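(* Let $q\in\mathbb{N}$, $q\ge2$, let $L$ be a locally compact group with neutral element $e_L$, and let $f:\overline{\mathbb D}\times L\to\mathbb{C}$ be continuous, where $\overline{\mathbb D}=\{z\in\mathbb{C}:|z|\le1\}$. Then the function $(A,u)\mapsto f(a_{11}(A),u)$ on $U(q)\times L$ (where $a_{11}(A)=Ae_1\cdot e_1$ is the upper left entry of $A$) is positive definite on the group $U(q)\times L$ if and only if there exists a double sequence $(\varphi^{q-2}_{m,n})_{m,n\ge0}$ of functions in $\mathcal P(L)$ with $\sum_{m,n\ge0}\varphi^{q-2}_{m,n}(e_L)<\infty$ such that $$f(z,u)=\sum_{m,n=0}^\infty\varphi^{q-2}_{m,n}(u)R^{q-2}_{m,n}(z),\qquad z\in\overline{\mathbb D},\ u\in L.$$ This expansion converges uniformly on $\overline{\mathbb D}\times L$, and $$\varphi^{q-2}_{m,n}(u)=N(q;m,n)\frac{q-1}{\pi}\int_0^1\int_0^{2\pi}f(re^{i\theta},u)\overline{R^{q-2}_{m,n}(re^{i\theta})}\,r(1-r^2)^{q-2}\,d\theta\,dr.$$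
   Context: $U(q)$ is the group of unitary $q\times q$ complex matrices, $e_1,\dots,e_q$ the standard basis of $\mathbb{C}^q$ and $z\cdot w=\sum_k z_k\overline{w_k}$. For a locally compact group $H$, a continuous $g:H\to\mathbb{C}$ is positive definite if $\sum_{j,k=1}^n g(x_j^{-1}x_k)c_j\overline{c_k}\ge0$ for all $n$, $x_j\in H$, $c_j\in\mathbb{C}$; $\mathcal P(H)$ is the set of such functions. For $\alpha,\beta>-1$ and $k\in\mathbb{N}_0$, $R^{(\alpha,\beta)}_k(x)=P^{(\alpha,\beta)}_k(x)/P^{(\alpha,\beta)}_k(1)$, where $P^{(\alpha,\beta)}_k$ is the Jacobi polynomial. The disc polynomials are $R^{\alpha}_{m,n}(re^{i\theta})=r^{|m-n|}e^{i(m-n)\theta}R^{(\alpha,|m-n|)}_{\min(m,n)}(2r^2-1)$ for $0\le r\le1$, $0\le\theta<2\pi$, $m,n\in\mathbb{N}_0$. Also $N(q;m,n)=\frac{m+n+q-1}{q-1}\binom{m+q-2}{q-2}\binom{n+q-2}{q-2}$. *)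

(* Defs.v *)
From HB Require Import structures.
From mathcomp Require Import all_boot all_order all_algebra.
From mathcomp Require Import all_classical all_reals all_analysis.
From mathcomp Require Import complex.
Set Implicit Arguments. Unset Strict Implicit. Unset Printing Implicit Defensive.
Import Order.TTheory GRing.Theory Num.Theory.
Import numFieldNormedType.Exports.
HB.instance Definition _ (R : realType) := NormedModule.copy R[i] R[i]^o.

Local Open Scope classical_set_scope.
Local Open Scope ring_scope.
Local Open Scope complex_scope.

Section Defs.
Variable R : realType.
Local Notation C := R[i].

Definition cconj (z : C) : C := conjc z.

Definition cdot (q : nat) (z w : 'cV[C]_q) : C := \sum_(k < q) z k ord0 * cconj (w k ord0).

Definition e1 (q : nat) : 'cV[C]_q := \col_(k < q) (nat_of_ord k == 0%N)%:R.

Definition a11 (q : nat) (A : 'M[C]_q) : C := cdot (A *m e1 q) (e1 q).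

Definition adjmx (q : nat) (A : 'M[C]_q) : 'M[C]_q := (map_mx cconj A)^T.

Definition unitary_mx (q : nat) : set 'M[C]_q := [set A | A *m adjmx A = 1%:M].

Definition gbinom (a : R) (j : nat) : R := (\prod_(i < j) (a - i%:R)) / (j`!)%:R.

Definition jacobiP (alpha beta : R) (k : nat) (x : R) : R :=
  \sum_(s < k.+1) gbinom (k%:R + alpha) (k - s) * gbinom (k%:R + beta) s
     * ((x - 1) / 2) ^+ s * ((x + 1) / 2) ^+ (k - s).

Definition jacobiR (alpha beta : R) (k : nat) (x : R) : R :=
  jacobiP alpha beta k x / jacobiP alpha beta k 1.

Definition cabs2 (z : C) : R := complex.Re z ^+ 2 + complex.Im z ^+ 2.

(** disc polynomial R^alpha_{m,n}(z).  For z = r e^{i theta}: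
    r^{|m-n|} e^{i(m-n)theta} = z^(m-n) if m >= n and conj(z)^(n-m) if m < n,
    and r^2 = |z|^2. *)
Definition discR (alpha : R) (m n : nat) (z : C) : C :=
  (if (n <= m)%N then z ^+ (m - n) else cconj z ^+ (n - m))
  * (jacobiR alpha `|(m%:Z - n%:Z)%R|%N%:R (minn m n) (2 * cabs2 z - 1))%:C.

Definition Nqmn (q m n : nat) : R :=
  (m + n + q - 1)%:R / (q - 1)%:R * 'C(m + q - 2, q - 2)%:R * 'C(n + q - 2, q - 2)%:R.

Definition polar (r t : R) : C := (r * cos t) +i* (r * sin t).

Definition cintegral (D : set R) (h : R -> C) : C :=
  (Rintegral lebesgue_measure D (fun x => complex.Re (h x)))%:C
  + 'i * (Rintegral lebesgue_measure D (fun x => complex.Im (h x)))%:C.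

End Defs.

(** Positive definiteness of g : H -> C on a group (given through its
    multiplication, inversion and carrier set D inside a topological type H):
    g is continuous on D and
    sum_{j,k} g(x_j^-1 x_k) c_j conj(c_k) >= 0 for all n, x_j in D, c_j in C. *)
Definition pos_def_on (R : realType) (H : topologicalType)
  (mul : H -> H -> H) (inv : H -> H) (D : set H) (g : H -> R[i]) : Prop :=
  {within D, continuous g} /\
  forall (n : nat) (x : 'I_n -> H) (c : 'I_n -> R[i]),
    (forall j, D (x j)) ->
    0 <= \sum_(j < n) \sum_(k < n) g (mul (inv (x j)) (x k)) * c j * cconj (c k).

Definition locally_compact_group (L : topologicalType)
  (mul : L -> L -> L) (inv : L -> L) (e : L) : Prop :=
  [/\ (forall x y z, mul x (mul y z) = mul (mul x y) z),
      (forall x, mul e x = x /\ mul x e = x) /\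
      (forall x, mul (inv x) x = e /\ mul x (inv x) = e),
      continuous (fun p : L * L => mul p.1 p.2),
      continuous inv &
      (hausdorff_space L /\ locally_compact [set: L])].

Section Expansion.
Variables (R : realType) (L : topologicalType).
Variables (mulL : L -> L -> L) (invL : L -> L) (eL : L).

Definition UL_mul (q : nat) (p p' : 'M[R[i]]_q * L) : 'M[R[i]]_q * L :=
  (p.1 *m p'.1, mulL p.2 p'.2).
Definition UL_inv (q : nat) (p : 'M[R[i]]_q * L) : 'M[R[i]]_q * L :=
  (adjmx p.1, invL p.2).
Definition UL_set (q : nat) : set ('M[R[i]]_q * L) := [set p | unitary_mx p.1].

Definition disc_psum (q : nat) (phi : nat -> nat -> L -> R[i]) (N : nat)
    (z : R[i]) (u : L) : R[i] :=
  \sum_(m < N) \sum_(n < N) phi m n u * discR (q - 2)%:R m n z.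

Definition disc_expansion (q : nat) (f : R[i] * L -> R[i])
    (phi : nat -> nat -> L -> R[i]) : Prop :=
  (forall m n, pos_def_on mulL invL setT (phi m n)) /\
  cvg ((fun N => \sum_(m < N) \sum_(n < N) phi m n eL) @ \oo) /\
      (forall z u, `|z| <= 1 ->
         (fun N => disc_psum q phi N z u) @ \oo --> f (z, u)).

End Expansion.

(* Main.v *)
(** Write q = a + 2. For unit vectors x_j of C^q, multiplying a positive semidefinite kernel K_jk by
    R_{m,n}(x_k . x_j) keeps it positive semidefinite: up to a positive factor R_{m,n}(x_k . x_j) is
    the average over unit vectors e of
      (x_k . e)^m (e . x_j)^m (x_j . x_k - (x_j . e)(e . x_k))^n,
    where the last base is the inner product of projections onto the complement of e. Averages over
    the sphere are limits of explicit finite quadratures, so no integration on the sphere or the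
    unitary group is needed; by Householder reflections, positive definiteness on U(q) x L only
    involves such kernels.

    If f(a_11, .) is positive definite, averaging f conj(R_{m,n}) over the disc therefore gives
    coefficients phi_{m,n} that are positive definite. Testing f(., e) against the kernels
    |sum_(j <= s) binom(j + q - 1, q - 1) z^j|^2, which are positive definite polynomials
    concentrating at z = 1, yields sum phi_{m,n}(e) <= f(1, e). Since |phi_{m,n}(u)| <= phi_{m,n}(e)
    and |R_{m,n}| <= 1, the expansion converges uniformly; its sum has the same coefficients as
    f(., u), hence equals it, because the monomials z^m conj(z)^n span a dense subspace and are
    combinations of disc polynomials. Conversely, every term of such an expansion is positive
    definite by the multiplier property. *)
Require Import Defs.
From HB Require Import structures.
From mathcomp Require Import all_boot all_order all_algebra.
From mathcomp Require Import all_classical all_reals all_analysis.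
From mathcomp Require Import complex ring lra zify.
Set Implicit Arguments. Unset Strict Implicit. Unset Printing Implicit Defensive.
Import Order.TTheory GRing.Theory Num.Theory.
Import numFieldNormedType.Exports.
Local Open Scope classical_set_scope.
Local Open Scope ring_scope.
Local Notation "x %:C" := (real_complex _ x) : ring_scope.
Local Notation "R [i]" := (complex R) : type_scope.
Local Notation "x ^*" := (cconj x) : ring_scope.

(** In polar coordinates the weight r (1 - r^2)^(q-2) is, up to normalisation, the law of x . y for
    independent uniform unit vectors x, y of C^q. This is why averaging over the disc keeps
    positivity: the mean of G is a limit of double sums of w_x w_y G(y . x) over quadrature nodes,
    that is, of the quadratic form of G at the nodes with the weights as coefficients. The limits of
    the quadratures are identified by moments alone: the nodes are built recursively in the
    dimension, and moments of monomials obey the recursion of Beta integrals. The numbers binom(j +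
    q - 1, q - 1) are the inverses of the means of |z|^(2j), so the polynomial inside the square is
    the reproducing kernel at 1 of the polynomials of degree at most s in z. The mean of its square
    grows like s^q, but only like s^(q-1) after multiplication by 1 - z; this gap is the
    concentration at 1. *)

HB.instance Definition _ (R : realType) := GRing.RMorphism.copy (@cconj R) (@conjc R).

(** * Disc polynomials *)

Section Binomial.
Variable F : numFieldType.

Lemma natS_neq0 (n : nat) : (n.+1%:R : F) != 0.
Proof. by rewrite pnatr_eq0. Qed.

Lemma fact_neq0 (n : nat) : (n`!%:R : F) != 0.
Proof. by rewrite pnatr_eq0 -lt0n fact_gt0. Qed.

(** Pascal's rule writes an alternating difference of order n + 1 as a difference of two of order n;
    it is the induction step of [sum_beta] and [sum_alt_bin]. *)
Lemma sum_alt_pascal (n : nat) (f : nat -> F) :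
  \sum_(s < n.+2) (-1) ^+ s * 'C(n.+1, s)%:R * f s =
  \sum_(s < n.+1) (-1) ^+ s * 'C(n, s)%:R * f s
  - \sum_(s < n.+1) (-1) ^+ s * 'C(n, s)%:R * f s.+1.
Proof.
rewrite big_ord_recl /= bin0 [in RHS]big_ord_recl /= bin0 -addrA; congr (_ + _).
under eq_bigr => i _ do rewrite /bump /= binS natrD mulrDr mulrDl.
rewrite big_split /= big_ord_recr /= bin_small // mulr0 mul0r addr0.
by congr (_ + _); rewrite -sumrN; apply: eq_bigr => i _; rewrite exprS; ring.
Qed.

(** The factorial quotient is 1/A! times the integral of x^(m+t) (1-x)^A over [0, 1]. The
    alternating sum inserts (1-x)^k, which gives another Beta integral. *)
Lemma sum_beta (A k m : nat) :
  \sum_(t < k.+1) (-1) ^+ t * 'C(k, t)%:R * ((m + t)`!%:R / (m + t + A.+1)`!%:R) =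
  m`!%:R * (A + k)`!%:R / (A`!%:R * (m + k + A.+1)`!%:R) :> F.
Proof.
elim: k m => [|k IH] m.
  by rewrite big_ord1 expr0 bin0 !addn0; field; rewrite ?fact_neq0.
rewrite (sum_alt_pascal k (fun t => (m + t)`!%:R / (m + t + A.+1)`!%:R)) IH.
under eq_bigr => i _ do rewrite -(addSnnS m i).
rewrite (IH m.+1) factS !addnS !addSn factS [(A + k).+1`!]factS !natrM.
have h1 : ((m + k + A).+2%:R : F) != 0 by exact: natS_neq0.
have h2 := fact_neq0 A; have h3 : (1 + (m%:R + k%:R + A%:R) : F) != 0 by rewrite -!natrD nat1r natS_neq0.
rewrite (_ : (m + k + A).+2%:R = (m%:R + k%:R + A%:R + 2 : F)) in h1 *; last first.
  by rewrite -[(_).+2]addn2 !natrD.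
rewrite (_ : m.+1%:R = (m%:R + 1 : F)); last by rewrite natr1.
rewrite (_ : (A + k).+1%:R = (A%:R + k%:R + 1 : F)); last by rewrite -natr1 natrD.
by field; rewrite h1 h2 h3 fact_neq0.
Qed.

(** Each backward difference of x -> binom(x, l) lowers both arguments by one, and a difference of
    order above l kills this polynomial of degree l. *)
Lemma sum_alt_bin (n x l : nat) : (n <= x)%N ->
  \sum_(s < n.+1) (-1) ^+ s * 'C(n, s)%:R * 'C(x - s, l)%:R =
  (if (n <= l)%N then 'C(x - n, l - n)%:R else 0) :> F.
Proof.
elim: n x l => [|n IH] x l nx; first by rewrite big_ord1 expr0 bin0 !subn0 !mul1r.
case: x nx => // x nx.
rewrite (sum_alt_pascal n (fun s => 'C(x.+1 - s, l)%:R)) -sumrB.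
case: l => [|l].
  by rewrite ltn0 big1 // => i _; rewrite !bin0 subrr.
rewrite ltnS !subSS -IH //; apply: eq_bigr => i _.
rewrite subSS subSn ?binS ?natrD; last by rewrite -ltnS (leq_trans _ nx).
ring.
Qed.

Lemma bin_ratio (alpha k s : nat) : (s <= k)%N ->
  'C(k + alpha, k - s)%:R / 'C(k + alpha, k)%:R
   = 'C(k, s)%:R * (s`!%:R * alpha`!%:R / (alpha + s)`!%:R) :> F.
Proof.
move=> hs.
have h1 := fact_neq0.
have e1 := bin_fact (leq_addr alpha k); rewrite addKn in e1.
have e2 : ('C(k + alpha, k - s) * ((k - s)`! * (alpha + s)`!) = (k + alpha)`!)%N.
  rewrite -(@bin_fact (k + alpha) (k - s)); last by lia.
  by congr (_ * (_ * _`!))%N; lia.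
have e3 := bin_fact hs.
move: (congr1 (fun n => n%:R : F) e1) (congr1 (fun n => n%:R : F) e2) (congr1 (fun n => n%:R : F) e3).
rewrite !natrM => f1 f2 f3.
have -> : 'C(k + alpha, k - s)%:R = (k + alpha)`!%:R / ((k - s)`!%:R * (alpha + s)`!%:R) :> F.
  by rewrite -f2; field; rewrite !h1.
have -> : 'C(k + alpha, k)%:R = (k + alpha)`!%:R / (k`!%:R * alpha`!%:R) :> F.
  by rewrite -f1; field; rewrite !h1.
have -> : 'C(k, s)%:R = k`!%:R / (s`!%:R * (k - s)`!%:R) :> F.
  by rewrite -f3; field; rewrite !h1.
by field; rewrite !h1.
Qed.

End Binomial.

Section DiscPoly.
Variable R : realType.
Local Notation C := R[i].

Lemma gbinom_nat (N j : nat) : @gbinom R N%:R j = 'C(N, j)%:R.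
Proof.
rewrite /gbinom.
have -> : \prod_(i < j) (N%:R - i%:R) = (N ^_ j)%:R :> R.
  elim: j => [|j IH]; first by rewrite big_ord0 ffactn0.
  rewrite big_ord_recr /= IH ffactnSr natrM.
  case: (leqP j N) => h; first by rewrite natrB.
  by rewrite ffact_small // !mul0r.
by rewrite -bin_ffact natrM mulfK // pnatr_eq0 -lt0n fact_gt0.
Qed.

(** Coefficients of the terminating hypergeometric series 2F1(-m, -n; alpha + 1; x) at x = -(1 -
    zw)/(zw), multiplied by z^m w^n in [disc_poly]. Their symmetry in m and n removes the case
    distinction made in [discR]. *)
Definition disc_coef (alpha m n s : nat) : C :=
  (-1) ^+ s * 'C(m, s)%:R * 'C(n, s)%:R * (s`!%:R * alpha`!%:R / (alpha + s)`!%:R).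

(* At w = conj z this is the disc polynomial, expanded in powers of 1 - |z|^2. *)
Definition disc_poly (alpha m n : nat) (z w : C) : C :=
  \sum_(s < n.+1) disc_coef alpha m n s
    * ((1 - z * w) ^+ s * (z ^+ (m - s) * w ^+ (n - s))).

Lemma disc_coefC (alpha m n s : nat) : disc_coef alpha m n s = disc_coef alpha n m s.
Proof. by rewrite /disc_coef (mulrAC ((-1) ^+ s)). Qed.

(** A binomial vanishes past [minn m n], so the cut-off is free, and the truncated subtractions m -
    s and n - s matter only in null terms. *)
Lemma disc_poly_le (alpha m n N : nat) (z w : C) : (minn m n <= N)%N ->
  disc_poly alpha m n z w = \sum_(s < N.+1) disc_coef alpha m n s
    * ((1 - z * w) ^+ s * (z ^+ (m - s) * w ^+ (n - s))).
Proof.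
pose f s := disc_coef alpha m n s * ((1 - z * w) ^+ s * (z ^+ (m - s) * w ^+ (n - s))).
have f0 s : (minn m n < s)%N -> f s = 0.
  rewrite gtn_min /f /disc_coef => /orP[] h;
    by rewrite (bin_small h) !(mulr0, mul0r).
have aux K : (minn m n <= K)%N -> \sum_(s < K.+1) f s = \sum_(s < (minn m n).+1) f s.
  move=> h; rewrite -!(big_mkord xpredT f) (big_cat_nat (n := (minn m n).+1)) //=.
  rewrite [X in _ + X]big1_seq ?addr0 // => i; rewrite mem_index_iota => /andP[_ /andP[h1 _]].
  exact: f0.
by move=> h; rewrite /disc_poly !(aux _) // geq_minr.
Qed.

Lemma disc_polyC (alpha m n : nat) (z w : C) :
  disc_poly alpha m n z w = disc_poly alpha n m w z.
Proof.
rewrite (@disc_poly_le _ m n m) ?geq_minl // /disc_poly; apply: eq_bigr => i _.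
by rewrite disc_coefC (mulrC z w) [z ^+ _ * _]mulrC.
Qed.

Lemma cconjK : involutive (@cconj R).
Proof. exact: conjcK. Qed.

Lemma cconjM (x y : C) : (x * y)^* = x^* * y^*.
Proof. exact: (rmorphM (@cconj R)). Qed.

Lemma cconjD (x y : C) : (x + y)^* = x^* + y^*.
Proof. exact: (rmorphD (@cconj R)). Qed.

Lemma cconjX (x : C) n : (x ^+ n)^* = x^* ^+ n.
Proof. exact: (rmorphXn (@cconj R)). Qed.

Lemma cconj_sum (I : Type) (s : seq I) (P : pred I) (F : I -> C) :
  (\sum_(i <- s | P i) F i)^* = \sum_(i <- s | P i) (F i)^*.
Proof. exact: (rmorph_sum (@cconj R)). Qed.

Lemma conj_realC (t : R) : (t%:C)^* = t%:C.
Proof. exact: conjc_real. Qed.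

Lemma conj_disc_coef alpha m n s : (disc_coef alpha m n s)^* = disc_coef alpha m n s.
Proof. by rewrite /disc_coef !rmorphM rmorphXn fmorphV !rmorph_nat rmorphN1. Qed.

Lemma conj_disc_poly (alpha m n : nat) (z w : C) :
  (disc_poly alpha m n z w)^* = disc_poly alpha m n z^* w^*.
Proof.
rewrite rmorph_sum /=; apply: eq_bigr => i _.
by rewrite rmorphM /= conj_disc_coef !rmorphM !rmorphXn rmorphB rmorphM rmorph1.
Qed.

Lemma cabs2E (z : C) : (cabs2 z)%:C = z * z^*.
Proof. by rewrite add_Re2_Im2 sqr_normc. Qed.

Lemma cabs2J (z : C) : cabs2 z^* = cabs2 z.
Proof. by case: z => a b; rewrite /cabs2 /= sqrrN. Qed.

Lemma jacobiR_nat (alpha b k : nat) (x : R) :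
  jacobiR alpha%:R b%:R k (2 * x - 1) =
  \sum_(s < k.+1) ((-1) ^+ s * 'C(k + b, s)%:R * 'C(k, s)%:R
     * (s`!%:R * alpha`!%:R / (alpha + s)`!%:R)) * ((1 - x) ^+ s * x ^+ (k - s)).
Proof.
have H1 : jacobiP alpha%:R b%:R k 1 = 'C(k + alpha, k)%:R :> R.
  rewrite /jacobiP big_ord_recl big1 => [|i _]; last first.
    by rewrite subrr mul0r /bump /= exprS mul0r !(mulr0, mul0r).
  rewrite addr0 subn0 -!natrD !gbinom_nat bin0 expr0 (_ : (1 + 1) / 2 = 1) ?expr1n ?mulr1 //.
  by field.
rewrite /jacobiR H1 /jacobiP mulr_suml; apply: eq_bigr => -[s /= hs] _; rewrite ltnS in hs.
rewrite -!natrD !gbinom_nat.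
rewrite (_ : (2 * x - 1 - 1) / 2 = - (1 - x)); last by field.
rewrite (_ : (2 * x - 1 + 1) / 2 = x); last by field.
rewrite (exprNn (1 - x)).
have hC := bin_ratio R alpha hs.
transitivity ('C(k + alpha, k - s)%:R / 'C(k + alpha, k)%:R * (-1) ^+ s * 'C(k + b, s)%:R * ((1 - x) ^+ s * x ^+ (k - s))); first by ring.
by rewrite hC; ring.
Qed.

Lemma discRE (alpha m n : nat) (z : C) :
  discR alpha%:R m n z = disc_poly alpha m n z z^*.
Proof.
wlog: m n z / (n <= m)%N => [H|nm].
  case: (leqP n m) => [|mn]; first exact: H.
  rewrite disc_polyC; have := H n m z^* (ltnW mn); rewrite cconjK => <-.
  rewrite /discR leqNgt mn /= (ltnW mn) /= minnC.
  by rewrite cabs2J distnC.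
rewrite /discR nm /= (minn_idPr nm) distnEl // /disc_poly.
rewrite jacobiR_nat rmorph_sum mulr_sumr; apply: eq_bigr => -[s /= hs] _.
rewrite ltnS in hs.
rewrite !rmorphM /= fmorphV !rmorphXn /= rmorphB /= rmorph1 cabs2E !rmorph_nat rmorphN1.
rewrite subnKC // /disc_coef.
rewrite (_ : (m - s)%N = ((m - n) + (n - s))%N); last by lia.
rewrite exprD exprMn.
by ring.
Qed.

End DiscPoly.

(** * Continuous functions on the closed disc *)

Section ComplexTopology.
Variable R : realType.
Local Notation C := R[i].

(** A modulus with values in [R]: the norm of [R[i]] takes its values in [R[i]], whose order is only
    partial. *)
Definition nrm (z : C) : R := Num.sqrt (cabs2 z).

Lemma normE (z : C) : `|z| = (nrm z)%:C.
Proof. by rewrite normc_def. Qed.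

Lemma nrm_ge0 z : 0 <= nrm z. Proof. exact: sqrtr_ge0. Qed.

Lemma cabs2_ge0 (z : C) : 0 <= cabs2 z. Proof. by rewrite addr_ge0 ?sqr_ge0. Qed.

Lemma sqr_nrm z : nrm z ^+ 2 = cabs2 z.
Proof. by rewrite sqr_sqrtr ?cabs2_ge0. Qed.

Lemma nrm0 : nrm 0 = 0.
Proof. by rewrite /nrm /cabs2 /= expr0n addr0 sqrtr0. Qed.

Lemma nrm1 : nrm 1 = 1.
Proof. by rewrite /nrm /cabs2 /= expr0n addr0 expr1n sqrtr1. Qed.

Lemma nrmM z w : nrm (z * w) = nrm z * nrm w.
Proof. by apply: complexI; rewrite rmorphM /= -!normE normrM. Qed.

Lemma nrmN z : nrm (- z) = nrm z.
Proof. by apply: complexI; rewrite -!normE normrN. Qed.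

Lemma nrmJ z : nrm z^* = nrm z.
Proof. by rewrite /nrm cabs2J. Qed.

Lemma nrmBC z w : nrm (z - w) = nrm (w - z).
Proof. by rewrite -opprB nrmN. Qed.

Lemma nrmD z w : nrm (z + w) <= nrm z + nrm w.
Proof. by rewrite -lecR rmorphD /= -!normE ler_normD. Qed.

Lemma nrm_tri y z w : nrm (z - w) <= nrm (z - y) + nrm (y - w).
Proof. by apply: le_trans (nrmD _ _); rewrite addrA subrK. Qed.

Lemma nrm_real (x : R) : nrm x%:C = `|x|.
Proof. by rewrite /nrm /cabs2 /= expr0n addr0 sqrtr_sqr. Qed.

Lemma nrm_eq0 z : nrm z = 0 -> z = 0.
Proof. by move=> h; apply/eqP; rewrite -normr_eq0 normE h. Qed.

Lemma nrm_sum (I : Type) (s : seq I) (P : pred I) (F : I -> C) :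
  nrm (\sum_(i <- s | P i) F i) <= \sum_(i <- s | P i) nrm (F i).
Proof.
rewrite -lecR rmorph_sum /= -normE; apply: le_trans (ler_norm_sum _ _ _) _.
by rewrite le_eqVlt; apply/orP; left; apply/eqP/eq_bigr => i _; rewrite normE.
Qed.

Lemma nrm_Re z : `|complex.Re z| <= nrm z.
Proof. by rewrite /nrm -sqrtr_sqr ler_wsqrtr // lerDl sqr_ge0. Qed.

Lemma nrm_Im z : `|complex.Im z| <= nrm z.
Proof. by rewrite /nrm -sqrtr_sqr ler_wsqrtr // lerDr sqr_ge0. Qed.

Lemma nrm_ReIm z : nrm z <= `|complex.Re z| + `|complex.Im z|.
Proof.
rewrite {1}[z]complexE; apply: le_trans (nrmD _ _) _; rewrite nrmM !nrm_real.
by rewrite (_ : nrm 'i%C = 1) ?mul1r // /nrm /cabs2 /= expr0n add0r expr1n sqrtr1.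
Qed.

Lemma ge0C (z : C) : 0 <= z -> z = (nrm z)%:C.
Proof. by move=> h; rewrite -normE ger0_norm. Qed.

Lemma le1C (z : C) : (`|z| <= 1) = (nrm z <= 1).
Proof. by rewrite normE -lecR. Qed.

Lemma cvgCP (T : Type) (F : set_system T) (f : T -> C) (l : C) : Filter F ->
  (f @ F --> l) <-> (forall e : R, 0 < e -> \forall x \near F, nrm (l - f x) < e).
Proof.
move=> FF; split => [/cvgrPdist_lt h e e0|h].
  have := h e%:C; rewrite ltcR => /(_ e0); apply: filterS => x.
  by rewrite normE ltcR.
apply/cvgrPdist_lt => e e0.
have e0' := ltW e0.
have ee := ge0C e0'.
move: e0; rewrite ee ltcR => /h; apply: filterS => x.
by rewrite normE ltcR.
Qed.

Lemma nbhsCP (z : C) (A : set C) :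
  nbhs z A <-> exists2 e : R, 0 < e & forall u, nrm (z - u) < e -> A u.
Proof.
split.
  move=> /(@nbhs_ballP C C z) [e /= e0 h].
  have ee := ge0C (ltW e0); exists (nrm e); first by rewrite -ltcR -ee.
  by move=> u hu; apply: h; rewrite -ball_normE /= normE ee ltcR.
move=> [e e0 h]; apply/nbhs_ballP; exists e%:C; first by rewrite /= ltcR.
by move=> u; rewrite -ball_normE /= normE ltcR => /h.
Qed.

Lemma cvg_Re (T : Type) (F : set_system T) (f : T -> C) (l : C) : Filter F ->
  f @ F --> l -> complex.Re (f x) @[x --> F] --> complex.Re l.
Proof.
move=> FF /cvgCP h; apply/cvgrPdist_lt => e /h; apply: filterS => x.
by apply: le_lt_trans; rewrite -raddfB; exact: nrm_Re.
Qed.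

Lemma cvg_Im (T : Type) (F : set_system T) (f : T -> C) (l : C) : Filter F ->
  f @ F --> l -> complex.Im (f x) @[x --> F] --> complex.Im l.
Proof.
move=> FF /cvgCP h; apply/cvgrPdist_lt => e /h; apply: filterS => x.
by apply: le_lt_trans; rewrite -raddfB; exact: nrm_Im.
Qed.

Lemma cvg_Complex (T : Type) (F : set_system T) (f g : T -> R) (a b : R) : Filter F ->
  f @ F --> a -> g @ F --> b -> Complex (f x) (g x) @[x --> F] --> Complex a b.
Proof.
move=> FF /cvgrPdist_lt hf /cvgrPdist_lt hg; apply/cvgCP => e e0.
have e2 : 0 < e / 2 by rewrite divr_gt0.
near=> x.
apply: le_lt_trans (nrm_ReIm _) _ => /=; rewrite [ltRHS](splitr e) ltrD //.
  by near: x; exact: hf.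
by near: x; exact: hg.
Unshelve. all: by end_near. Qed.

Lemma cvg_realC (T : Type) (F : set_system T) (f : T -> R) (a : R) : Filter F ->
  f @ F --> a -> (f x)%:C @[x --> F] --> a%:C.
Proof. by move=> FF h; apply: cvg_Complex => //; exact: cvg_cst. Qed.

Lemma cvg_nrm (T : Type) (F : set_system T) (f : T -> C) (l : C) : Filter F ->
  f @ F --> l -> nrm (f x) @[x --> F] --> nrm l.
Proof.
move=> FF /cvgCP h; apply/cvgrPdist_lt => e /h; apply: filterS => x.
apply: le_lt_trans; rewrite ler_norml; apply/andP; split.
  by rewrite lerNl opprB lerBlDl -[X in nrm X <= _](subrK l) addrC nrmBC (le_trans (nrmD _ _)) // addrC.
by rewrite lerBlDl -{1}[l](subrK (f x)) addrC nrmD.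
Qed.

Lemma cvgCD (T : Type) (F : set_system T) (f g : T -> C) (a b : C) : Filter F ->
  f @ F --> a -> g @ F --> b -> f x + g x @[x --> F] --> a + b.
Proof.
move=> FF /cvgCP hf /cvgCP hg; apply/cvgCP => e e0.
have e2 : 0 < e / 2 by rewrite divr_gt0.
near=> x.
have := nrmD (a - f x) (b - g x); rewrite addrACA -opprD => /le_lt_trans; apply.
rewrite [ltRHS](splitr e) ltrD //; near: x; [exact: hf|exact: hg].
Unshelve. all: by end_near. Qed.

Lemma cvgCM (T : Type) (F : set_system T) (f g : T -> C) (a b : C) : Filter F ->
  f @ F --> a -> g @ F --> b -> f x * g x @[x --> F] --> a * b.
Proof.
move=> FF /cvgCP hf /cvgCP hg; apply/cvgCP => e e0.
have a0 : 0 < nrm a + 1 by rewrite ltr_wpDl ?nrm_ge0.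
have b0 : 0 < nrm b + 1 by rewrite ltr_wpDl ?nrm_ge0.
have ea : 0 < e / 2 / (nrm a + 1) by rewrite !divr_gt0.
have eb : 0 < e / 2 / (nrm b + 1) by rewrite !divr_gt0.
near=> x.
have h1 : nrm (a - f x) < e / 2 / (nrm b + 1) by near: x; exact: hf.
have h2 : nrm (b - g x) < e / 2 / (nrm a + 1) by near: x; exact: hg.
have h3 : nrm (b - g x) < 1 by near: x; exact: hg.
have hg1 : nrm (g x) <= nrm b + 1.
  by have := nrm_tri b (g x) 0; rewrite !subr0 (nrmBC (g x)); lra.
have -> : a * b - f x * g x = a * (b - g x) + (a - f x) * g x by ring.
apply: le_lt_trans (nrmD _ _) _; rewrite !nrmM [ltRHS](splitr e).
have H1 : nrm a * nrm (b - g x) <= e / 2.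
  have := ltW h2; rewrite ler_pdivlMr // => h; apply: le_trans h.
  by rewrite mulrC ler_wpM2l ?nrm_ge0 // lerDl.
have H2 : nrm (a - f x) * nrm (g x) < e / 2.
  move: h1; rewrite ltr_pdivlMr // => h; apply: le_lt_trans h.
  by rewrite ler_wpM2l ?nrm_ge0.
by rewrite ler_ltD.
Unshelve. all: by end_near. Qed.

Lemma cvgC_sum (T : Type) (F : set_system T) (I : Type) (s : seq I) (P : pred I)
    (f : I -> T -> C) (a : I -> C) : Filter F ->
  (forall i, f i @ F --> a i) ->
  \sum_(i <- s | P i) f i x @[x --> F] --> \sum_(i <- s | P i) a i.
Proof.
move=> FF h; elim: s => [|i s IH].
  by rewrite big_nil; under eq_fun do rewrite big_nil; exact: cvg_cst.
rewrite big_cons; under eq_fun do rewrite big_cons.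
case: (P i); last exact: IH.
by apply: cvgCD; [exact: h|exact: IH].
Qed.

Definition cdisc : set C := [set z | `|z| <= 1].

Lemma cdiscE z : cdisc z = (nrm z <= 1).
Proof. by rewrite /cdisc /= le1C. Qed.

Lemma compact_cdisc : compact cdisc.
Proof.
pose g (p : R * R) : C := Complex p.1 p.2.
have cg : continuous g.
  by move=> p; apply: cvg_Complex; [exact: cvg_fst|exact: cvg_snd].
have cK : compact (g @` (`[-1, 1]%classic `*` `[-1, 1]%classic)).
  apply: continuous_compact; first exact: continuous_subspaceT.
  by apply: compact_setX; exact: segment_compact.
apply: (subclosed_compact _ cK).
  rewrite (_ : cdisc = nrm @^-1` [set x | x <= 1]); last first.
    by apply/seteqP; split => z; rewrite cdiscE.
  apply: closed_comp; last exact: closed_le.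
  by move=> z _; apply: (@cvg_nrm _ (nbhs z) id z).
move=> z; rewrite cdiscE => hz; exists (complex.Re z, complex.Im z); last by case: z hz.
by split => /=; rewrite in_itv /= -ler_norml; apply: le_trans hz; [exact: nrm_Re|exact: nrm_Im].
Qed.

(* An inductive wrapper keeps unification from unfolding the filters in the definition of continuity. *)
Variant contD (F : C -> C) : Prop := ContD of {within cdisc, continuous F}.

Lemma contDP F : contD F <-> forall w, cdisc w -> forall e : R, 0 < e ->
  exists2 d : R, 0 < d & forall u, cdisc u -> nrm (w - u) < d -> nrm (F w - F u) < e.
Proof.
split.
  move=> [/subspace_continuousP h] w Dw e e0.
  have /cvgCP/(_ e e0) := h w Dw.
  rewrite near_withinE => /nbhsCP [d d0 hd]; exists d => // u Du hu.
  exact: hd.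
move=> h; split; apply/subspace_continuousP => w Dw; apply/cvgCP => e e0.
have [d d0 hd] := h w Dw e e0.
by rewrite near_withinE; apply/nbhsCP; exists d => // u hu Du; exact: hd.
Qed.

Lemma cabs2_nrm_lt (z : C) (d : R) : 0 <= d -> d <= nrm z -> d ^+ 2 <= cabs2 z.
Proof. by move=> d0 h; rewrite -sqr_nrm lerXn2r // nnegrE nrm_ge0. Qed.

(* A quantitative Heine-Cantor statement: the quadratic error term absorbs all pairs of distant points. *)
Lemma contD_modulus F : contD F -> forall e : R, 0 < e ->
  exists2 K : R, 0 <= K & forall u w, cdisc u -> cdisc w ->
    nrm (F u - F w) <= e + K * cabs2 (u - w).
Proof.
move=> /contDP cF e e0.
have /compact_near_coveringP cc := compact_setX compact_cdisc compact_cdisc.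
pose P (K : R) (p : C * C) := cdisc p.1 -> cdisc p.2 ->
  nrm (F p.1 - F p.2) <= e + K * cabs2 (p.1 - p.2).
(* Compactness is used as a near-covering property with K running along the filter at +oo, which
   merges the local bounds into a single K. *)
suff : \forall K \near +oo, (cdisc `*` cdisc) `<=` P K.
  move=> [K0 [_ h]]; exists (`|K0| + 1); first by rewrite addr_ge0.
  move=> u w Du Dw; apply: (h (`|K0| + 1) _ (u, w)) => //.
  by rewrite (le_lt_trans (ler_norm _)) // ltrDl.
apply: cc => -[u0 w0] [/= Du0 Dw0].
have e2 : 0 < e / 2 by rewrite divr_gt0.
have [d1 d10 h1] := cF _ Du0 _ e2.
have [d2 d20 h2] := cF _ Dw0 _ e2.
pose d0 := nrm (u0 - w0).
have key u w : cdisc u -> cdisc w -> nrm (u0 - u) < d1 -> nrm (w0 - w) < d2 ->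
    nrm (F u - F w) <= e + nrm (F u0 - F w0).
  move=> Du Dw hu hw.
  have := h1 u Du hu; have := h2 w Dw hw.
  have := nrm_tri (F u0) (F u) (F w); have := nrm_tri (F w0) (F u0) (F w).
  rewrite (nrmBC (F u) (F u0)); lra.
have [dz|dn] := eqVneq d0 0.
  have uw : u0 = w0 by apply/eqP; rewrite -subr_eq0; apply/eqP/nrm_eq0.
  exists ([set p : C * C | nrm (u0 - p.1) < d1 /\ nrm (w0 - p.2) < d2], [set K : R | 0 <= K]) => /=.
    split; last by apply: nbhs_pinfty_ge; rewrite num_real.
    exists ([set u | nrm (u0 - u) < d1], [set w | nrm (w0 - w) < d2]) => //=.
    by split; apply/nbhsCP; [exists d1|exists d2].
  move=> [[u w] K] /= [[hu hw] K0] Du Dw /=.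
  apply: le_trans (key _ _ Du Dw hu hw) _.
  by rewrite uw subrr nrm0 addr0 lerDl mulr_ge0 // cabs2_ge0.
have dp : 0 < d0 by rewrite lt_neqAle eq_sym dn nrm_ge0.
have d4 : 0 < d0 / 4 by rewrite divr_gt0.
(* Near a pair off the diagonal, |u - w| stays above d0 / 2, so K at least B makes the quadratic
   term alone exceed |F u0 - F w0|. *)
pose B := nrm (F u0 - F w0) / (d0 / 2) ^+ 2.
exists ([set p : C * C | nrm (u0 - p.1) < Num.min d1 (d0 / 4) /\ nrm (w0 - p.2) < Num.min d2 (d0 / 4)],
  [set K : R | B <= K]) => /=.
  split; last by apply: nbhs_pinfty_ge; rewrite num_real.
  exists ([set u | nrm (u0 - u) < Num.min d1 (d0 / 4)], [set w | nrm (w0 - w) < Num.min d2 (d0 / 4)]) => //=.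
  by split; apply/nbhsCP; [exists (Num.min d1 (d0 / 4))|exists (Num.min d2 (d0 / 4))];
   rewrite // lt_min ?d10 ?d20.
move=> [[u w] K] /= [[]]; rewrite !lt_min => /andP[hu hu'] /andP[hw hw'] BK Du Dw /=.
apply: le_trans (key _ _ Du Dw hu hw) _; rewrite lerD2l.
have hd : d0 / 2 <= nrm (u - w).
  have := nrm_tri u u0 w0; have := nrm_tri w u w0.
  rewrite -/d0 (nrmBC w w0); lra.
have hc := cabs2_nrm_lt (ltW (divr_gt0 dp (ltr0Sn R 1))) hd.
rewrite -(@divfK _ ((d0 / 2) ^+ 2) _ (nrm (F u0 - F w0))); last first.
  by rewrite expf_neq0 // gt_eqF // divr_gt0.
by rewrite ler_pM // ?sqr_ge0 // divr_ge0 ?nrm_ge0 ?sqr_ge0.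
Qed.

Lemma contD_bounded F : contD F ->
  exists2 B : R, 0 <= B & forall u, cdisc u -> nrm (F u) <= B.
Proof.
move=> /contD_modulus/(_ 1 ltr01) [K K0 h].
exists (nrm (F 0) + (1 + K)).
  by rewrite !addr_ge0 // nrm_ge0.
have D0 : cdisc 0 by rewrite cdiscE nrm0.
move=> u Du; rewrite -lerBlDl.
have := h u 0 Du D0; have := nrm_tri (F 0) (F u) 0; rewrite !subr0.
have : K * cabs2 u <= K.
  by rewrite ler_piMr // -sqr_nrm exprn_ile1 ?nrm_ge0 // -cdiscE.
lra.
Qed.

Lemma contD_cst (c : C) : contD (fun=> c).
Proof. by apply/contDP => w _ e e0; exists 1 => // u _ _; rewrite subrr nrm0. Qed.

Lemma contD_id : contD id.
Proof. by apply/contDP => w _ e e0; exists e. Qed.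

Lemma contDJ F : contD F -> contD (fun z => (F z)^*).
Proof.
move=> /contDP h; apply/contDP => w Dw e e0; have [d d0 hd] := h w Dw e e0.
by exists d => // u Du hu; rewrite -rmorphB nrmJ hd.
Qed.

Lemma contDD F G : contD F -> contD G -> contD (fun z => F z + G z).
Proof.
move=> [/subspace_continuousP hF] [/subspace_continuousP hG].
by split; apply/subspace_continuousP => w Dw; apply: cvgCD; [exact: hF|exact: hG].
Qed.

Lemma contDM F G : contD F -> contD G -> contD (fun z => F z * G z).
Proof.
move=> [/subspace_continuousP hF] [/subspace_continuousP hG].
by split; apply/subspace_continuousP => w Dw; apply: cvgCM; [exact: hF|exact: hG].
Qed.

Lemma contDZ (c : C) F : contD F -> contD (fun z => c * F z).
Proof. by move=> hF; exact: (contDM (contD_cst c) hF). Qed.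

Lemma contDN F : contD F -> contD (fun z => - F z).
Proof. by move=> h; under eq_fun do rewrite -mulN1r; exact: (contDZ (-1) h). Qed.

Lemma contDB F G : contD F -> contD G -> contD (fun z => F z - G z).
Proof. by move=> hF hG; exact: (contDD hF (contDN hG)). Qed.

Lemma contDX F n : contD F -> contD (fun z => F z ^+ n).
Proof.
move=> hF; elim: n => [|n IH]; first exact: contD_cst.
by under eq_fun do rewrite exprS; apply: contDM; [exact: hF|exact: IH].
Qed.

Lemma contD_sum (I : Type) (s : seq I) (P : pred I) (F : I -> C -> C) :
  (forall i, contD (F i)) -> contD (fun z => \sum_(i <- s | P i) F i z).
Proof.
move=> hF; elim: s => [|a s IH].
  by under eq_fun do rewrite big_nil; exact: contD_cst.
under eq_fun do rewrite big_cons; case: (P a); last exact: IH.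
by apply: contDD; [exact: hF|exact: IH].
Qed.

Lemma contD_disc_poly a m n : contD (fun z => disc_poly a m n z z^*).
Proof.
apply: contD_sum => i; apply/contDZ/contDM.
  apply/contDX/contDB; first exact: contD_cst.
  by apply: contDM; [exact: contD_id|exact/contDJ/contD_id].
by apply/contDM; apply/contDX; [exact: contD_id|exact/contDJ/contD_id].
Qed.

End ComplexTopology.

(** * Integration over the disc and orthogonality *)

Section PolarIntegral.
Variable R : realType.
Local Notation C := R[i].
Local Notation mu := (@lebesgue_measure R).

Lemma within_contP (a b : R) (h : R -> R) :
  (forall x, a <= x <= b -> forall e, 0 < e -> exists2 d, 0 < d &
    forall y, a <= y <= b -> `|x - y| < d -> `|h x - h y| < e) ->
  {within `[a, b], continuous h}.
Proof.
move=> H; apply/subspace_continuousP => x /=; rewrite in_itv /= => xab.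
apply/cvgrPdist_lt => e e0; have [d d0 hd] := H x xab e e0.
rewrite near_withinE; apply/nbhs_ballP; exists d => //= y.
by rewrite /ball /= in_itv /= => xy yab; exact: hd.
Qed.

Lemma integrable_cont (a b : R) (h : R -> R) :
  {within `[a, b], continuous h} -> mu.-integrable `[a, b] (EFin \o h).
Proof. by apply: continuous_compact_integrable; exact: segment_compact. Qed.

Lemma Rint_FTC (a b : R) (f F : R -> R) : a < b ->
  (forall x : R, is_derive x (1 : R) F (f x)) -> continuous f ->
  Rintegral mu `[a, b] f = F b - F a.
Proof.
move=> ab dF cf.
have cF x : {for x, continuous F}.
  by apply: differentiable_continuous; apply/derivable1_diffP; have [] := dF x.
rewrite /Rintegral (@continuous_FTC2 _ _ F) //.
- exact: continuous_subspaceT.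
- split.
  + by move=> x _; have [] := dF x.
  + by apply: cvg_at_right_filter; exact: cF.
  + by apply: cvg_at_left_filter; exact: cF.
- by move=> x _; rewrite derive1E; have [] := dF x.
Qed.

Lemma Rint_cst (a b c : R) : a <= b -> Rintegral mu `[a, b] (fun=> c) = c * (b - a).
Proof.
move=> ab; rewrite Rintegral_cst //=; congr (_ * _).
rewrite lebesgue_measure_itv /= lte_fin; case: ltP => //= ba.
by rewrite (_ : a = b) ?subrr //; lra.
Qed.

Lemma Rint_ge0_eq0 (a b : R) (h : R -> R) : a < b ->
  {within `[a, b], continuous h} -> (forall x, a <= x <= b -> 0 <= h x) ->
  Rintegral mu `[a, b] h = 0 -> forall x, a <= x <= b -> h x = 0.
Proof.
move=> ab ch h0 I0 x xab; apply/eqP/negPn/negP => hx.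
have hp : 0 < h x by rewrite lt_neqAle eq_sym hx h0.
have hp2 : 0 < h x / 2 by rewrite divr_gt0.
move/subspace_continuousP: (ch) => /(_ x); rewrite /= in_itv /= => /(_ xab).
move=> /cvgrPdist_lt/(_ _ hp2); rewrite near_withinE => /nbhs_ballP [d /= d0' hd].
have d0 : (0 : R) < d := d0'.
pose c := Num.max a (x - d / 2); pose e := Num.min b (x + d / 2).
have ce : c < e.
  move: xab => /andP[ax xb]; rewrite /c /e lt_min !gt_max ab /=.
  by apply/andP; split; [lra|apply/andP; split; lra].
have sub : `[c, e]%classic `<=` `[a, b]%classic.
  move=> y /=; rewrite !in_itv /= /c /e ge_max le_min.
  by move=> /andP[/andP[-> _] /andP[-> _]].
have lb y : `[c, e]%classic y -> h x / 2 <= h y.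
  move=> yce; have := sub _ yce; rewrite /= !in_itv /= => yab.
  move: yce; rewrite /= in_itv /= /c /e ge_max le_min => /andP[/andP[_ h1] /andP[_ h2]].
  have hb : `|x - y| < d by rewrite ltr_norml; apply/andP; split; lra.
  have := hd y hb.
  rewrite /= in_itv /= yab => /(_ isT) hb'.
  have {hb'} : `|h x - h y| < h x / 2 := hb'.
  by rewrite ltr_norml => /andP[]; lra.
have ich := integrable_cont ch.
have mh := measurable_int _ ich.
have H1 : (\int[mu]_(y in `[c, e]) (h y)%:E <= \int[mu]_(y in `[a, b]) (h y)%:E)%E.
  apply: ge0_subset_integral => //.
have i2 : mu.-integrable `[c, e] (EFin \o h) by apply: (integrableS _ _ _ ich) => //; exact: measurable_itv.
have H2 : Rintegral mu `[c, e] h <= 0.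
  rewrite -I0 /Rintegral fine_le //; exact: integrable_fin_num.
have H3 : Rintegral mu `[c, e] (fun=> h x / 2) <= Rintegral mu `[c, e] h.
  apply: le_Rintegral => //.
  by apply: integrable_cont; apply: continuous_subspaceT => y; exact: cvg_cst.
move: (le_trans H3 H2); rewrite Rint_cst ?(ltW ce) //.
by rewrite leNgt mulr_gt0 // subr_gt0.
Qed.

Lemma polarJ (r t : R) : (polar r t)^* = polar r (- t).
Proof. by rewrite /polar cosN sinN mulrN. Qed.

Lemma cabs2_polar (r t : R) : cabs2 (polar r t) = r ^+ 2.
Proof. by rewrite /cabs2 /polar /= !exprMn -mulrDr cos2Dsin2 mulr1. Qed.

Lemma nrm_polar (r t : R) : nrm (polar r t) = `|r|.
Proof. by rewrite /nrm cabs2_polar sqrtr_sqr. Qed.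

Lemma polarB (r r' t : R) : polar r t - polar r' t = polar (r - r') t.
Proof. by rewrite /polar !mulrBl. Qed.

Lemma polarX (r t : R) n : polar r t ^+ n = polar (r ^+ n) (n%:R * t).
Proof.
elim: n => [|n IH]; first by rewrite /polar mul0r cos0 sin0 mulr1 mulr0.
rewrite exprS IH -natr1 mulrDl mul1r addrC /polar cosD sinD exprS.
by apply/eqP; rewrite eq_complex /=; apply/andP; split; apply/eqP; ring.
Qed.

Lemma cdisc_polar (r t : R) : 0 <= r <= 1 -> cdisc (polar r t).
Proof. by move=> /andP[r0 r1]; rewrite cdiscE nrm_polar ger0_norm. Qed.

Lemma cdisc_polarP (z : C) : cdisc z ->
  exists r t, [/\ 0 <= r <= 1, 0 <= t <= 2 * pi & z = polar r t].
Proof.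
rewrite cdiscE => Dz.
have [z0|z0] := eqVneq (nrm z) 0.
  exists 0, 0; split; rewrite ?lexx ?ler01 ?mulr_ge0 ?pi_ge0 //.
  by rewrite (nrm_eq0 z0) /polar !mul0r.
have zp : 0 < nrm z by rewrite lt_neqAle eq_sym z0 nrm_ge0.
pose x := complex.Re z / nrm z; pose y := complex.Im z / nrm z.
have xy : x ^+ 2 + y ^+ 2 = 1.
  by rewrite !exprMn -mulrDl -[X in X * _]/(cabs2 z) -sqr_nrm exprVn mulfV // expf_neq0.
have x1 : -1 <= x <= 1.
  rewrite -ler_norml -(@ler_pXn2r _ 2) ?nnegrE // expr1n real_normK ?num_real // -xy.
  by rewrite lerDl sqr_ge0.
have acx : cos (acos x) = x by rewrite acosK // in_itv.
have sacx : sin (acos x) = `|y|.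
  by rewrite sin_acos // -xy addrC addKr sqrtr_sqr.
have a0 := acos_ge0 x1; have a1 := acos_lepi x1.
have zE c s : c = x -> s = y -> z = Complex (nrm z * c) (nrm z * s).
  move=> -> ->; rewrite /x /y ![nrm z * _]mulrC !divfK //.
  by case: (z).
case: (leP 0 y) => y0.
  exists (nrm z), (acos x); split; first by rewrite nrm_ge0.
    by rewrite a0 /=; have := @pi_ge0 R; lra.
  by apply: zE => //; rewrite sacx ger0_norm.
exists (nrm z), (2 * pi - acos x); split; first by rewrite nrm_ge0.
  by apply/andP; split; have := @pi_ge0 R; lra.
have p2 : 2 * pi = pi *+ 2 :> R by rewrite mulr2n; ring.
apply: zE; rewrite p2 addrC.
  by rewrite cosD2pi cosN.
by rewrite sinD2pi sinN sacx ltr0_norm // opprK.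
Qed.

(** Stated through the embedding into [C], so that the modulus and the algebra of [contD] serve real
    functions as well. *)
Definition contRD (g : C -> R) := contD (fun z => (g z)%:C).

Definition circ (g : C -> R) (r : R) : R :=
  Rintegral mu [set t : R | 0 <= t <= 2 * pi] (fun t => g (polar r t)).

Definition weight (a : nat) (r : R) : R := r * (1 - r ^+ 2) ^+ a.

(** The weight stands inside the inner integral to match the iterated integral of the theorem, which
    [coef_integral] folds into this form; [rmeanE] pulls the weight out. *)
Definition rmean (a : nat) (g : C -> R) : R :=
  Rintegral mu [set r : R | 0 <= r <= 1] (fun r =>
    Rintegral mu [set t : R | 0 <= t <= 2 * pi] (fun t => g (polar r t) * weight a r)).

Lemma pi2_gt0 : 0 < 2 * pi :> R. Proof. by rewrite mulr_gt0 // pi_gt0. Qed.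

Lemma weight_ge0 a r : 0 <= r <= 1 -> 0 <= weight a r.
Proof.
by move=> /andP[r0 r1]; rewrite mulr_ge0 // exprn_ge0 // subr_ge0 exprn_ile1.
Qed.

Lemma contRD_modulus g : contRD g -> forall e : R, 0 < e ->
  exists2 K : R, 0 <= K & forall u w, cdisc u -> cdisc w ->
    `|g u - g w| <= e + K * cabs2 (u - w).
Proof.
move=> /contD_modulus h e /h [K K0 hK]; exists K => // u w Du Dw.
by rewrite -nrm_real rmorphB; exact: hK.
Qed.

Lemma polar_lip (r t s : R) : cabs2 (polar r t - polar r s) <= r ^+ 2 * (2 - 2 * cos (t - s)).
Proof.
rewrite /cabs2 /polar /= cosB -!mulrBr !exprMn -mulrDr ler_wpM2l ?sqr_ge0 //.
have := cos2Dsin2 t; have := cos2Dsin2 s; nra.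
Qed.

Lemma cont_angle g r : contRD g -> 0 <= r <= 1 -> continuous (fun t => g (polar r t)).
Proof.
move=> cg r01 t; apply/cvgrPdist_lt => e e0.
have e2 : 0 < e / 2 by rewrite divr_gt0.
have [K K0 hK] := contRD_modulus cg e2.
have hc : K * (2 - 2 * cos (t - s)) @[s --> t] --> K * (2 - 2 * cos (t - t)).
  apply: cvgM; first exact: cvg_cst.
  apply: cvgB; first exact: cvg_cst.
  apply: cvgM; first exact: cvg_cst.
  apply: (@cvg_comp _ _ _ (fun s => t - s) cos _ (nbhs (t - t))); last exact: continuous_cos.
  by apply: cvgB; [exact: cvg_cst|exact: cvg_id].
rewrite subrr cos0 mulr1 subrr mulr0 in hc.
move/cvgrPdist_lt: hc => /(_ _ e2); apply: filterS => s; rewrite sub0r normrN => hs.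
apply: le_lt_trans (hK _ _ (cdisc_polar t r01) (cdisc_polar s r01)) _.
rewrite [ltRHS](splitr e) ler_ltD //; apply: le_lt_trans hs; apply: le_trans (ler_norm _).
apply: ler_wpM2l => //; apply: le_trans (polar_lip _ _ _) _.
have := cos_le1 (t - s); case/andP: r01 => r0 r1.
have : r ^+ 2 <= 1 by rewrite exprn_ile1.
by move=> h1 h2; rewrite ler_piMl //; lra.
Qed.

Lemma int_angle g r : contRD g -> 0 <= r <= 1 ->
  mu.-integrable `[0, 2 * pi] (EFin \o (fun t => g (polar r t))).
Proof.
by move=> cg r01; apply/integrable_cont/continuous_subspaceT/cont_angle.
Qed.

Lemma circE g r : circ g r = Rintegral mu `[0, 2 * pi] (fun t => g (polar r t)).
Proof. by rewrite /circ set_itvE. Qed.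

Lemma rmeanE a g : contRD g ->
  rmean a g = Rintegral mu `[0, 1] (fun r => circ g r * weight a r).
Proof.
move=> cg; rewrite /rmean set_itvE; apply: eq_Rintegral => r /set_mem /= r01.
by rewrite -set_itvE RintegralZr ?circE //; exact: int_angle.
Qed.

Lemma le_circ g h r : contRD g -> contRD h -> 0 <= r <= 1 ->
  (forall z, cdisc z -> g z <= h z) -> circ g r <= circ h r.
Proof.
move=> cg ch r01 gh; rewrite !circE; apply: le_Rintegral => //; try exact: int_angle.
by move=> t _; exact/gh/cdisc_polar.
Qed.

Lemma circD g h r : contRD g -> contRD h -> 0 <= r <= 1 ->
  circ (fun z => g z + h z) r = circ g r + circ h r.
Proof. by move=> cg ch r01; rewrite !circE RintegralD //; exact: int_angle. Qed.

Lemma circZ c g r : contRD g -> 0 <= r <= 1 ->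
  circ (fun z => c * g z) r = c * circ g r.
Proof. by move=> cg r01; rewrite !circE RintegralZl //; exact: int_angle. Qed.

Lemma cont_circ g : contRD g -> {within `[0, 1], continuous (circ g)}.
Proof.
move=> cg; apply: within_contP => x x01 e e0.
have p0 := pi2_gt0.
(* The integrand will be at most e / (4 pi), hence the integral over length 2 pi at most e / 2. One
   half of that bound is the constant of the modulus, the other is K |x - y|^2, at most K |x - y|
   because the minimum with 1 keeps |x - y| below 1. *)
have e2 : 0 < e / (4 * pi) / 2 by rewrite !divr_gt0 // mulr_gt0 // pi_gt0.
have [K K0 hK] := contRD_modulus cg e2.
pose d := Num.min 1 (e / (4 * pi) / 2 / (K + 1)).
have K1 : 0 < K + 1 by lra.
exists d; first by rewrite lt_min ltr01 divr_gt0.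
move=> y y01; rewrite lt_min => /andP[xy1 xy2].
have step z : 0 <= z <= 1 -> mu.-integrable `[0, 2 * pi] (EFin \o (fun t => g (polar z t))).
  exact: int_angle.
rewrite !circE -RintegralB; try by [|exact: step].
apply: le_lt_trans (le_normr_Rintegral _ _) _ => //.
  have -> : EFin \o (fun t => g (polar x t) - g (polar y t)) =
     ((EFin \o (fun t => g (polar x t))) \- (EFin \o (fun t => g (polar y t))))%E by [].
  by apply: integrableB => //; exact: step.
have bd t : `|g (polar x t) - g (polar y t)| <= e / (4 * pi).
  apply: le_trans (hK _ _ (cdisc_polar t x01) (cdisc_polar t y01)) _.
  rewrite polarB cabs2_polar [leRHS](splitr (e / (4 * pi))) lerD2l.
  have : `|x - y| ^+ 2 <= `|x - y|.
    by rewrite expr2 ler_piMl // ltW.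
  rewrite real_normK ?num_real // => h.
  move: xy2; rewrite ltr_pdivlMr // mulrDr mulr1 => h2.
  have : K * (x - y) ^+ 2 <= K * `|x - y| by rewrite ler_wpM2l.
  by have := normr_ge0 (x - y); lra.
have -> : e = 2 * (Rintegral mu `[0, 2 * pi] (fun=> e / (4 * pi))).
  rewrite Rint_cst ?(ltW p0) //; move: (@pi R) (@pi_gt0 R) => p h.
  by field; rewrite gt_eqF.
have I0 : 0 < Rintegral mu `[0, 2 * pi] (fun=> e / (4 * pi)).
  by rewrite Rint_cst ?(ltW p0) // subr0 mulr_gt0 // divr_gt0 // mulr_gt0 // pi_gt0.
apply: (@le_lt_trans _ _ (Rintegral mu `[0, 2 * pi] (fun=> e / (4 * pi)))); last by lra.
apply: le_Rintegral => //.
- have -> : EFin \o (fun t => `|g (polar x t) - g (polar y t)|) =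
     (abse \o ((EFin \o (fun t => g (polar x t))) \- (EFin \o (fun t => g (polar y t)))))%E by [].
  by apply/integrable_abse/integrableB => //; exact: step.
- by apply: integrable_cont; apply: continuous_subspaceT => z; exact: cvg_cst.
Qed.

Lemma cont_weight a : continuous (weight a).
Proof.
move=> x; apply: cvgM; first exact: cvg_id.
apply: (@cvg_comp _ _ _ (fun r : R => 1 - r ^+ 2) (fun s => s ^+ a) _ (nbhs (1 - x ^+ 2))).
  by apply: cvgB; [exact: cvg_cst|exact: exprn_continuous].
exact: exprn_continuous.
Qed.

Lemma cont_circ_weight a g : contRD g ->
  {within `[0, 1], continuous (fun r => circ g r * weight a r)}.
Proof.
move=> cg x; apply: cvgM; first exact: cont_circ.
by have /continuous_subspaceT := @cont_weight a; apply.
Qed.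

Lemma int_circ a g : contRD g ->
  mu.-integrable `[0, 1] (EFin \o (fun r => circ g r * weight a r)).
Proof. by move=> cg; apply/integrable_cont/cont_circ_weight. Qed.

Lemma contRDD g h : contRD g -> contRD h -> contRD (fun z => g z + h z).
Proof. by move=> cg ch; have := contDD cg ch; rewrite /contRD; under eq_fun do rewrite -rmorphD. Qed.

Lemma contRDZ c g : contRD g -> contRD (fun z => c * g z).
Proof. by move=> cg; have := contDZ c%:C cg; rewrite /contRD; under eq_fun do rewrite -rmorphM. Qed.

Lemma rmeanD a g h : contRD g -> contRD h ->
  rmean a (fun z => g z + h z) = rmean a g + rmean a h.
Proof.
move=> cg ch; rewrite !rmeanE //; last exact: contRDD.
rewrite -RintegralD //; try exact: int_circ.
apply: eq_Rintegral => r /set_mem /=; rewrite in_itv /= => r01.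
by rewrite circD // mulrDl.
Qed.

Lemma rmeanZ a c g : contRD g -> rmean a (fun z => c * g z) = c * rmean a g.
Proof.
move=> cg; rewrite !rmeanE //; last exact: contRDZ.
rewrite -RintegralZl //; try exact: int_circ.
apply: eq_Rintegral => r /set_mem /=; rewrite in_itv /= => r01.
by rewrite circZ // mulrA.
Qed.

Lemma le_rmean a g h : contRD g -> contRD h ->
  (forall z, cdisc z -> g z <= h z) -> rmean a g <= rmean a h.
Proof.
move=> cg ch gh; rewrite !rmeanE //; apply: le_Rintegral => //; try exact: int_circ.
move=> r; rewrite /= in_itv /= => r01.
by rewrite ler_wpM2r ?weight_ge0 // le_circ.
Qed.

(** The end radii are left out because the weight vanishes at r = 0 and, for positive a, at r =
    1. *)
Lemma rmean_ge0_eq0 a g : contRD g -> (forall z, cdisc z -> 0 <= g z) ->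
  rmean a g = 0 -> forall r t, 0 < r < 1 -> 0 <= t <= 2 * pi -> g (polar r t) = 0.
Proof.
move=> cg g0; rewrite rmeanE // => I0 r t /andP[r0 r1] t2.
have c0 s : 0 <= s <= 1 -> 0 <= circ g s.
  by move=> s01; apply: Rintegral_ge0 => u _; exact/g0/cdisc_polar.
have := Rint_ge0_eq0 ltr01 (cont_circ_weight (a := a) cg) _ I0.
move=> /(_ _ r); rewrite (ltW r0) (ltW r1) => /(_ _ isT) H.
have : circ g r * weight a r = 0.
  by apply: H => s s01; rewrite mulr_ge0 ?c0 ?weight_ge0.
move/eqP; rewrite mulf_eq0 => /orP[/eqP|]; last first.
  rewrite mulf_eq0 gt_eqF //= expf_eq0 => /andP[_]; rewrite subr_eq0 => /eqP h.
  by have : r ^+ 2 < 1 by [rewrite exprn_ilt1 // ltW]; rewrite -h ltxx.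
rewrite circE => C0.
have r01 : 0 <= r <= 1 by rewrite !ltW.
have := Rint_ge0_eq0 pi2_gt0 (continuous_subspaceT (cont_angle cg r01)) _ C0.
by apply => // s _; exact/g0/cdisc_polar.
Qed.

End PolarIntegral.

Section DiscMean.
Variable R : realType.
Local Notation C := R[i].
Local Notation mu := (@lebesgue_measure R).

Lemma contRD_Re (F : C -> C) : contD F -> contRD (fun z => complex.Re (F z)).
Proof.
move=> /contDP h; apply/contDP => w Dw e e0; have [d d0 hd] := h w Dw e e0.
exists d => // u Du hu; apply: le_lt_trans (hd u Du hu).
by rewrite -rmorphB nrm_real -raddfB nrm_Re.
Qed.

Lemma contRD_Im (F : C -> C) : contD F -> contRD (fun z => complex.Im (F z)).
Proof.
move=> /contDP h; apply/contDP => w Dw e e0; have [d d0 hd] := h w Dw e e0.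
exists d => // u Du hu; apply: le_lt_trans (hd u Du hu).
by rewrite -rmorphB nrm_real -raddfB nrm_Im.
Qed.

Lemma contRD_cst (c : R) : contRD (fun=> c).
Proof. exact: contD_cst. Qed.

Lemma contRD_cabs2 (F : C -> C) : contD F -> contRD (fun z => cabs2 (F z)).
Proof.
move=> cF; rewrite /contRD; under eq_fun do rewrite cabs2E.
exact: (contDM cF (contDJ cF)).
Qed.

Lemma sin_nat2pi n : sin (n%:R * (2 * pi)) = 0 :> R.
Proof.
have -> : n%:R * (2 * pi) = 0 + pi *+ 2 *+ n :> R.
  by rewrite add0r -[RHS]mulr_natl -[pi *+ 2]mulr_natl.
by rewrite (periodicn (@sinD2pi R)) sin0.
Qed.

Lemma cos_nat2pi n : cos (n%:R * (2 * pi)) = 1 :> R.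
Proof.
have -> : n%:R * (2 * pi) = 0 + pi *+ 2 *+ n :> R.
  by rewrite add0r -[RHS]mulr_natl -[pi *+ 2]mulr_natl.
by rewrite (periodicn (@cosD2pi R)) cos0.
Qed.

Lemma is_derive_linear (k x : R) : is_derive x (1 : R) (fun t : R => k * t) k.
Proof.
have := @is_deriveZ R R R id k x 1 1 (is_derive_id x 1).
by rewrite /GRing.scale /= mulr1.
Qed.

Lemma Rint_cos (m n : nat) :
  Rintegral mu `[0, 2 * pi] (fun t : R => cos ((m%:R - n%:R) * t)) =
  if m == n then 2 * pi else 0.
Proof.
have p0 := @pi2_gt0 R.
have [->|mn] := eqVneq m n.
  under eq_Rintegral do rewrite subrr mul0r cos0.
  by rewrite Rint_cst ?(ltW p0) // mul1r subr0.
have k0 : (m%:R - n%:R : R) != 0 by rewrite subr_eq0 eqr_nat.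
set k := m%:R - n%:R in k0 *.
have dF (x : R) : is_derive x (1 : R) (fun t : R => k^-1 * sin (k * t)) (cos (k * x)).
  have h := is_derive_linear k x.
  have h1 := @is_derive1_comp R sin (fun t => k * t) x _ _ (is_derive_sin _) h.
  have := @is_deriveZ R R R _ k^-1 x 1 _ h1.
  by rewrite /GRing.scale /= mulrCA mulVf // mulr1.
rewrite (Rint_FTC p0 dF).
  by rewrite mulr0 sin0 mulr0 subr0 /k mulrBl sinB !sin_nat2pi !mul0r mulr0 subr0 mulr0.
move=> x; apply: (@cvg_comp _ _ _ (fun t => k * t) cos _ (nbhs (k * x))); last exact: continuous_cos.
by apply: cvgM; [exact: cvg_cst|exact: cvg_id].
Qed.

Lemma Rint_sin (m n : nat) :
  Rintegral mu `[0, 2 * pi] (fun t : R => sin ((m%:R - n%:R) * t)) = 0.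
Proof.
have p0 := @pi2_gt0 R.
have [->|mn] := eqVneq m n.
  under eq_Rintegral do rewrite subrr mul0r sin0.
  by rewrite Rint_cst ?(ltW p0) // mul0r.
have k0 : (m%:R - n%:R : R) != 0 by rewrite subr_eq0 eqr_nat.
set k := m%:R - n%:R in k0 *.
have dF (x : R) : is_derive x (1 : R) (fun t : R => - k^-1 * cos (k * t)) (sin (k * x)).
  have h := is_derive_linear k x.
  have h1 := @is_derive1_comp R cos (fun t => k * t) x _ _ (is_derive_cos _) h.
  have := @is_deriveZ R R R _ (- k^-1) x 1 _ h1.
  rewrite /GRing.scale /=.
  by rewrite (_ : - k^-1 * (- sin (k * x) * k) = sin (k * x)) //; field.
rewrite (Rint_FTC p0 dF).
  by rewrite mulr0 cos0 /k mulrBl cosB !cos_nat2pi !sin_nat2pi mulr0 addr0 !mulr1 subrr.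
move=> x; apply: (@cvg_comp _ _ _ (fun t => k * t) sin _ (nbhs (k * x))); last exact: continuous_sin.
by apply: cvgM; [exact: cvg_cst|exact: cvg_id].
Qed.

Lemma Rint_radial (a m : nat) :
  Rintegral mu `[0, 1] (fun r : R => r ^+ (m + m) * weight a r) =
  m`!%:R * a`!%:R / (m + a).+1`!%:R / 2.
Proof.
have cX n : continuous (fun r : R => r ^+ n) by move=> x; exact: exprn_continuous.
have ii b l : mu.-integrable `[0, 1] (EFin \o (fun r : R => r ^+ (l + l) * weight b r)).
  apply/integrable_cont/continuous_subspaceT => x; apply: cvgM; first exact: cX.
  exact: cont_weight.
elim: a m => [|a IH] m.
  have n0 : ((m + m).+2%:R : R) != 0 by rewrite pnatr_eq0.
  have dF (x : R) : is_derive x (1 : R) (fun r : R => (m + m).+2%:R^-1 * r ^+ (m + m).+2)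
      (x ^+ (m + m) * weight 0 x).
    have h1 := @is_deriveX R R id (m + m).+2 x 1 1 (is_derive_id _ _).
    rewrite exprfctE in h1.
    have := @is_deriveZ R R R _ ((m + m).+2%:R^-1) x 1 _ h1.
    rewrite /GRing.scale /= /weight expr0 !mulr1 => h.
    have e : (m + m).+2%:R^-1 * ((m + m).+2%:R * x ^+ (m + m).+1) = x ^+ (m + m) * x.
      by rewrite mulrA mulVf // mul1r exprSr.
    by move: h; rewrite e.
  rewrite (Rint_FTC ltr01 dF).
    rewrite expr1n expr0n /= mulr0 subr0 mulr1 addn0 factS natrM fact0 mulr1.
    rewrite (_ : (m + m).+2 = (m.+1 * 2)%N); last by lia.
    by rewrite natrM; field; rewrite fact_neq0 nat1r natS_neq0.
  by move=> x; apply: cvgM; [exact: cX|exact: cont_weight].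
have -> : Rintegral mu `[0, 1] (fun r : R => r ^+ (m + m) * weight a.+1 r) =
    Rintegral mu `[0, 1] (fun r : R => r ^+ (m + m) * weight a r - r ^+ (m.+1 + m.+1) * weight a r).
  apply: eq_Rintegral => r _; rewrite /weight exprS addSn addnS !exprS; ring.
rewrite RintegralB // !IH !addnS !addSn factS [(a.+1)`!]factS [(m + a).+2`!]factS !natrM.
rewrite (_ : (m + a).+2%:R = m%:R + a%:R + 2 :> R); last by rewrite -addn2 !natrD.
rewrite -[m.+1%:R]natr1 -[a.+1%:R]natr1.
by field; rewrite fact_neq0 -!natrD nat1r addn2 !natS_neq0.
Qed.

Lemma realCM (x u v : R) : x%:C * Complex u v = Complex (x * u) (x * v).
Proof. by apply/eqP; rewrite eq_complex /= !mul0r subr0 addr0 !eqxx. Qed.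

(* The factor makes this a probability mean, for the weight r (1 - r^2)^a. *)
Definition nmean (a : nat) (g : C -> R) : R := a.+1%:R / pi * rmean a g.

Definition dmean (a : nat) (F : C -> C) : C :=
  Complex (nmean a (fun z => complex.Re (F z))) (nmean a (fun z => complex.Im (F z))).

Lemma nmeanD a g h : contRD g -> contRD h ->
  nmean a (fun z => g z + h z) = nmean a g + nmean a h.
Proof. by move=> cg ch; rewrite /nmean rmeanD // mulrDr. Qed.

Lemma nmeanZ a c g : contRD g -> nmean a (fun z => c * g z) = c * nmean a g.
Proof. by move=> cg; rewrite /nmean rmeanZ // mulrCA. Qed.

Lemma le_nmean a g h : contRD g -> contRD h ->
  (forall z, cdisc z -> g z <= h z) -> nmean a g <= nmean a h.
Proof.
move=> cg ch gh; rewrite /nmean ler_wpM2l ?le_rmean //.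
by rewrite divr_ge0 // pi_ge0.
Qed.

Lemma circ_monomial (m n : nat) (r : R) : 0 <= r <= 1 ->
  circ (fun z => complex.Re (z ^+ m * z^* ^+ n)) r =
    r ^+ (m + n) * (if m == n then 2 * pi else 0) /\
  circ (fun z => complex.Im (z ^+ m * z^* ^+ n)) r = 0.
Proof.
move=> r01; rewrite !circE.
have e t : polar r t ^+ m * (polar r t)^* ^+ n = polar (r ^+ (m + n)) ((m%:R - n%:R) * t).
  rewrite polarJ !polarX mulrBl mulrN /polar cosB sinB cosN sinN exprD.
  by apply/eqP; rewrite eq_complex /=; apply/andP; split; apply/eqP; ring.
have ic (f : R -> R) : continuous f ->
    mu.-integrable `[0, 2 * pi] (EFin \o (fun t : R => f ((m%:R - n%:R) * t))).
  move=> cf; apply/integrable_cont/continuous_subspaceT => x.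
  apply: (@cvg_comp _ _ _ (fun t => (m%:R - n%:R) * t) f _ (nbhs ((m%:R - n%:R) * x))); last exact: cf.
  by apply: cvgM; [exact: cvg_cst|exact: cvg_id].
split.
  under eq_Rintegral do rewrite e /=.
  by rewrite RintegralZl ?Rint_cos //; exact/ic/continuous_cos.
under eq_Rintegral do rewrite e /=.
by rewrite RintegralZl ?Rint_sin ?mulr0 //; exact/ic/continuous_sin.
Qed.

Lemma contD_monomial m n : contD (fun z : C => z ^+ m * z^* ^+ n).
Proof.
exact: (contDM (contDX m (@contD_id R)) (contDX n (contDJ (@contD_id R)))).
Qed.

(** The mean of |z|^(2p), an inverse binomial coefficient by [moment_bin]. *)
Definition moment (a p : nat) : C := p`!%:R * a.+1`!%:R / (p + a).+1`!%:R.

Lemma dmean_monomial a m n :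
  dmean a (fun z => z ^+ m * z^* ^+ n) = if m == n then moment a m else 0.
Proof.
have cM := contD_monomial m n.
rewrite /dmean /nmean !rmeanE; [|exact: contRD_Im|exact: contRD_Re].
rewrite (_ : Rintegral mu _ (fun r => circ (fun z => complex.Im _) r * _) = 0); last first.
  transitivity (Rintegral mu `[0, 1] (fun=> 0 : R)); last by rewrite Rint_cst ?mul0r.
  apply: eq_Rintegral => r /set_mem /=; rewrite in_itv /= => r01.
  by rewrite (circ_monomial m n r01).2 mul0r.
rewrite (_ : Rintegral mu _ _ = Rintegral mu `[0, 1] (fun r => (if m == n then 2 * pi else 0) *
    (r ^+ (m + n) * weight a r))); last first.
  apply: eq_Rintegral => r /set_mem /=; rewrite in_itv /= => r01.
  by rewrite (circ_monomial m n r01).1 -mulrA mulrCA.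
rewrite mulr0 RintegralZl //; last first.
  apply/integrable_cont/continuous_subspaceT => x; apply: cvgM; last exact: cont_weight.
  exact: exprn_continuous.
have [->|_] := eqVneq m n; last by rewrite mul0r mulr0.
rewrite Rint_radial /moment -[LHS]/(real_complex R _).
rewrite -!(rmorph_nat (real_complex R)) -fmorphV -!rmorphM /=; congr (_ %:C).
rewrite [(a.+1)`!]factS natrM; move: (@pi R) (@pi_gt0 R) => p p0.
by field; rewrite fact_neq0 gt_eqF.
Qed.

Lemma moment0 a : moment a 0 = 1.
Proof. by rewrite /moment fact0 add0n mul1r divff // fact_neq0. Qed.

Lemma nmean1 a : nmean a (fun=> 1) = 1.
Proof.
have e : (fun=> 1) = (fun z : C => complex.Re (z ^+ 0 * z^* ^+ 0)).
  by apply/funext => z; rewrite !expr0 mul1r.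
have := congr1 (@complex.Re R) (@dmean_monomial a 0 0).
by rewrite moment0 e.
Qed.

Lemma dmeanD a F G : contD F -> contD G ->
  dmean a (fun z => F z + G z) = dmean a F + dmean a G.
Proof.
move=> cF cG; rewrite /dmean.
have -> : (fun z => complex.Re (F z + G z)) = (fun z => complex.Re (F z) + complex.Re (G z)).
  by apply/funext => z; rewrite raddfD.
have -> : (fun z => complex.Im (F z + G z)) = (fun z => complex.Im (F z) + complex.Im (G z)).
  by apply/funext => z; rewrite raddfD.
by rewrite !nmeanD //; do ?[exact: contRD_Re|exact: contRD_Im].
Qed.

Lemma dmeanZ a c F : contD F -> dmean a (fun z => c * F z) = c * dmean a F.
Proof.
move=> cF; case: c => x y; rewrite /dmean.
have cRe := contRD_Re cF; have cIm := contRD_Im cF.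
have -> : (fun z => complex.Re (Complex x y * F z)) =
    (fun z => x * complex.Re (F z) + (- y) * complex.Im (F z)).
  by apply/funext => z; case: (F z) => u v /=; rewrite mulNr.
have -> : (fun z => complex.Im (Complex x y * F z)) =
    (fun z => x * complex.Im (F z) + y * complex.Re (F z)).
  by apply/funext => z; case: (F z) => u v /=.
rewrite !nmeanD ?nmeanZ //; try exact: contRDZ.
by apply/eqP; rewrite eq_complex /= mulNr !eqxx.
Qed.

Lemma dmeanN a F : contD F -> dmean a (fun z => - F z) = - dmean a F.
Proof.
by move=> cF; under eq_fun do rewrite -mulN1r; rewrite dmeanZ // mulN1r.
Qed.

Lemma dmeanB a F G : contD F -> contD G ->
  dmean a (fun z => F z - G z) = dmean a F - dmean a G.
Proof. by move=> cF cG; rewrite dmeanD ?dmeanN //; exact: contDN. Qed.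

Lemma dmean_sum a (I : Type) (s : seq I) (P : pred I) (F : I -> C -> C) :
  (forall i, contD (F i)) ->
  dmean a (fun z => \sum_(i <- s | P i) F i z) = \sum_(i <- s | P i) dmean a (F i).
Proof.
move=> cF; elim: s => [|i s IH].
  rewrite big_nil; under eq_fun do rewrite big_nil -(mul0r 1).
  by rewrite dmeanZ ?mul0r //; exact: contD_cst.
rewrite big_cons; under eq_fun do rewrite big_cons.
case: (P i); last exact: IH.
by rewrite dmeanD ?IH //; exact: contD_sum.
Qed.

Lemma dmeanJ a F : contD F -> dmean a (fun z => (F z)^*) = (dmean a F)^*.
Proof.
move=> cF; rewrite /dmean /cconj /=.
have -> : (fun z => complex.Re (conjc (F z))) = (fun z => complex.Re (F z)).
  by apply/funext => z; case: (F z).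
have -> : (fun z => complex.Im (conjc (F z))) = (fun z => -1 * complex.Im (F z)).
  by apply/funext => z; case: (F z) => u v /=; rewrite mulN1r.
by rewrite nmeanZ ?mulN1r //; exact: contRD_Im.
Qed.

Lemma dmean_real a g : contRD g -> dmean a (fun z => (g z)%:C) = (nmean a g)%:C.
Proof.
move=> cg; rewrite /dmean /=; apply/eqP; rewrite eq_complex /= eqxx /=; apply/eqP.
have -> : (fun=> 0) = (fun z : C => 0 * 1) :> (C -> R) by apply/funext => z; rewrite mul0r.
by rewrite nmeanZ ?mul0r //; exact: contRD_cst.
Qed.

(** The factor 2 comes from bounding real and imaginary parts separately; every use tolerates this
    loss. *)
Lemma nrm_dmean a F g : contD F -> contRD g ->
  (forall z, cdisc z -> nrm (F z) <= g z) -> nrm (dmean a F) <= 2 * nmean a g.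
Proof.
move=> cF cg Fg; apply: le_trans (nrm_ReIm _) _ => /=.
have cNg : contRD (fun z => -1 * g z) by exact: contRDZ.
have H h : contRD h -> (forall z, cdisc z -> `|h z| <= g z) -> `|nmean a h| <= nmean a g.
  move=> ch hg; rewrite ler_norml -mulN1r -nmeanZ //; apply/andP; split; apply: le_nmean => // z Dz.
    by rewrite mulN1r; have := hg z Dz; rewrite ler_norml => /andP[].
  by have := hg z Dz; rewrite ler_norml => /andP[].
rewrite mulr_natl mulr2n lerD //; apply: H.
- exact: contRD_Re.
- by move=> z Dz; apply: le_trans (Fg z Dz); exact: nrm_Re.
- exact: contRD_Im.
- by move=> z Dz; apply: le_trans (Fg z Dz); exact: nrm_Im.
Qed.

Lemma nmean_cst a c : nmean a (fun=> c) = c.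
Proof.
have -> : (fun=> c) = (fun z : C => c * 1) by apply/funext => z; rewrite mulr1.
by rewrite nmeanZ ?nmean1 ?mulr1 //; exact: contRD_cst.
Qed.

Lemma nrm_dmean_le a F B : contD F -> (forall z, cdisc z -> nrm (F z) <= B) ->
  nrm (dmean a F) <= 2 * B.
Proof. by move=> cF FB; have := nrm_dmean a cF (contRD_cst B) FB; rewrite nmean_cst. Qed.

(** A factor (1 - |z|^2)^s only raises the exponent of the weight; the constant is the quotient of
    the two normalisations. *)
Lemma dmean_weight a s F : contD F ->
  dmean a (fun z => (1 - z * z^*) ^+ s * F z) =
  a.+1%:R / (a + s).+1%:R * dmean (a + s) F.
Proof.
move=> cF.
have H (g : C -> R) : nmean a (fun z => (1 - cabs2 z) ^+ s * g z) =
    a.+1%:R / (a + s).+1%:R * nmean (a + s) g.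
  rewrite /nmean mulrA; congr (_ * _).
    by rewrite mulrA divfK // natS_neq0.
  congr Rintegral; apply/funext => r; congr Rintegral; apply/funext => t.
  by rewrite cabs2_polar /weight exprD; ring.
have e z : (1 - z * z^*) ^+ s = ((1 - cabs2 z) ^+ s)%:C.
  by rewrite rmorphXn rmorphB /= cabs2E.
rewrite /dmean.
have -> : (fun z => complex.Re ((1 - z * z^*) ^+ s * F z)) =
    (fun z => (1 - cabs2 z) ^+ s * complex.Re (F z)).
  by apply/funext => z; rewrite e; case: (F z) => u v /=; rewrite mul0r subr0.
have -> : (fun z => complex.Im ((1 - z * z^*) ^+ s * F z)) =
    (fun z => (1 - cabs2 z) ^+ s * complex.Im (F z)).
  by apply/funext => z; rewrite e; case: (F z) => u v /=; rewrite mul0r addr0.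
rewrite !H -!(rmorph_nat (real_complex R)) -fmorphV -rmorphM.
exact/esym/realCM.
Qed.

Lemma dmean_eq0 a H : contD H -> dmean a (fun z => H z * (H z)^*) = 0 ->
  forall z, cdisc z -> H z = 0.
Proof.
move=> cH; have cg := contRD_cabs2 cH.
have -> : (fun z => H z * (H z)^*) = (fun z => (cabs2 (H z))%:C).
  by apply/funext => z; rewrite cabs2E.
rewrite dmean_real // => -[/eqP]; rewrite mulf_eq0 => /orP[|/eqP I0].
  by rewrite mulf_eq0 invr_eq0 pnatr_eq0 (gt_eqF (pi_gt0 R)).
have H0 r t : 0 < r < 1 -> 0 <= t <= 2 * pi -> H (polar r t) = 0.
  move=> r01 t2; apply/nrm_eq0/eqP; rewrite -sqrf_eq0 sqr_nrm.
  by rewrite (rmean_ge0_eq0 cg _ I0) // => z _; exact: cabs2_ge0.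
move=> z Dz; apply/nrm_eq0/eqP/negPn/negP => nz.
have np : 0 < nrm (H z) by rewrite lt_neqAle eq_sym nz nrm_ge0.
move: (Dz) => /cdisc_polarP [r [t [r01 t2 ez]]].
move/contDP: cH => /(_ z Dz _ np) [d d0 hd].
(* Vanishing is known only for radii in the open interval, so r is moved inside by less than d and
   continuity covers the centre and the boundary circle. *)
have [s s01 rs] : exists2 s, 0 < s < 1 & `|r - s| < d.
  pose m := Num.min (1 / 2) (d / 2).
  have m1 : m <= 1 / 2 by rewrite ge_min lexx.
  have m2 : m <= d / 2 by rewrite ge_min lexx orbT.
  have m0 : 0 < m by rewrite lt_min !divr_gt0.
  case/andP: r01 => r0 r1.
  case: (leP r (1 / 2)) => r2.
    exists (r + m / 2); first by apply/andP; split; lra.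
    by rewrite ltr_norml; apply/andP; split; lra.
  exists (r - m / 2); first by apply/andP; split; lra.
  by rewrite ltr_norml; apply/andP; split; lra.
have s01' : 0 <= s <= 1 by case/andP: s01 => s0 s1; rewrite !ltW.
have := hd (polar s t) (cdisc_polar t s01').
by rewrite {1}ez polarB nrm_polar H0 // subr0 ltxx => /(_ rs).
Qed.

End DiscMean.

Lemma sum2_delta (V : nmodType) (F : nat -> nat -> V) (K m n : nat) :
  (m < K)%N -> (n < K)%N ->
  (forall i j, (i == m) && (j == n) = false -> F i j = 0) ->
  \sum_(i < K) \sum_(j < K) F i j = F m n.
Proof.
move=> mK nK F0; rewrite (bigD1 (Ordinal mK)) //= (bigD1 (Ordinal nK)) //=.
rewrite [X in _ + X + _]big1 => [|i ne]; last first.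
  by apply: F0; rewrite (_ : (_ == n) = false) ?andbF //; apply/negbTE.
rewrite big1 ?addr0 // => i ne; rewrite big1 // => j _.
by apply: F0; rewrite (_ : (_ == m) = false) //; apply/negbTE.
Qed.

Section Orthogonality.
Variable R : realType.
Local Notation C := R[i].

(** The terms with [i = s] are multiples of z^m w^n, and in all others both exponents are strictly
    smaller. This triangular shape underlies orthogonality and [disc_span_monomial]. *)
Lemma disc_poly_monomials (a m n : nat) (z w : C) :
  disc_poly a m n z w = \sum_(s < (minn m n).+1) \sum_(i < s.+1)
    disc_coef R a m n s * ((-1) ^+ i * 'C(s, i)%:R) * (z ^+ (m - s + i) * w ^+ (n - s + i)).
Proof.
rewrite (disc_poly_le _ _ _ (leqnn _)); apply: eq_bigr => s _.
rewrite exprBn mulr_suml mulr_sumr; apply: eq_bigr => i _.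
rewrite expr1n mulr1 -mulr_natr exprMn !exprD; ring.
Qed.

Lemma dmean_weight_monomial a s m n :
  dmean a (fun z : C => (1 - z * z^*) ^+ s * (z ^+ m * z^* ^+ n)) =
  if m == n then a.+1%:R * (m`!%:R * (a + s)`!%:R / (m + (a + s)).+1`!%:R) else 0.
Proof.
rewrite dmean_weight; last exact: contD_monomial.
rewrite dmean_monomial; case: eqP => _; last by rewrite mulr0.
rewrite /moment factS natrM; field.
by rewrite fact_neq0 -?natrD nat1r natS_neq0.
Qed.

(** On every circle the function carries the phase e^(i(m - n + l - k)t), which averages to zero. *)
Lemma dmean_disc_phase a m n l k : (m + l != n + k)%N ->
  dmean a (fun z : C => disc_poly a m n z z^* * (z ^+ l * z^* ^+ k)) = 0.
Proof.
move=> h; have -> : (fun z : C => disc_poly a m n z z^* * (z ^+ l * z^* ^+ k)) =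
   (fun z => \sum_(s < (minn m n).+1) disc_coef R a m n s *
     ((1 - z * z^*) ^+ s * (z ^+ (m - s + l) * z^* ^+ (n - s + k)))).
  apply/funext => z; rewrite (disc_poly_le _ _ _ (leqnn _)) mulr_suml.
  by apply: eq_bigr => s _; rewrite !exprD; ring.
have cc s : contD (fun z : C => (1 - z * z^*) ^+ s * (z ^+ (m - s + l) * z^* ^+ (n - s + k))).
  apply: contDM; last exact: contD_monomial.
  exact: (contDX s (contDB (contD_cst 1) (contDM (@contD_id R) (contDJ (@contD_id R))))).
rewrite dmean_sum => [|s]; last exact: (contDZ _ (cc s)).
rewrite big1 // => -[s /= hs] _; rewrite dmeanZ // dmean_weight_monomial.
case: eqP => [e|_]; last by rewrite mulr0.
by move: h; rewrite ltnS leq_min in hs; case/negP; apply/eqP; lia.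
Qed.

(** The mean of R_{m,n} times the conjugate of its leading monomial z^m conj(z)^n. *)
Definition disc_mass (a m n : nat) : C :=
  a.+1`!%:R * m`!%:R * n`!%:R / (m + n + a).+1`!%:R.

(** The factorials of the weighted moments combine with [disc_coef] into an n-th difference of a
    polynomial of degree l, which vanishes for l < n and is constant for l = n. *)
Lemma dmean_disc_le a m n l k : (n <= m)%N -> (m + l = n + k)%N -> (l <= n)%N ->
  dmean a (fun z : C => disc_poly a m n z z^* * (z ^+ l * z^* ^+ k)) =
  if l == n then disc_mass a m n else 0.
Proof.
move=> nm h ln; have -> : (fun z : C => disc_poly a m n z z^* * (z ^+ l * z^* ^+ k)) =
   (fun z => \sum_(s < n.+1) disc_coef R a m n s *
     ((1 - z * z^*) ^+ s * (z ^+ (m - s + l) * z^* ^+ (n - s + k)))).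
  apply/funext => z; rewrite mulr_suml.
  by apply: eq_bigr => s _; rewrite !exprD; ring.
have cc s : contD (fun z : C => (1 - z * z^*) ^+ s * (z ^+ (m - s + l) * z^* ^+ (n - s + k))).
  apply: contDM; last exact: contD_monomial.
  exact: (contDX s (contDB (contD_cst 1) (contDM (@contD_id R) (contDJ (@contD_id R))))).
rewrite dmean_sum => [|s]; last exact: (contDZ _ (cc s)).
transitivity (a.+1`!%:R * m`!%:R * l`!%:R / (m + l + a).+1`!%:R *
   (\sum_(s < n.+1) (-1) ^+ s * 'C(n, s)%:R * 'C(m + l - s, l)%:R) : C).
  rewrite mulr_sumr; apply: eq_bigr => -[s /= hs] _; rewrite ltnS in hs.
  rewrite dmeanZ // dmean_weight_monomial (_ : (_ == _) = true); last by apply/eqP; lia.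
  have sm : (s <= m)%N by lia.
  have e1 := bin_fact sm.
  have lm : (l <= m + l - s)%N by lia.
  have e2 := bin_fact lm.
  have {}e1 : 'C(m, s)%:R * (s`!%:R * (m - s)`!%:R) = m`!%:R :> C by rewrite -!natrM e1.
  have {}e2 : (m - s + l)`!%:R = 'C(m + l - s, l)%:R * (l`!%:R * (m - s)`!%:R) :> C.
    rewrite -!natrM (_ : (m - s)%N = (m + l - s - l)%N); last by lia.
    by rewrite e2; congr ((_)`!%:R); lia.
  rewrite e2 -e1 /disc_coef (_ : (m - s + l + (a + s)).+1 = (m + l + a).+1); last by lia.
  rewrite [(a.+1)`!]factS natrM; field.
  by rewrite !fact_neq0.
rewrite sum_alt_bin; last by lia.
case: eqVneq => [e|ne]; last by rewrite leqNgt ltn_neqAle ne ln mulr0.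
by rewrite e leqnn subnn bin0 mulr1 /disc_mass.
Qed.

Lemma dmean_disc_monomial a m n l k : (l <= n)%N -> (k <= m)%N ->
  dmean a (fun z : C => disc_poly a m n z z^* * (z ^+ l * z^* ^+ k)) =
  if (k == m) && (l == n) then disc_mass a m n else 0.
Proof.
move=> ln km; have [h|h] := eqVneq (m + l)%N (n + k)%N; last first.
  rewrite dmean_disc_phase //; case: andP => // -[/eqP e1 /eqP e2].
  by move: h; rewrite e1 e2 addnC eqxx.
have -> : (k == m) = (l == n) by apply/eqP/eqP; lia.
rewrite andbb; case: (leqP n m) => nm; first exact: dmean_disc_le.
have -> : (fun z : C => disc_poly a m n z z^* * (z ^+ l * z^* ^+ k)) =
   (fun z => (disc_poly a n m z z^* * (z ^+ k * z^* ^+ l))^*).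
  apply/funext => z.
  by rewrite rmorphM /= conj_disc_poly rmorphM !rmorphXn /= cconjK disc_polyC [z^* ^+ _ * _]mulrC.
rewrite dmeanJ; last first.
  exact: (contDM (contD_disc_poly R a n m) (contD_monomial R k l)).
rewrite dmean_disc_le ?(ltnW nm) //.
have -> : (k == m) = (l == n) by apply/eqP/eqP; lia.
case: eqP => _; last exact: rmorph0.
by rewrite /disc_mass !rmorphM fmorphV /= !rmorph_nat (mulrAC _ n`!%:R) (addnC n m).
Qed.

(** This is N(a + 2; m, n), the inverse of the mean of |R_{m,n}|^2. *)
Definition disc_norm (a m n : nat) : R :=
  (m + n + a.+1)%:R / a.+1%:R * 'C(m + a, a)%:R * 'C(n + a, a)%:R.

Lemma disc_norm_gt0 a m n : 0 < disc_norm a m n.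
Proof.
rewrite /disc_norm !mulr_gt0 ?invr_gt0 ?ltr0n ?bin_gt0 ?leq_addl //.
by rewrite addnS.
Qed.

(** The sum is the coefficient of z^m w^n in [disc_poly]; the signs cancel and Vandermonde's
    convolution evaluates it. *)
Lemma disc_lead a m n : \sum_(s < (minn m n).+1) disc_coef R a m n s * (-1) ^+ s =
  'C(m + n + a, n)%:R / 'C(n + a, n)%:R.
Proof.
transitivity (\sum_(s < n.+1) disc_coef R a m n s * (-1) ^+ s).
  rewrite -!(big_mkord xpredT (fun s => disc_coef R a m n s * (-1) ^+ s)).
  rewrite [RHS](big_cat_nat (n := (minn m n).+1)) ?ltnS ?geq_minr //=.
  rewrite [X in _ + X]big1_seq ?addr0 // => i; rewrite mem_index_iota => /andP[_ /andP[h1 _]].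
  by move: h1; rewrite gtn_min /disc_coef => /orP[] h; rewrite (bin_small h) !(mulr0, mul0r).
rewrite -addnA -binomial.Vandermonde natr_sum mulr_suml; apply: eq_bigr => -[s /= hs] _.
rewrite natrM -mulrA bin_ratio // /disc_coef.
have -> : forall x y u : C, (-1) ^+ s * x * y * u * (-1) ^+ s = (-1) ^+ (s + s) * (x * (y * u)).
  by move=> x y u; rewrite exprD; ring.
by rewrite addnn -mul2n exprM sqrrN expr1n expr1n mul1r.
Qed.

Lemma disc_lead_neq0 a m n : ('C(m + n + a, n)%:R / 'C(n + a, n)%:R : C) != 0.
Proof.
by rewrite mulf_neq0 ?invr_eq0 // pnatr_eq0 -lt0n bin_gt0; lia.
Qed.

(** By triangularity the squared norm of R_{m,n} is its leading coefficient times its pairing with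
    the leading monomial. *)
Lemma disc_mass_lead a m n :
  'C(m + n + a, n)%:R / 'C(n + a, n)%:R * disc_mass a m n = ((disc_norm a m n)^-1)%:C.
Proof.
rewrite /disc_mass /disc_norm fmorphV !rmorphM fmorphV /= !rmorph_nat.
have h1 := @fact_neq0 C.
have e1 k l : 'C(k + l, l)%:R = (k + l)`!%:R / (l`!%:R * k`!%:R) :> C.
  by have := bin_fact (leq_addl k l); rewrite addnK => <-; rewrite !natrM; field; rewrite !h1.
rewrite !e1 (_ : (m + n + a = m + a + n)%N); last by lia.
rewrite e1 (_ : (n + a = a + n)%N); last by lia.
rewrite e1 (_ : (m + n + a.+1 = (m + a + n).+1)%N); last by lia.
rewrite [(m + a + n).+1`!]factS [(a.+1)`!]factS !natrM; field.
by rewrite !h1 /= !nat1r !natS_neq0 -!natrD nat1r natS_neq0.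
Qed.

Lemma dmean_orth a m n k l :
  dmean a (fun z : C => disc_poly a m n z z^* * (disc_poly a k l z z^*)^*) =
  if (k == m) && (l == n) then ((disc_norm a m n)^-1)%:C else 0.
Proof.
have cM m' n' k' l' := contDM (contD_disc_poly R a m' n') (contD_monomial R k' l') : contD (_ : C -> C).
have exp m' n' k' l' : (fun z : C => disc_poly a m' n' z z^* * (disc_poly a k' l' z z^*)^*) =
  (fun z => \sum_(s < (minn k' l').+1) \sum_(i < s.+1)
    disc_coef R a k' l' s * ((-1) ^+ i * 'C(s, i)%:R) *
    (disc_poly a m' n' z z^* * (z ^+ (l' - s + i) * z^* ^+ (k' - s + i)))).
  apply/funext => z; rewrite conj_disc_poly cconjK (disc_poly_monomials a k' l') mulr_sumr.
  apply: eq_bigr => s _; rewrite mulr_sumr; apply: eq_bigr => i _.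
  by rewrite mulrCA [z^* ^+ _ * _]mulrC.
have expd m' n' k' l' : dmean a (fun z : C => disc_poly a m' n' z z^* * (disc_poly a k' l' z z^*)^*) =
  \sum_(s < (minn k' l').+1) \sum_(i < s.+1)
    disc_coef R a k' l' s * ((-1) ^+ i * 'C(s, i)%:R) *
    dmean a (fun z : C => disc_poly a m' n' z z^* * (z ^+ (l' - s + i) * z^* ^+ (k' - s + i))).
  rewrite exp dmean_sum => [|s]; last by apply: contD_sum => i; exact/contDZ/cM.
  apply: eq_bigr => s _; rewrite dmean_sum => [|i]; last exact/contDZ/cM.
  by apply: eq_bigr => i _; rewrite dmeanZ //; exact: cM.
have [h|h] := eqVneq (m + l)%N (n + k)%N; last first.
  rewrite expd big1 => [|[s /= hs] _]; last first.
    rewrite big1 // => -[i /= hi] _; rewrite dmean_disc_phase ?mulr0 //.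
    rewrite !ltnS leq_min in hs hi *.
    by apply/eqP => e; case/eqP: h; lia.
  by case: andP => // -[/eqP e1 /eqP e2]; move: h; rewrite e1 e2 addnC eqxx.
(* When the second polynomial has the smaller indices, all its lower monomials pair to zero and only
   [i = s] can contribute. *)
have le m' n' k' l' : (k' <= m')%N -> (l' <= n')%N -> (m' + l' = n' + k')%N ->
    dmean a (fun z : C => disc_poly a m' n' z z^* * (disc_poly a k' l' z z^*)^*) =
    if (k' == m') && (l' == n') then ((disc_norm a m' n')^-1)%:C else 0.
  move=> km ln hh; rewrite expd.
  transitivity (\sum_(s < (minn k' l').+1) (disc_coef R a k' l' s * (-1) ^+ s) *
      (if (k' == m') && (l' == n') then disc_mass a m' n' else 0)).
    apply: eq_bigr => -[s /= hs] _; rewrite ltnS leq_min in hs; case/andP: hs => h1 h2.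
    rewrite big_ord_recr /= big1 ?add0r => [|[i /= hi] _].
      by rewrite !subnK // binn mulr1 dmean_disc_monomial.
    rewrite dmean_disc_monomial; [|lia|lia].
    by rewrite (_ : (_ == _) = false) ?mulr0 //; apply/eqP; lia.
  rewrite -mulr_suml; case: andP => [[/eqP -> /eqP ->]|_]; last by rewrite mulr0.
  by rewrite disc_lead disc_mass_lead.
(* Since m + l = n + k, the inequalities k <= m and l <= n are equivalent; the opposite case is the
   conjugate one. *)
case: (leqP k m) => km; first by apply: le => //; lia.
rewrite (_ : (k == m) = false); last by apply/eqP; lia.
have -> : (fun z : C => disc_poly a m n z z^* * (disc_poly a k l z z^*)^*) =
          (fun z : C => (disc_poly a k l z z^* * (disc_poly a m n z z^*)^*)^*).
  by apply/funext => z; rewrite rmorphM /= cconjK mulrC.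
rewrite dmeanJ; last exact: (contDM (contD_disc_poly R a k l) (contDJ (contD_disc_poly R a m n))).
rewrite le ?(ltnW km) //; [|lia|lia].
by rewrite (_ : (m == k) = false) ?rmorph0 //; apply/eqP; lia.
Qed.

Definition disc_span (a K : nat) (p : C -> C) : Prop :=
  exists d : nat -> nat -> C, forall z,
    p z = \sum_(m < K) \sum_(n < K) d m n * disc_poly a m n z z^*.

Lemma disc_spanD a K p r : disc_span a K p -> disc_span a K r ->
  disc_span a K (fun z : C => p z + r z).
Proof.
move=> [d hd] [e he]; exists (fun m n => d m n + e m n) => z.
rewrite hd he -big_split; apply: eq_bigr => m _; rewrite -big_split.
by apply: eq_bigr => n _; rewrite mulrDl.
Qed.

Lemma disc_spanZ a K c p : disc_span a K p -> disc_span a K (fun z : C => c * p z).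
Proof.
move=> [d hd]; exists (fun m n => c * d m n) => z.
rewrite hd mulr_sumr; apply: eq_bigr => m _; rewrite mulr_sumr.
by apply: eq_bigr => n _; rewrite mulrA.
Qed.

Lemma disc_span_sum a K (I : Type) (s : seq I) (P : pred I) (p : I -> C -> C) :
  (forall i, P i -> disc_span a K (p i)) ->
  disc_span a K (fun z : C => \sum_(i <- s | P i) p i z).
Proof.
move=> h; elim: s => [|i s IH].
  exists (fun _ _ => 0) => z; rewrite big_nil big1 // => m _.
  by rewrite big1 // => n _; rewrite mul0r.
under eq_fun do rewrite big_cons; case Pi: (P i); last exact: IH.
by apply: disc_spanD; [exact: h|exact: IH].
Qed.

Lemma disc_span_disc a K m n : (m < K)%N -> (n < K)%N ->
  disc_span a K (fun z : C => disc_poly a m n z z^*).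
Proof.
move=> mK nK; exists (fun m' n' => ((m' == m) && (n' == n))%:R) => z.
rewrite (@sum2_delta C (fun m' n' => ((m' == m) && (n' == n))%:R * disc_poly a m' n' z z^*) K m n) //.
  by rewrite !eqxx mul1r.
by move=> i j ->; rewrite mul0r.
Qed.

Lemma disc_span_monomial a K m n : (m < K)%N -> (n < K)%N ->
  disc_span a K (fun z : C => z ^+ m * z^* ^+ n).
Proof.
elim/ltn_ind: n m => n IH m mK nK.
set q := 'C(m + n + a, n)%:R / 'C(n + a, n)%:R : C.
pose low z := \sum_(s < (minn m n).+1) \sum_(i < s)
    disc_coef R a m n s * ((-1) ^+ i * 'C(s, i)%:R) * (z ^+ (m - s + i) * z^* ^+ (n - s + i)).
have -> : (fun z : C => z ^+ m * z^* ^+ n) =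
    (fun z => q^-1 * (disc_poly a m n z z^* + (-1) * low z)).
  apply/funext => z; apply: (canRL (mulKf (disc_lead_neq0 a m n))).
  rewrite -/q disc_poly_monomials mulN1r; apply/eqP; rewrite eq_sym subr_eq; apply/eqP.
  rewrite /q -disc_lead mulr_suml -big_split /=; apply: eq_bigr => -[s /= hs] _.
  rewrite ltnS leq_min in hs; case/andP: hs => h1 h2.
  by rewrite big_ord_recr /= !subnK // binn mulr1 addrC.
apply/disc_spanZ/disc_spanD; first exact: disc_span_disc.
apply/disc_spanZ/disc_span_sum => -[s /= hs] _; apply: disc_span_sum => -[i /= hi] _.
rewrite ltnS leq_min in hs; case/andP: hs => h1 h2.
by apply: disc_spanZ; apply: IH; lia.
Qed.

Lemma dmean_span a K (F : C -> C) (d : nat -> nat -> C) : contD F ->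
  dmean a (fun z : C => F z * (\sum_(m < K) \sum_(n < K) d m n * disc_poly a m n z z^*)^*) =
  \sum_(m < K) \sum_(n < K) (d m n)^* * dmean a (fun z : C => F z * (disc_poly a m n z z^*)^*).
Proof.
move=> cF.
have cM m n : contD (fun z : C => F z * (disc_poly a m n z z^*)^*).
  exact: (contDM cF (contDJ (contD_disc_poly R a m n))).
have -> : (fun z : C => F z * (\sum_(m < K) \sum_(n < K) d m n * disc_poly a m n z z^*)^*) =
    (fun z => \sum_(m < K) \sum_(n < K) (d m n)^* * (F z * (disc_poly a m n z z^*)^*)).
  apply/funext => z; rewrite rmorph_sum mulr_sumr; apply: eq_bigr => m _.
  rewrite rmorph_sum mulr_sumr; apply: eq_bigr => n _.
  by rewrite rmorphM /= mulrCA.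
rewrite dmean_sum => [|m]; last by apply: contD_sum => n; exact/contDZ/cM.
apply: eq_bigr => m _; rewrite dmean_sum => [|n]; last exact/contDZ/cM.
by apply: eq_bigr => n _; rewrite dmeanZ.
Qed.

Lemma dmean_span_coef a K (d : nat -> nat -> C) m n : (m < K)%N -> (n < K)%N ->
  dmean a (fun z : C => disc_poly a m n z z^* *
      (\sum_(m < K) \sum_(n < K) d m n * disc_poly a m n z z^*)^*) =
  (d m n)^* * ((disc_norm a m n)^-1)%:C.
Proof.
move=> mK nK; rewrite dmean_span; last exact: contD_disc_poly.
rewrite (@sum2_delta C (fun m' n' => (d m' n')^* *
   dmean a (fun z : C => disc_poly a m n z z^* * (disc_poly a m' n' z z^*)^*)) K m n mK nK).
  by rewrite dmean_orth !eqxx.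
by move=> i j e; rewrite dmean_orth e mulr0.
Qed.

End Orthogonality.

Lemma expand_pair (K : comPzRingType) (s r z zb A B X Y : K) (p p' : nat) :
  (s * A + r * zb * Y) ^+ p * (s * B + r * z * X) ^+ p' =
  \sum_(i < p.+1) \sum_(j < p'.+1) ('C(p, i)%:R * 'C(p', j)%:R * (Y ^+ i * X ^+ j)) *
    ((s ^+ (p - i + (p' - j)) * r ^+ (i + j)) * (zb ^+ i * z ^+ j) * (A ^+ (p - i) * B ^+ (p' - j))).
Proof.
rewrite !exprDn big_distrlr /=; apply: eq_bigr => i _; apply: eq_bigr => j _.
by rewrite !exprMn !exprD; ring.
Qed.

Lemma sum1_delta (V : nmodType) (I : finType) (F : I -> V) (i : I) :
  (forall j, j != i -> F j = 0) -> \sum_j F j = F i.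
Proof. by move=> F0; rewrite (bigD1 i) //= big1 ?addr0. Qed.

(** Fubini for a product quadrature: [I] indexes nodes of one dimension less, [T] the heights t and
    [L] the phases of the last coordinate. *)
Lemma exchange_design (K : comPzRingType) (I T L : finType) (n n' : nat)
    (W : I -> K) (al : T -> K) (be : L -> K) (c : nat -> nat -> K)
    (sg : nat -> nat -> T -> K) (ze : nat -> nat -> L -> K) (g : nat -> nat -> I -> K) :
  \sum_x \sum_t \sum_l W x * al t * be l *
    (\sum_(i < n) \sum_(j < n') c i j * (sg i j t * ze i j l * g i j x)) =
  \sum_(i < n) \sum_(j < n') c i j * (\sum_t al t * sg i j t) * (\sum_l be l * ze i j l) *
    (\sum_x W x * g i j x).
Proof.
have e (i j : nat) : c i j * (\sum_t al t * sg i j t) * (\sum_l be l * ze i j l) *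
    (\sum_x W x * g i j x) =
    \sum_x \sum_t \sum_l W x * al t * be l * (c i j * (sg i j t * ze i j l * g i j x)).
  rewrite mulr_sumr; apply: eq_bigr => x _.
  rewrite [c i j * _]mulr_sumr -[LHS]mulrA mulr_suml; apply: eq_bigr => t _.
  rewrite mulr_suml mulr_sumr; apply: eq_bigr => l _; ring.
under [RHS]eq_bigr => i _ do under eq_bigr => j _ do rewrite e.
under [RHS]eq_bigr => i _ do rewrite exchange_big.
rewrite [RHS]exchange_big; apply: eq_bigr => x _.
under [RHS]eq_bigr => i _ do rewrite exchange_big.
rewrite [RHS]exchange_big; apply: eq_bigr => t _.
under [RHS]eq_bigr => i _ do rewrite exchange_big.
rewrite [RHS]exchange_big; apply: eq_bigr => l _.
by rewrite mulr_sumr; apply: eq_bigr => i _; rewrite mulr_sumr.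
Qed.

(** * Quadrature on the unit sphere of C^(k+1) *)

Section Design.
Variable R : realType.
Local Notation C := R[i].

(** Left and right Riemann sums of x^j enclose its integral: M^(j+1) telescopes into increments that
    factor as geometric sums. *)
Lemma power_sum_bounds (j M : nat) :
  j.+1%:R * \sum_(i < M) (i%:R : R) ^+ j <= M%:R ^+ j.+1 /\
  M%:R ^+ j.+1 <= j.+1%:R * (\sum_(i < M) (i%:R : R) ^+ j + M%:R ^+ j).
Proof.
have diff (i : nat) : i.+1%:R ^+ j.+1 - i%:R ^+ j.+1 = \sum_(l < j.+1) (i%:R + 1) ^+ (j - l) * i%:R ^+ l :> R.
  by rewrite subrXX -[i.+1%:R]natr1 [_ + 1 - _]addrAC subrr add0r mul1r.
have i0 (i : nat) : (0 : R) <= i%:R by exact: ler0n.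
have i1 (i : nat) : (i%:R : R) <= i%:R + 1 by rewrite lerDl.
have i2 (i : nat) : (0 : R) <= i%:R + 1 by rewrite addr_ge0.
have cst (c : R) : j.+1%:R * c = \sum_(l < j.+1) c.
  by rewrite sumr_const card_ord mulr_natl.
have stepl (i : nat) : j.+1%:R * (i%:R : R) ^+ j <= i.+1%:R ^+ j.+1 - i%:R ^+ j.+1.
  rewrite diff cst; apply: ler_sum => -[l /= hl] _.
  rewrite -{1}(@subnK l j) // exprD.
  by rewrite ler_wpM2r ?exprn_ge0 // lerXn2r ?nnegrE.
have stepr (i : nat) : i.+1%:R ^+ j.+1 - i%:R ^+ j.+1 <= j.+1%:R * (i.+1%:R : R) ^+ j.
  rewrite diff cst -[i.+1%:R]natr1; apply: ler_sum => -[l /= hl] _.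
  rewrite -{2}(@subnK l j) // exprD.
  by rewrite ler_wpM2l ?exprn_ge0 // lerXn2r ?nnegrE.
have tel : M%:R ^+ j.+1 = \sum_(i < M) (i.+1%:R ^+ j.+1 - i%:R ^+ j.+1) :> R.
  elim: M => [|M IH]; first by rewrite big_ord0 expr0n.
  by rewrite big_ord_recr /= -IH addrC subrK.
split; rewrite {1}tel ?mulr_sumr.
  by apply: ler_sum => i _; exact: stepl.
have -> : \sum_(i < M) (i%:R : R) ^+ j + M%:R ^+ j = 0 ^+ j + \sum_(i < M) (i.+1%:R : R) ^+ j.
  by rewrite -(big_ord_recr M (fun i => (i%:R : R) ^+ j)) big_ord_recl.
rewrite mulrDr -[leLHS]add0r lerD ?mulr_ge0 ?exprn_ge0 // mulr_sumr.
by apply: ler_sum => i _; exact: stepr.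
Qed.

Lemma cvg_power_sum (j : nat) :
  \sum_(i < M) M%:R^-1 * (i%:R / M%:R : R) ^+ j @[M --> \oo] --> (j.+1%:R^-1 : R).
Proof.
have H (M : nat) : `|j.+1%:R^-1 - \sum_(i < M.+1) M.+1%:R^-1 * (i%:R / M.+1%:R : R) ^+ j| <= M.+1%:R^-1.
  have [l u] := power_sum_bounds j M.+1.
  have M0 : (0 : R) < M.+1%:R ^+ j.+1 by rewrite exprn_gt0.
  set S := \sum_(i < M.+1) (i%:R : R) ^+ j in l u.
  have -> : \sum_(i < M.+1) M.+1%:R^-1 * (i%:R / M.+1%:R : R) ^+ j = S / M.+1%:R ^+ j.+1.
    rewrite mulr_suml; apply: eq_bigr => i _.
    by rewrite exprMn exprVn exprS invfM mulrCA.
  have l' : S / M.+1%:R ^+ j.+1 <= j.+1%:R^-1.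
    by rewrite ler_pdivrMr // ler_pdivlMl.
  have u' : j.+1%:R^-1 <= S / M.+1%:R ^+ j.+1 + M.+1%:R^-1.
    have -> : M.+1%:R^-1 = M.+1%:R ^+ j / M.+1%:R ^+ j.+1 :> R.
      by rewrite exprS invfM mulrCA mulfV ?mulr1 // expf_neq0.
    rewrite -mulrDl ler_pdivlMr // ler_pdivrMl //.
  by rewrite ger0_norm ?subr_ge0 // lerBlDl.
rewrite -(cvg_shiftS (fun M : nat => \sum_(i < M) M%:R^-1 * (i%:R / M%:R : R) ^+ j)).
apply/cvgrPdist_lt => e e0.
have := @cvg_harmonic R; move=> /cvgrPdist_lt/(_ e e0); apply: filterS => M.
rewrite sub0r normrN /harmonic => h; apply: le_lt_trans (H M) _.
by apply: le_lt_trans h; exact: ler_norm.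
Qed.

Definition tnode (M : nat) (i : 'I_M) : R := i%:R / M%:R.

Lemma tnode_itv M (i : 'I_M) : 0 <= tnode i <= 1.
Proof.
case: M i => [[]//|M] i; rewrite /tnode divr_ge0 //= ler_pdivrMr // mul1r ler_nat.
exact: ltnW.
Qed.

(** Left Riemann sum of a mixed moment for the density (k + 1)(1 - t)^k. The square roots are those
    of the node coordinates; the limit is only needed for even exponents, where they disappear. *)
Definition TM (k M u v : nat) : R := \sum_(i < M)
  (k.+1%:R * (1 - tnode i) ^+ k / M%:R) * (Num.sqrt (1 - tnode i) ^+ u * Num.sqrt (tnode i) ^+ v).

Definition tbeta (k u v : nat) : R := k.+1%:R * ((k + u)`!%:R * v`!%:R / (k + u + v).+1`!%:R).

Lemma TM_even k M u v : TM k M (2 * u) (2 * v) =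
  \sum_(t < (k + u).+1) k.+1%:R * ((-1) ^+ t * 'C(k + u, t)%:R) *
     (\sum_(i < M) M%:R^-1 * (i%:R / M%:R) ^+ (v + t)).
Proof.
under [RHS]eq_bigr do rewrite mulr_sumr.
rewrite exchange_big /=; apply: eq_bigr => i _.
have /andP[t0 t1] := tnode_itv i.
rewrite !exprM !sqr_sqrtr ?subr_ge0 //.
transitivity (k.+1%:R * M%:R^-1 * tnode i ^+ v * (1 - tnode i) ^+ (k + u)).
  by rewrite exprD; ring.
rewrite exprBn mulr_sumr; apply: eq_bigr => t _.
by rewrite expr1n mulr1 -mulr_natr exprD -/(tnode i); ring.
Qed.

Lemma cvg_TM k u v : TM k M (2 * u) (2 * v) @[M --> \oo] --> tbeta k u v.
Proof.
under eq_fun do rewrite TM_even.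
have -> : tbeta k u v = \sum_(t < (k + u).+1) k.+1%:R * ((-1) ^+ t * 'C(k + u, t)%:R) *
   (v + t).+1%:R^-1.
  (* [sum_beta] with A = 0, read backwards: its quotients (v + t)!/(v + t + 1)! are the limits 1/(v
     + t + 1) of the power sums. *)
  rewrite /tbeta (_ : _ / _ = v`!%:R * (0 + (k + u))`!%:R / (0`!%:R * (v + (k + u) + 1)`!%:R)).
    rewrite -sum_beta mulr_sumr; apply: eq_bigr => t _.
    have -> : (v + t)`!%:R / (v + t + 1)`!%:R = (v + t).+1%:R^-1 :> R.
      by rewrite addn1 factS natrM invfM mulrCA mulfV ?mulr1 // fact_neq0.
    by rewrite !mulrA.
  by rewrite fact0 mul1r add0n addn1 (mulrC (_`!%:R)) (addnC v).
apply: cvg_big => [|t _]; first exact: add_continuous.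
apply: cvgM; first exact: cvg_cst.
exact: cvg_power_sum.
Qed.

Definition zeta (M : nat) : C := polar 1 (2 * pi / M%:R).

Lemma polar1_mulJ t : polar 1 t * (polar 1 t)^* = 1 :> C.
Proof. by rewrite -cabs2E cabs2_polar expr1n. Qed.

Lemma zetaJ M l : (zeta M ^+ l) * (zeta M ^+ l)^* = 1.
Proof. by rewrite polarX expr1n polar1_mulJ. Qed.

Lemma zetaM M : (0 < M)%N -> zeta M ^+ M = 1.
Proof.
move=> M0; rewrite polarX expr1n mulrCA mulfV ?pnatr_eq0 -?lt0n // mulr1.
rewrite (_ : 2 * pi = pi *+ 2) ?mulr_natl // /polar cos2pi sin2pi.
by apply/eqP; rewrite eq_complex /= !mul1r !eqxx.
Qed.

Lemma zeta_neq1 M d : (0 < d < M)%N -> zeta M ^+ d != 1.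
Proof.
move=> /andP[d0 dM]; rewrite polarX expr1n eq_complex /= !mul1r negb_and; apply/orP; left.
have Mn0 : (0 < M)%N by exact: leq_ltn_trans dM.
have M0 : (0 : R) < M%:R by rewrite ltr0n.
pose x : R := d%:R * pi / M%:R.
have -> : d%:R * (2 * pi / M%:R) = x *+ 2 by rewrite /x mulr2n; ring.
have sx : 0 < sin x.
  apply: sin_gt0_pi; apply/andP; split.
    by rewrite /x divr_gt0 ?mulr_gt0 ?pi_gt0 ?ltr0n.
  by rewrite ltr_pdivrMr // mulrC ltr_pM2l ?pi_gt0 // ltr_nat.
rewrite (cos_mulr2n x) cos2sin2 lt_eqF //.
have : 0 < sin x ^+ 2 by rewrite exprn_gt0.
lra.
Qed.

Definition ZM (M i j : nat) : C := \sum_(l < M) M%:R^-1 * ((zeta M ^+ l)^* ^+ i * (zeta M ^+ l) ^+ j).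

Lemma ZM_diag M i : (0 < M)%N -> ZM M i i = 1.
Proof.
move=> M0; rewrite /ZM (eq_bigr (fun=> M%:R^-1)) => [|l _].
  by rewrite sumr_const card_ord -(mulr_natl M%:R^-1 M) mulfV // pnatr_eq0 -lt0n.
by rewrite -exprMn mulrC [_^* * _]mulrC zetaJ expr1n mul1r.
Qed.

(** A full geometric sum of an M-th root of unity. Exponents below M exclude aliasing, so this root
    is not 1. *)
Lemma ZM_offdiag M i j : (i < M)%N -> (j < M)%N -> i != j -> ZM M i j = 0.
Proof.
move=> iM jM ij; rewrite /ZM -mulr_sumr.
pose w := (zeta M)^* ^+ i * zeta M ^+ j.
rewrite (eq_bigr (fun l : 'I_M => w ^+ l)) => [|l _]; last first.
  by rewrite rmorphXn exprMn -!exprM mulnC [(j * _)%N]mulnC.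
have M0 : (0 < M)%N by exact: leq_ltn_trans iM.
have z1 : zeta M * (zeta M)^* = 1 by exact: (zetaJ M 1).
have w1 : w ^+ M = 1.
  rewrite exprMn -!exprM !(mulnC _ M) !exprM -rmorphXn zetaM // rmorph1.
  by rewrite !expr1n mulr1.
have wn : w != 1.
  have pw n : (zeta M) ^+ n * (zeta M)^* ^+ n = 1 by rewrite -exprMn z1 expr1n.
  case: (ltngtP i j) ij => // h _.
    have -> : w = zeta M ^+ (j - i).
      by rewrite /w -{1}(subnK (ltnW h)) exprD mulrCA (mulrC ((zeta M)^* ^+ i)) pw mulr1.
    by apply: zeta_neq1; rewrite subn_gt0 h (leq_ltn_trans (leq_subr _ _)).
  have -> : w = (zeta M ^+ (i - j))^*.
    by rewrite /w -{1}(subnK (ltnW h)) exprD -mulrA (mulrC ((zeta M)^* ^+ j)) pw mulr1 rmorphXn.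
  rewrite -(rmorph1 (@cconj R)) (inj_eq (can_inj (@cconjK R))).
  by apply: zeta_neq1; rewrite subn_gt0 h (leq_ltn_trans (leq_subr _ _)).
have : (w - 1) * (\sum_(l < M) w ^+ l) = 0 by rewrite -subrX1 w1 subrr.
by move/eqP; rewrite mulf_eq0 subr_eq0 (negbTE wn) /= => /eqP ->; rewrite mulr0.
Qed.

(** Vectors are functions on [nat] of which only the first q entries are read, so changing the
    dimension needs no casts. *)
Definition dotn (q : nat) (x y : nat -> C) : C := \sum_(i < q) x i * (y i)^*.

Definition ext (k : nat) (a : nat -> C) (t : R) (z : C) : nat -> C := fun i =>
  if (i <= k)%N then (Num.sqrt (1 - t))%:C * a i else (Num.sqrt t)%:C * z.

(* Quadrature nodes: a unit vector of C^(k+2) is (sqrt(1 - t) a', sqrt t zeta), where a' is a unit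
   vector of C^(k+1), t = i / M has density (k + 1)(1 - t)^k and zeta is an M-th root of unity. *)
Fixpoint dI (k M : nat) : finType :=
  if k is k'.+1 then ((dI k' M) * ('I_M * 'I_M))%type : finType else 'I_M : finType.

Fixpoint dw (k M : nat) : dI k M -> R :=
  match k return dI k M -> R with
  | 0 => fun=> M%:R^-1
  | k'.+1 => fun x => dw x.1 * (k'.+1%:R * (1 - tnode x.2.1) ^+ k' / M%:R) / M%:R
  end.

Fixpoint dp (k M : nat) : dI k M -> nat -> C :=
  match k return dI k M -> nat -> C with
  | 0 => fun x _ => zeta M ^+ x
  | k'.+1 => fun x => ext k' (dp x.1) (tnode x.2.1) (zeta M ^+ x.2.2)
  end.

Definition avg (k M : nat) (g : (nat -> C) -> C) : C :=
  \sum_(x : dI k M) (dw x)%:C * g (dp x).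

Lemma dw_ge0 k M (x : dI k M) : 0 <= dw x.
Proof.
elim: k x => [|k IH] x /=; first by rewrite invr_ge0.
have /andP[_ t1] := tnode_itv x.2.1.
by rewrite !mulr_ge0 ?invr_ge0 ?exprn_ge0 ?subr_ge0.
Qed.

Lemma dotn_extl k a t z y :
  dotn k.+2 (ext k a t z) y = (Num.sqrt (1 - t))%:C * dotn k.+1 a y + (Num.sqrt t)%:C * z * (y k.+1)^*.
Proof.
rewrite /dotn big_ord_recr /= /ext ltnn; congr (_ + _).
rewrite mulr_sumr; apply: eq_bigr => i _.
by rewrite -ltnS ltn_ord mulrA.
Qed.

Lemma dotnJ q x y : (dotn q x y)^* = dotn q y x.
Proof.
rewrite cconj_sum; apply: eq_bigr => i _.
by rewrite cconjM cconjK mulrC.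
Qed.

Lemma dotn_extr k a t z y :
  dotn k.+2 y (ext k a t z) = (Num.sqrt (1 - t))%:C * dotn k.+1 y a + (Num.sqrt t)%:C * z^* * y k.+1.
Proof.
by rewrite -dotnJ dotn_extl cconjD !cconjM !conj_realC cconjK dotnJ.
Qed.

Lemma dotn_ext_low k a t z y :
  dotn k.+1 (ext k a t z) y = (Num.sqrt (1 - t))%:C * dotn k.+1 a y.
Proof.
rewrite /dotn mulr_sumr; apply: eq_bigr => i _.
by rewrite /ext -ltnS ltn_ord mulrA.
Qed.

Lemma dotn_low_ext k a t z y :
  dotn k.+1 y (ext k a t z) = (Num.sqrt (1 - t))%:C * dotn k.+1 y a.
Proof. by rewrite -dotnJ dotn_ext_low cconjM conj_realC dotnJ. Qed.

Lemma ext_last k a t z : ext k a t z k.+1 = (Num.sqrt t)%:C * z.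
Proof. by rewrite /ext ltnn. Qed.

Lemma realC_sqrt (t : R) : 0 <= t -> (Num.sqrt t)%:C * (Num.sqrt t)%:C = t%:C.
Proof. by move=> t0; rewrite -rmorphM /= -expr2 sqr_sqrtr. Qed.

Lemma dp_unit k M (x : dI k M) : dotn k.+1 (dp x) (dp x) = 1.
Proof.
elim: k x => [|k IH] x /=; first by rewrite /dotn big_ord1 zetaJ.
have /andP[t0 t1] := tnode_itv x.2.1.
rewrite dotn_extl dotn_low_ext IH ext_last cconjM conj_realC mulr1.
rewrite realC_sqrt ?subr_ge0 // mulrACA realC_sqrt // zetaJ mulr1.
by rewrite -rmorphD /= subrK.
Qed.

Definition twt (k M : nat) (i : 'I_M) : R := k.+1%:R * (1 - tnode i) ^+ k / M%:R.

Lemma avgS k M g : avg k.+1 M g = \sum_(x : dI k M) \sum_(t < M) \sum_(l < M)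
  (dw x)%:C * (twt k t)%:C * M%:R^-1 * g (ext k (dp x) (tnode t) (zeta M ^+ l)).
Proof.
under [RHS]eq_bigr do rewrite pair_bigA /=.
rewrite pair_bigA /=; apply: eq_bigr => -[x [t l]] _ /=.
congr (_ * _); rewrite -/(twt k t) !rmorphM /= fmorphV /=.
by congr (_ * _^-1); exact: rmorph_nat.
Qed.

Definition mo (k M p p' : nat) (y x : nat -> C) : C :=
  avg k M (fun a => dotn k.+1 y a ^+ p * dotn k.+1 a x ^+ p').

Lemma moS k M p p' y x : mo k.+1 M p p' y x = \sum_(i < p.+1) \sum_(j < p'.+1)
  ('C(p, i)%:R * 'C(p', j)%:R * (y k.+1 ^+ i * (x k.+1)^* ^+ j)) *
  (TM k M (p - i + (p' - j)) (i + j))%:C * ZM M i j * mo k M (p - i) (p' - j) y x.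
Proof.
rewrite /mo avgS.
under [LHS]eq_bigr => z _ do under eq_bigr => t _ do under eq_bigr => l _ do
  rewrite dotn_extl dotn_extr expand_pair.
rewrite (@exchange_design C _ _ _ p.+1 p'.+1 (fun z : dI k M => (dw z)%:C)
  (fun t : 'I_M => (twt k t)%:C) (fun=> M%:R^-1)
  (fun i j => 'C(p, i)%:R * 'C(p', j)%:R * (y k.+1 ^+ i * (x k.+1)^* ^+ j))
  (fun i j (t : 'I_M) => (Num.sqrt (1 - tnode t))%:C ^+ (p - i + (p' - j)) * (Num.sqrt (tnode t))%:C ^+ (i + j))
  (fun i j (l : 'I_M) => ((zeta M ^+ l)^*) ^+ i * (zeta M ^+ l) ^+ j)
  (fun i j z => dotn k.+1 y (dp z) ^+ (p - i) * dotn k.+1 (dp z) x ^+ (p' - j))).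
apply: eq_bigr => i _; apply: eq_bigr => j _; congr (_ * _ * _ * _).
rewrite /TM rmorph_sum /=; apply: eq_bigr => t _.
by rewrite -/(twt k t) !rmorphM /= !rmorphXn.
Qed.

Lemma mo_offdiag k M p p' y x : (p < M)%N -> (p' < M)%N -> p != p' -> mo k M p p' y x = 0.
Proof.
elim: k p p' => [|k IH] p p' pM p'M pp.
  rewrite /mo /avg /=.
  transitivity ((y 0%N ^+ p * (x 0%N)^* ^+ p') * ZM M p p').
    rewrite /ZM mulr_sumr; apply: eq_bigr => l _.
    rewrite /dotn !big_ord1 !exprMn fmorphV rmorph_nat; ring.
  by rewrite ZM_offdiag ?mulr0.
rewrite moS big1 // => -[i /= hi] _; rewrite big1 // => -[j /= hj] _.
rewrite !ltnS in hi hj.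
have [e|ne] := eqVneq i j.
  rewrite IH ?mulr0 //; [lia|lia|].
  by apply: contra_neq pp; lia.
by rewrite ZM_offdiag ?mulr0 ?mul0r //; lia.
Qed.

Lemma moS_diag k M p y x : (p < M)%N -> mo k.+1 M p p y x = \sum_(i < p.+1)
  ('C(p, i)%:R ^+ 2 * (y k.+1 * (x k.+1)^*) ^+ i) *
  (TM k M (2 * (p - i)) (2 * i))%:C * mo k M (p - i) (p - i) y x.
Proof.
move=> pM; rewrite moS; apply: eq_bigr => i _.
have iM : (i < M)%N by apply: leq_trans pM; exact: ltn_ord.
rewrite (@sum1_delta _ _ _ i) => [|j ne].
  rewrite ZM_diag ?(leq_ltn_trans (leq0n _) pM) // mulr1 exprMn expr2.
  by rewrite !mul2n !addnn.
have jM : (j < M)%N by apply: leq_trans pM; exact: ltn_ord.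
by rewrite ZM_offdiag ?mulr0 ?mul0r // eq_sym.
Qed.

(** The mean of |x . e|^(2p) over unit vectors e of C^(k+1), for a fixed unit vector x. *)
Definition cmass (k p : nat) : C := p`!%:R * k`!%:R / (p + k)`!%:R.

(** The right-hand side does not depend on i; this is what lets the terms of the recursion
    reassemble into a binomial expansion in [cvg_mo]. *)
Lemma cmassS k p i : (i <= p)%N ->
  'C(p, i)%:R * (tbeta k (p - i) i)%:C * cmass k (p - i) = cmass k.+1 p.
Proof.
move=> ip; have e : 'C(p, i)%:R * (i`!%:R * (p - i)`!%:R) = p`!%:R :> C.
  by rewrite -!natrM bin_fact.
rewrite /cmass /tbeta !rmorphM fmorphV /= !rmorph_nat -e.
rewrite (_ : (k + (p - i) + i).+1 = (p + k.+1)%N); last by lia.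
rewrite (addnC k) [(k.+1)`!]factS natrM; field.
by rewrite !fact_neq0.
Qed.

(** Induction on the dimension: splitting off the last coordinate, averaging its phase leaves only
    terms with equal exponents, and by [cmassS] their limits form the binomial expansion of (y' . x'
    + y_last conj(x_last))^p. *)
Lemma cvg_mo k p y x :
  mo k M p p y x @[M --> \oo] --> cmass k p * dotn k.+1 y x ^+ p.
Proof.
elim: k p => [|k IH] p.
  have -> : cmass 0 p * dotn 1 y x ^+ p = (y 0%N * (x 0%N)^*) ^+ p.
    by rewrite /cmass addn0 mulr1 divff ?fact_neq0 // mul1r /dotn big_ord1.
  apply: cvg_near_cst; near=> M.
  have M0 : (0 < M)%N by near: M; exact: nbhs_infty_gt.
  rewrite /mo /avg /=.
  transitivity ((y 0%N * (x 0%N)^*) ^+ p * ZM M p p); last by rewrite ZM_diag // mulr1.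
  rewrite /ZM mulr_sumr; apply: eq_bigr => l _.
  rewrite /dotn !big_ord1 !exprMn fmorphV rmorph_nat; ring.
have -> : cmass k.+1 p * dotn k.+2 y x ^+ p = \sum_(i < p.+1)
  ('C(p, i)%:R ^+ 2 * (y k.+1 * (x k.+1)^*) ^+ i) * (tbeta k (p - i) i)%:C *
   (cmass k (p - i) * dotn k.+1 y x ^+ (p - i)).
  rewrite /dotn big_ord_recr /= -!/(dotn _ _ _) exprDn mulr_sumr; apply: eq_bigr => -[i /= hi] _.
  by rewrite -(@cmassS k p i) //; ring.
have near_eq : {near \oo, (fun M => \sum_(i < p.+1)
  ('C(p, i)%:R ^+ 2 * (y k.+1 * (x k.+1)^*) ^+ i) *
  (TM k M (2 * (p - i)) (2 * i))%:C * mo k M (p - i) (p - i) y x)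
    =1 (fun M => mo k.+1 M p p y x)}.
  by near=> M; rewrite moS_diag //; near: M; exact: nbhs_infty_gt.
apply: cvg_trans (near_eq_cvg near_eq) _.
apply: cvgC_sum => i; apply: cvgCM; last exact: IH.
apply: cvgCM; first exact: cvg_cst.
by apply: cvg_realC; exact: cvg_TM.
Unshelve. all: by end_near. Qed.

End Design.

Lemma exchange_fourier (K : comPzRingType) (B : finType) (n : nat)
    (al be : B -> K) (c : nat -> nat -> K) (u v : nat -> B -> K) :
  \sum_b \sum_d al b * be d * (\sum_(i < n) \sum_(j < n) c i j * (u i b * v j d)) =
  \sum_(i < n) \sum_(j < n) c i j * (\sum_b al b * u i b) * (\sum_d be d * v j d).
Proof.
have e (i j : nat) : c i j * (\sum_b al b * u i b) * (\sum_d be d * v j d) =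
    \sum_b \sum_d al b * be d * (c i j * (u i b * v j d)).
  rewrite [c i j * _]mulr_sumr mulr_suml; apply: eq_bigr => b _.
  rewrite mulr_sumr; apply: eq_bigr => d _; ring.
under [RHS]eq_bigr => i _ do under eq_bigr => j _ do rewrite e.
under [RHS]eq_bigr => i _ do rewrite exchange_big.
rewrite [RHS]exchange_big; apply: eq_bigr => b _.
under [RHS]eq_bigr => i _ do rewrite exchange_big.
rewrite [RHS]exchange_big; apply: eq_bigr => d _.
by rewrite mulr_sumr; apply: eq_bigr => i _; rewrite mulr_sumr.
Qed.

(** * Positive semidefinite kernels *)

Section PositiveDefinite.
Variable R : realType.
Local Notation C := R[i].

(** The double quadrature average of z^m conj(z)^n, where z is the inner product of two independent
    nodes. *)
Definition pairmo (k M m n : nat) : C :=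
  avg k M (fun b => mo k M m n b b).

Lemma pairmo_offdiag k M m n : (m < M)%N -> (n < M)%N -> m != n -> pairmo k M m n = 0.
Proof.
by move=> mM nM mn; apply: big1 => x _; rewrite mo_offdiag ?mulr0.
Qed.

Lemma mo_ext k M p (a : nat -> C) t z : 0 <= t <= 1 ->
  mo k M p p (ext k a t z) (ext k a t z) = ((1 - t) ^+ p)%:C * mo k M p p a a.
Proof.
move=> /andP[t0 t1]; rewrite /mo /avg mulr_sumr; apply: eq_bigr => x _.
rewrite dotn_ext_low dotn_low_ext !exprMn mulrACA -exprMn realC_sqrt ?subr_ge0 //.
by rewrite rmorphXn; ring.
Qed.

Lemma ext_last_mulJ k a t (z : C) : 0 <= t -> z * z^* = 1 ->
  ext k a t z k.+1 * (ext k a t z k.+1)^* = t%:C.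
Proof.
by move=> t0 z1; rewrite ext_last cconjM conj_realC mulrACA realC_sqrt // z1 mulr1.
Qed.

(** Averaging the last coordinate of each of the two nodes yields one factor [TM], hence the
    square. *)
Lemma pairmoS k M p : (p < M)%N -> pairmo k.+1 M p p = \sum_(i < p.+1)
  (('C(p, i)%:R * TM R k M (2 * (p - i)) (2 * i)) ^+ 2)%:C * pairmo k M (p - i) (p - i).
Proof.
move=> pM; have M0 : (0 < M)%N by exact: leq_ltn_trans pM.
rewrite /pairmo avgS.
pose cc (i j : nat) : C := 'C(p, i)%:R ^+ 2 * (TM R k M (2 * (p - i)) (2 * i))%:C.
transitivity (\sum_(x : dI k M) \sum_(t < M) \sum_(l < M)
  (dw R x)%:C * (twt R k t)%:C * M%:R^-1 * (\sum_(i < p.+1) \sum_(j < 1)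
    cc i j * (((1 - tnode R t) ^+ (p - i) * tnode R t ^+ i)%:C * 1 *
     mo k M (p - i) (p - i) (dp R x) (dp R x)))).
  apply: eq_bigr => x _; apply: eq_bigr => t _; apply: eq_bigr => l _; congr (_ * _).
  rewrite moS_diag //; apply: eq_bigr => i _; rewrite big_ord1 mo_ext ?tnode_itv //.
  rewrite ext_last_mulJ ?zetaJ //; last by have /andP[] := tnode_itv R t.
  move: (tnode R t) => tt.
  by rewrite /cc !rmorphM !rmorphXn /=; ring.
rewrite (@exchange_design C _ _ _ p.+1 1 (fun z : dI k M => (dw R z)%:C)
  (fun t : 'I_M => (twt R k t)%:C) (fun=> M%:R^-1) cc
  (fun i j (t : 'I_M) => ((1 - tnode R t) ^+ (p - i) * tnode R t ^+ i)%:C)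
  (fun i j (l : 'I_M) => 1)
  (fun i j z => mo k M (p - i) (p - i) (dp R z) (dp R z))).
apply: eq_bigr => i _; rewrite big_ord1 /cc.
have -> : \sum_(t < M) (twt R k t)%:C * ((1 - tnode R t) ^+ (p - i) * tnode R t ^+ i)%:C =
   (TM R k M (2 * (p - i)) (2 * i))%:C.
  rewrite /TM rmorph_sum /=; apply: eq_bigr => t _.
  have /andP[t0 t1] := tnode_itv R t.
  by rewrite -rmorphM /= -/(twt R k t) !exprM !sqr_sqrtr ?subr_ge0.
have -> : \sum_(l < M) M%:R^-1 * 1 = 1 :> C.
  by rewrite mulr1 sumr_const card_ord -(mulr_natl M%:R^-1 M) mulfV // pnatr_eq0 -lt0n.
by rewrite rmorphXn rmorphM /= rmorph_nat /avg; ring.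
Qed.

(** The summands are the limits of the terms of (1 - t + t)^p under the quadrature in t, so the sum
    is the total mass of the density. *)
Lemma sum_tbeta k p : \sum_(i < p.+1) 'C(p, i)%:R * tbeta R k (p - i) i = 1.
Proof.
have h1 : (\sum_(i < p.+1) 'C(p, i)%:R * TM R k M (2 * (p - i)) (2 * i)) @[M --> \oo] -->
    \sum_(i < p.+1) 'C(p, i)%:R * tbeta R k (p - i) i.
  apply: cvg_big => [|i _]; first exact: add_continuous.
  by apply: cvgM; [exact: cvg_cst|exact: cvg_TM].
have h2 : (\sum_(i < p.+1) 'C(p, i)%:R * TM R k M (2 * (p - i)) (2 * i)) @[M --> \oo] --> tbeta R k 0 0.
  have -> : (fun M => \sum_(i < p.+1) 'C(p, i)%:R * TM R k M (2 * (p - i)) (2 * i)) =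
      (fun M => TM R k M (2 * 0) (2 * 0)).
    apply/funext => M; under eq_bigr do rewrite mulr_sumr.
    rewrite exchange_big /=; apply: eq_bigr => t _; rewrite !mul2n !expr0 !mulr1.
    have /andP[t0 t1] := tnode_itv R t.
    transitivity (k.+1%:R * (1 - tnode R t) ^+ k / M%:R * (1 - tnode R t + tnode R t) ^+ p).
      rewrite (exprDn (1 - tnode R t)) mulr_sumr; apply: eq_bigr => i _.
      by rewrite -?mul2n !exprM !sqr_sqrtr ?subr_ge0 //; ring.
    by rewrite subrK expr1n mulr1.
  exact: cvg_TM.
rewrite -(cvg_lim _ h1) // (cvg_lim _ h2) // /tbeta !addn0 fact0 mulr1 factS natrM.
by field; rewrite fact_neq0 /= nat1r natS_neq0.
Qed.

(** [cvg_mo] treats fixed vectors, whereas both vectors here are nodes that change with M; hence a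
    separate recursion on the dimension. *)
Lemma cvg_pairmo k p : pairmo k M p p @[M --> \oo] --> cmass R k p.
Proof.
elim: k p => [|k IH] p.
  rewrite /cmass addn0 mulr1 divff ?fact_neq0 //.
  apply: cvg_near_cst; near=> M.
  have M0 : (0 < M)%N by near: M; exact: nbhs_infty_gt.
  rewrite /pairmo /avg /=.
  rewrite (eq_bigr (fun=> M%:R^-1)) => [|x _].
    by rewrite sumr_const card_ord -(mulr_natl M%:R^-1 M) mulfV // pnatr_eq0 -lt0n.
  rewrite /mo /avg /= (eq_bigr (fun=> M%:R^-1)) => [|l _].
    rewrite sumr_const card_ord -(mulr_natl M%:R^-1 M) mulfV ?mulr1 // ?pnatr_eq0 -?lt0n //.
    by rewrite fmorphV rmorph_nat.
  have e (u v : C) : u * u^* = 1 -> v * v^* = 1 -> (u * v^*) * (v * u^*) = 1.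
    move=> h1 h2; transitivity ((u * u^*) * (v * v^*)); first by ring.
    by rewrite h1 h2 mulr1.
  rewrite /dotn !big_ord1 -exprMn (e _ _ (zetaJ _ _ _) (zetaJ _ _ _)).
  by rewrite expr1n mulr1 fmorphV rmorph_nat.
have near_eq : {near \oo, (fun M => \sum_(i < p.+1)
  (('C(p, i)%:R * TM R k M (2 * (p - i)) (2 * i)) ^+ 2)%:C * pairmo k M (p - i) (p - i))
    =1 (fun M => pairmo k.+1 M p p)}.
  by near=> M; rewrite pairmoS //; near: M; exact: nbhs_infty_gt.
apply: cvg_trans (near_eq_cvg near_eq) _.
have -> : cmass R k.+1 p = \sum_(i < p.+1)
   (('C(p, i)%:R * tbeta R k (p - i) i) ^+ 2)%:C * cmass R k (p - i).
  transitivity ((\sum_(i < p.+1) 'C(p, i)%:R * tbeta R k (p - i) i)%:C * cmass R k.+1 p).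
    by rewrite sum_tbeta mul1r.
  rewrite rmorph_sum mulr_suml.
  apply: eq_bigr => -[i /= hi] _.
  rewrite -(@cmassS R k p i) //; move: (tbeta R k (p - i) i) => tb.
  by rewrite rmorphXn !rmorphM /= rmorph_nat; ring.
apply: cvgC_sum => i; apply: cvgCM; last exact: IH.
apply: cvg_realC; rewrite expr2.
under eq_fun do rewrite expr2.
by apply: cvgM; (apply: cvgM; [exact: cvg_cst|exact: cvg_TM]).
Unshelve. all: by end_near. Qed.

Definition psd (T : finType) (K : T -> T -> C) : Prop :=
  forall c : T -> C, 0 <= \sum_j \sum_k K j k * c j * (c k)^*.

Lemma psd_gram (T : finType) (K : T -> T -> C) (v : T -> C) :
  psd K -> psd (fun j k => K j k * (v j * (v k)^*)).
Proof.
move=> hK c; have := hK (fun j => v j * c j); congr (0 <= _).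
apply: eq_bigr => j _; apply: eq_bigr => k _.
by rewrite cconjM; ring.
Qed.

Lemma psd_sum (T I : finType) (K : I -> T -> T -> C) :
  (forall i, psd (K i)) -> psd (fun j k => \sum_i K i j k).
Proof.
move=> hK c.
have -> : \sum_j \sum_k (\sum_i K i j k) * c j * (c k)^* =
    \sum_i \sum_j \sum_k K i j k * c j * (c k)^*.
  rewrite [RHS]exchange_big; apply: eq_bigr => j _.
    rewrite [RHS]exchange_big; apply: eq_bigr => k _.
    by rewrite !mulr_suml.
by apply: sumr_ge0 => i _; exact: hK.
Qed.

Lemma psdZ (T : finType) (K : T -> T -> C) (r : C) : 0 <= r -> psd K -> psd (fun j k => r * K j k).
Proof.
move=> r0 hK c.
have -> : \sum_j \sum_k r * K j k * c j * (c k)^* =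
    r * \sum_j \sum_k K j k * c j * (c k)^*.
  rewrite mulr_sumr; apply: eq_bigr => j _; rewrite mulr_sumr; apply: eq_bigr => k _.
  by rewrite !mulrA.
by rewrite mulr_ge0.
Qed.

Lemma psd_ext (T : finType) (K K' : T -> T -> C) : (forall j k, K j k = K' j k) -> psd K -> psd K'.
Proof.
move=> e hK c; have := hK c; congr (0 <= _).
by apply: eq_bigr => j _; apply: eq_bigr => k _; rewrite e.
Qed.

Lemma cvg_ge0C (u : nat -> C) (l : C) : (forall N, 0 <= u N) -> u @ \oo --> l -> 0 <= l.
Proof.
move=> u0 ul.
have cIm := cvg_Im _ ul; have cRe := cvg_Re _ ul.
rewrite lecE /=; apply/andP; split.
  apply/eqP; rewrite -(cvg_lim _ (cIm _)) //.
  have -> : (fun x => complex.Im (u x)) = (fun=> 0) by apply/funext => x; exact: ger0_Im.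
  by rewrite lim_cst.
rewrite -(cvg_lim _ (cRe _)) //; apply: limr_ge; first by apply/cvg_ex; exists (complex.Re l); exact: cRe.
by near=> N; have := u0 N; rewrite lecE => /andP[].
Unshelve. all: by end_near. Qed.

Lemma psd_cvg (T : finType) (K : nat -> T -> T -> C) (K' : T -> T -> C) :
  (forall N, psd (K N)) -> (forall j k, K N j k @[N --> \oo] --> K' j k) -> psd K'.
Proof.
move=> hK cK c.
apply: (@cvg_ge0C (fun N => \sum_j \sum_k K N j k * c j * (c k)^*)).
  by move=> N; exact: hK.
apply: cvgC_sum => j; apply: cvgC_sum => k.
apply: cvgCM; last exact: cvg_cst.
by apply: cvgCM; [exact: cK|exact: cvg_cst].
Qed.

End PositiveDefinite.

(** This expands [zonal_kernel] for xi = kap + z eta, with g, h the products of eta, kap with e and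
    g', h' the reversed ones. In each term the exponents of g, h and those of g', h' both add up to
    m + t + s', the shape that [cvg_bimoment] requires. *)
Lemma zonal_expand (K : comPzRingType) (m n : nat) (wx z zb g h g' h' : K) :
  wx * ((z * g + h) ^+ m * g' ^+ m * (zb - g * (zb * g' + h')) ^+ n) =
  \sum_(s' < n.+1) \sum_(t < (n - s').+1) \sum_(s < m.+1)
   ('C(m, s)%:R * ('C(n, s')%:R * (-1) ^+ s') * ((-1) ^+ t * 'C(n - s', t)%:R) *
   (z ^+ (m - s) * zb ^+ (n - s'))) *
   (wx * ((g ^+ (m + t + s' - s) * h ^+ (m + t + s' - (m + t + s' - s))) *
   (g' ^+ (m + t) * h' ^+ (m + t + s' - (m + t))))).
Proof.
have -> : zb - g * (zb * g' + h') = zb * (1 - g * g') + - (g * h') by ring.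
rewrite (exprDn (zb * _)) !mulr_sumr; apply: eq_bigr => -[s' /= hs'] _.
rewrite (exprMn _ zb) (exprBn 1) mulr_sumr mulr_suml.
rewrite -mulr_natl !mulr_sumr; apply: eq_bigr => -[t /= ht] _.
rewrite (exprDn (z * g)) !mulr_suml mulr_sumr; apply: eq_bigr => -[s /= hs] _.
rewrite !ltnS in hs' ht hs.
rewrite (_ : (m + t + s' - (m + t + s' - s) = s)%N); last by lia.
rewrite (_ : (m + t + s' - (m + t) = s')%N); last by lia.
rewrite (_ : (m + t + s' - s = (m - s) + t + s')%N); last by lia.
by rewrite !expr1n !exprD (exprNn (g * h')) !exprMn; ring.
Qed.

(** * Spherical averages of zonal kernels *)

Section Zonal.
Variable R : realType.
Local Notation C := R[i].
Local Notation zeta := (zeta R).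

(* A discrete Fourier transform extracting one coefficient of a polynomial in zeta^b, conj(zeta)^d. *)
Definition fcoef (P : nat) (F : 'I_P -> 'I_P -> C) (i j : nat) : C :=
  \sum_(b < P) \sum_(d < P) (P%:R^-1 * (zeta P ^+ b)^* ^+ i) * (P%:R^-1 * (zeta P ^+ d) ^+ j) * F b d.

Lemma fcoefE (P : nat) (c : nat -> nat -> C) (i j : nat) : (i < P)%N -> (j < P)%N ->
  fcoef (fun b d : 'I_P => \sum_(w < P) \sum_(v < P)
    c w v * ((zeta P ^+ b) ^+ w * (zeta P ^+ d)^* ^+ v)) i j = c i j.
Proof.
move=> iP jP; have P0 : (0 < P)%N by exact: leq_ltn_trans iP.
rewrite /fcoef (@exchange_fourier C _ P (fun b : 'I_P => P%:R^-1 * (zeta P ^+ b)^* ^+ i)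
  (fun d : 'I_P => P%:R^-1 * (zeta P ^+ d) ^+ j) c
  (fun w (b : 'I_P) => (zeta P ^+ b) ^+ w) (fun v (d : 'I_P) => (zeta P ^+ d)^* ^+ v)).
have e1 w : \sum_(b < P) (P%:R^-1 * (zeta P ^+ b)^* ^+ i) * (zeta P ^+ b) ^+ w = ZM R P i w.
  by apply: eq_bigr => b _; rewrite mulrA.
have e2 v : \sum_(d < P) (P%:R^-1 * (zeta P ^+ d) ^+ j) * (zeta P ^+ d)^* ^+ v = ZM R P v j.
  by apply: eq_bigr => b _; rewrite -mulrA [_ ^+ j * _]mulrC.
rewrite (@sum1_delta _ _ _ (Ordinal iP)) => [|w ne].
  rewrite (@sum1_delta _ _ _ (Ordinal jP)) => [|v ne].
    by rewrite e1 e2 !ZM_diag // !mulr1.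
  by rewrite e2 ZM_offdiag ?mulr0.
rewrite big1 // => v _; rewrite e1 ZM_offdiag ?mulr0 ?mul0r //.
by rewrite eq_sym; exact: ne.
Qed.

Lemma cvg_fcoef (P : nat) (F : nat -> 'I_P -> 'I_P -> C) (G : 'I_P -> 'I_P -> C) i j :
  (forall b d, F M b d @[M --> \oo] --> G b d) ->
  fcoef (F M) i j @[M --> \oo] --> fcoef G i j.
Proof.
move=> h; apply: cvgC_sum => b; apply: cvgC_sum => d.
by apply: cvgCM; [exact: cvg_cst|exact: h].
Qed.

Lemma dotnDl q (x y e : nat -> C) (c : C) :
  dotn q (fun i => x i + c * y i) e = dotn q x e + c * dotn q y e.
Proof.
rewrite /dotn mulr_sumr -big_split; apply: eq_bigr => i _.
by rewrite mulrDl mulrA.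
Qed.

Lemma dotnDr q (x y e : nat -> C) (c : C) :
  dotn q e (fun i => x i + c * y i) = dotn q e x + c^* * dotn q e y.
Proof. by rewrite -dotnJ dotnDl cconjD cconjM !dotnJ. Qed.

(** Polarisation: for the vectors kap + zeta^b eta, [cvg_mo] is a statement about polynomials of
    degree p in phases, and p + 1 roots of unity suffice to isolate a coefficient. Orthogonality of
    eta and kap leaves only i = j in the limit. *)
Lemma cvg_bimoment k p (eta kap : nat -> C) i j :
  dotn k.+1 eta eta = 1 -> dotn k.+1 eta kap = 0 -> (i <= p)%N -> (j <= p)%N ->
  avg k M (fun e => (dotn k.+1 eta e ^+ i * dotn k.+1 kap e ^+ (p - i)) *
    (dotn k.+1 e eta ^+ j * dotn k.+1 e kap ^+ (p - j))) @[M --> \oo] -->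
  (if i == j then cmass R k p / 'C(p, i)%:R * dotn k.+1 kap kap ^+ (p - i) else 0).
Proof.
move=> ee ek ip jp.
have ke : dotn k.+1 kap eta = 0 by rewrite -dotnJ ek rmorph0.
pose A M w v : C := avg k M (fun e => (dotn k.+1 eta e ^+ w * dotn k.+1 kap e ^+ (p - w)) *
    (dotn k.+1 e eta ^+ v * dotn k.+1 e kap ^+ (p - v))).
pose Y b : nat -> C := fun l => kap l + zeta p.+1 ^+ b * eta l.
have F1 M (b d : 'I_p.+1) : mo k M p p (Y b) (Y d) = \sum_(w < p.+1) \sum_(v < p.+1)
   ('C(p, w)%:R * 'C(p, v)%:R * A M w v) * ((zeta p.+1 ^+ b) ^+ w * (zeta p.+1 ^+ d)^* ^+ v).
  rewrite /mo /A /avg.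
  under [RHS]eq_bigr => w _ do under eq_bigr => v _ do rewrite mulr_sumr mulr_suml.
  under [RHS]eq_bigr => w _ do rewrite exchange_big.
  rewrite [RHS]exchange_big; apply: eq_bigr => x _.
  rewrite dotnDl dotnDr !exprDn big_distrlr mulr_sumr; apply: eq_bigr => w _.
  rewrite mulr_sumr; apply: eq_bigr => v _.
  by rewrite !exprMn /=; ring.
have F2 (b d : 'I_p.+1) : cmass R k p * dotn k.+1 (Y b) (Y d) ^+ p = \sum_(w < p.+1) \sum_(v < p.+1)
   (if w == v then cmass R k p * 'C(p, w)%:R * dotn k.+1 kap kap ^+ (p - w) else 0) *
   ((zeta p.+1 ^+ b) ^+ w * (zeta p.+1 ^+ d)^* ^+ v).
  rewrite dotnDl !dotnDr ek ke ee mulr0 addr0 add0r mulr1 exprDn mulr_sumr.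
  apply: eq_bigr => w _; rewrite (@sum1_delta _ _ _ w) => [|v ne].
    by rewrite eqxx exprMn; ring.
  by rewrite eq_sym (negbTE ne) mul0r.
have H : (fcoef (fun b d : 'I_p.+1 => mo k M p p (Y b) (Y d)) i j) @[M --> \oo] -->
    fcoef (fun b d : 'I_p.+1 => cmass R k p * dotn k.+1 (Y b) (Y d) ^+ p) i j.
  by apply: cvg_fcoef => b d; exact: cvg_mo.
have E1 M : fcoef (fun b d : 'I_p.+1 => mo k M p p (Y b) (Y d)) i j = 'C(p, i)%:R * 'C(p, j)%:R * A M i j.
  rewrite -(@fcoefE p.+1 (fun w v => 'C(p, w)%:R * 'C(p, v)%:R * A M w v)) ?ltnS //.
  by apply: eq_bigr => b _; apply: eq_bigr => d _; rewrite F1.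
have E2 : fcoef (fun b d : 'I_p.+1 => cmass R k p * dotn k.+1 (Y b) (Y d) ^+ p) i j =
    if i == j then cmass R k p * 'C(p, i)%:R * dotn k.+1 kap kap ^+ (p - i) else 0.
  rewrite -(@fcoefE p.+1 (fun w v => if w == v then cmass R k p * 'C(p, w)%:R * dotn k.+1 kap kap ^+ (p - w) else 0)) ?ltnS //.
  by apply: eq_bigr => b _; apply: eq_bigr => d _; rewrite F2.
rewrite E2 in H.
have {}H : ('C(p, i)%:R * 'C(p, j)%:R * A M i j) @[M --> \oo] -->
    (if i == j then cmass R k p * 'C(p, i)%:R * dotn k.+1 kap kap ^+ (p - i) else 0).
  by apply: cvg_trans H; apply: near_eq_cvg; near=> M; rewrite E1.
have bi0 : ('C(p, i)%:R : C) != 0 by rewrite pnatr_eq0 -lt0n bin_gt0.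
have bj0 : ('C(p, j)%:R : C) != 0 by rewrite pnatr_eq0 -lt0n bin_gt0.
have K : (('C(p, i)%:R * 'C(p, j)%:R)^-1 * ('C(p, i)%:R * 'C(p, j)%:R * A M i j)) @[M --> \oo] -->
   ('C(p, i)%:R * 'C(p, j)%:R)^-1 *
    (if i == j then cmass R k p * 'C(p, i)%:R * dotn k.+1 kap kap ^+ (p - i) else 0).
  by apply: cvgCM; [exact: cvg_cst|exact: H].
have -> : (if i == j then cmass R k p / 'C(p, i)%:R * dotn k.+1 kap kap ^+ (p - i) else 0) =
   ('C(p, i)%:R * 'C(p, j)%:R)^-1 *
    (if i == j then cmass R k p * 'C(p, i)%:R * dotn k.+1 kap kap ^+ (p - i) else 0).
  case: eqP => [<-|_]; last by rewrite mulr0.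
  by field; rewrite bi0.
apply: cvg_trans K; apply: near_eq_cvg; near=> M.
by rewrite mulrA mulVf ?mul1r // mulf_neq0.
Unshelve. all: by end_near. Qed.

Definition zonal_kernel (k m n : nat) (xi eta e : nat -> C) : C :=
  dotn k.+1 xi e ^+ m * dotn k.+1 e eta ^+ m *
  (dotn k.+1 eta xi - dotn k.+1 eta e * dotn k.+1 e xi) ^+ n.

(* The spherical mean of zonal_kernel over e is zonal_const times a disc polynomial. *)
Definition zonal_const (a m n : nat) : R :=
  a.+1`!%:R * m`!%:R * (a + n)`!%:R / (a`!%:R * (m + n + a).+1`!%:R).

Lemma zonal_const_gt0 a m n : 0 < zonal_const a m n.
Proof. by rewrite /zonal_const !(divr_gt0, mulr_gt0) ?ltr0n ?fact_gt0. Qed.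

(** An instance of [sum_beta] with k = n - s and A = a + s; its dependence on s is exactly the
    factorial quotient in [disc_coef]. *)
Lemma zonal_beta a m n s : (s <= n)%N ->
  \sum_(t < (n - s).+1) (-1) ^+ t * 'C(n - s, t)%:R *
    (cmass R a.+1 (m + t + s) / 'C(m + t + s, m + t)%:R) =
  (zonal_const a m n)%:C * (s`!%:R * a`!%:R / (a + s)`!%:R).
Proof.
move=> sn.
transitivity (s`!%:R * a.+1`!%:R * (\sum_(t < (n - s).+1) (-1) ^+ t * 'C(n - s, t)%:R *
    ((m + t)`!%:R / (m + t + (a + s).+1)`!%:R)) : C).
  rewrite mulr_sumr; apply: eq_bigr => t _.
  have b0 : ('C(m + t + s, m + t)%:R : C) != 0.
    by rewrite pnatr_eq0 -lt0n bin_gt0 leq_addr.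
  have e : (m + t + s)`!%:R = 'C(m + t + s, m + t)%:R * ((m + t)`!%:R * s`!%:R) :> C.
    by rewrite -!natrM -(@bin_fact (m + t + s) (m + t)) ?leq_addr // addKn.
  rewrite /cmass e (_ : (m + t + s + a.+1 = m + t + (a + s).+1)%N); last by lia.
  field; rewrite b0 /= fact_neq0 //.
rewrite sum_beta (_ : (a + s + (n - s) = a + n)%N); last by lia.
rewrite (_ : (m + (n - s) + (a + s).+1 = (m + n + a).+1)%N); last by lia.
rewrite /zonal_const !rmorphM fmorphV rmorphM /= !rmorph_nat.
field; rewrite !fact_neq0 //.
Qed.

Lemma cvg_zonal a m n (xi eta : nat -> C) :
  dotn a.+2 xi xi = 1 -> dotn a.+2 eta eta = 1 ->
  avg a.+1 M (zonal_kernel a.+1 m n xi eta) @[M --> \oo] -->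
  (zonal_const a m n)%:C * disc_poly a m n (dotn a.+2 xi eta) (dotn a.+2 xi eta)^*.
Proof.
move=> xx ee; set z := dotn a.+2 xi eta; rewrite dotnJ.
have zJ : dotn a.+2 eta xi = z^* by rewrite /z dotnJ.
(* The component of xi orthogonal to eta. Its squared length 1 - |z|^2 produces the powers in
   [disc_poly]. *)
pose kap : nat -> C := fun l => xi l + (- z) * eta l.
have ek : dotn a.+2 eta kap = 0.
  by rewrite dotnDr ee zJ mulr1 rmorphN subrr.
have kk : dotn a.+2 kap kap = 1 - z * z^*.
  by rewrite dotnDl ek mulr0 addr0 dotnDr xx -/z rmorphN mulNr mulrC.
rewrite zJ.
have xie e : dotn a.+2 xi e = z * dotn a.+2 eta e + dotn a.+2 kap e.
  by rewrite dotnDl; ring.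
have exi e : dotn a.+2 e xi = z^* * dotn a.+2 e eta + dotn a.+2 e kap.
  by rewrite dotnDr rmorphN; ring.
pose B M s s' t : C := avg a.+1 M (fun e =>
  (dotn a.+2 eta e ^+ (m + t + s' - s) * dotn a.+2 kap e ^+ (m + t + s' - (m + t + s' - s))) *
  (dotn a.+2 e eta ^+ (m + t) * dotn a.+2 e kap ^+ (m + t + s' - (m + t)))).
pose cf (s s' t : nat) : C := 'C(m, s)%:R * ('C(n, s')%:R * (-1) ^+ s') * ((-1) ^+ t * 'C(n - s', t)%:R) *
   (z ^+ (m - s) * z^* ^+ (n - s')).
have E M : avg a.+1 M (zonal_kernel a.+1 m n xi eta) =
   \sum_(s' < n.+1) \sum_(t < (n - s').+1) \sum_(s < m.+1) cf s s' t * B M s s' t.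
  rewrite /B /avg.
  under [RHS]eq_bigr => s' _ do under eq_bigr => t _ do under eq_bigr => s _ do rewrite mulr_sumr.
  under [RHS]eq_bigr => s' _ do under eq_bigr => t _ do rewrite exchange_big.
  under [RHS]eq_bigr => s' _ do rewrite exchange_big.
  rewrite [RHS]exchange_big; apply: eq_bigr => x _.
  move: (dp R x) (dw R x)%:C => e wx.
  rewrite /zonal_kernel (xie e) (exi e) zJ.
  move: (dotn a.+2 eta e) (dotn a.+2 kap e) (dotn a.+2 e eta) (dotn a.+2 e kap) => g h g' h'.
  exact: zonal_expand.
have -> : (fun M => avg a.+1 M (zonal_kernel a.+1 m n xi eta)) =
   (fun M => \sum_(s' < n.+1) \sum_(t < (n - s').+1) \sum_(s < m.+1) cf s s' t * B M s s' t).
  exact/funext.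
have -> : (zonal_const a m n)%:C * disc_poly a m n z z^* =
    \sum_(s' < n.+1) \sum_(t < (n - s').+1) \sum_(s < m.+1) cf s s' t *
     (if (m + t + s' - s == m + t)%N then cmass R a.+1 (m + t + s') /
       'C(m + t + s', m + t + s' - s)%:R * (1 - z * z^*) ^+ (m + t + s' - (m + t + s' - s)) else 0).
  rewrite /disc_poly mulr_sumr; apply: eq_bigr => -[s' /= hs'] _; rewrite ltnS in hs'.
  rewrite mulrCA mulrA mulrC /disc_coef.
  transitivity ('C(m, s')%:R * 'C(n, s')%:R * (-1) ^+ s' * (z ^+ (m - s') * z^* ^+ (n - s') * (1 - z * z^*) ^+ s') *
     ((zonal_const a m n)%:C * (s'`!%:R * a`!%:R / (a + s')`!%:R))); first by ring.
  rewrite -zonal_beta // mulr_sumr; apply: eq_bigr => -[t /= ht] _.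
  (* The limit keeps only s = s'; if s' > m no such s exists, in agreement with binom(m, s') = 0. *)
  case: (leqP s' m) => sm.
    have sm' : (s' < m.+1)%N by [].
    rewrite (@sum1_delta _ _ _ (Ordinal sm')) => [|[s /= hs] ne].
      rewrite (_ : (m + t + s' - Ordinal sm' == m + t)%N = true); last by apply/eqP => /=; lia.
      rewrite (_ : (m + t + s' - Ordinal sm')%N = (m + t)%N); last by rewrite /=; lia.
      rewrite (_ : (m + t + s' - (m + t))%N = s'); last by lia.
      by rewrite /cf /=; ring.
    rewrite (_ : (_ == _) = false) ?mulr0 //; apply/negbTE/eqP => e.
    by case/eqP: ne; apply: val_inj => /=; lia.
  rewrite (bin_small sm) !mul0r big1 // => -[s /= hs] _.
  by rewrite (_ : (_ == _) = false) ?mulr0 //; apply/negbTE/eqP => e; lia.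
apply: cvgC_sum => -[s' /= hs']; apply: cvgC_sum => -[t /= ht]; apply: cvgC_sum => -[s /= hs].
apply: cvgCM; first exact: cvg_cst.
by rewrite -kk; apply: cvg_bimoment => //; lia.
Qed.

(** The Schur product with a Gram kernel, added up one coordinate at a time. *)
Lemma psd_dot (T : finType) q (K : T -> T -> C) (w : T -> nat -> C) :
  psd K -> psd (fun j l => K j l * dotn q (w j) (w l)).
Proof.
move=> hK; apply: (@psd_ext _ _ (fun j l => \sum_(i < q) K j l * (w j i * (w l i)^*))).
  by move=> j l; rewrite /dotn mulr_sumr.
by apply: psd_sum => i; exact: psd_gram.
Qed.

Lemma psd_dotX (T : finType) q (K : T -> T -> C) (w : T -> nat -> C) p :
  psd K -> psd (fun j l => K j l * dotn q (w j) (w l) ^+ p).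
Proof.
move=> hK; elim: p => [|p IH].
  by apply: psd_ext hK => j l; rewrite mulr1.
apply: psd_ext (psd_dot q w IH) => j l.
by rewrite exprSr mulrA.
Qed.

Lemma psd_zonal (T : finType) k m p (K : T -> T -> C) (X : T -> nat -> C) (e : nat -> C) :
  dotn k.+1 e e = 1 -> psd K ->
  psd (fun j l => K j l * zonal_kernel k m p (X l) (X j) e).
Proof.
move=> e1 hK.
pose w j : nat -> C := fun i => X j i + (- dotn k.+1 (X j) e) * e i.
have := psd_dotX k.+1 w p (psd_gram (fun j => dotn k.+1 e (X j) ^+ m) hK).
apply: psd_ext => j l; rewrite /zonal_kernel cconjX dotnJ -mulrA [_ ^+ m * (_ ^+ m)]mulrC.
congr (_ * (_ * _ ^+ _)).
by rewrite /w dotnDl !dotnDr e1 rmorphN /= dotnJ; ring.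
Qed.

Lemma psd_disc_poly (T : finType) a m p (K : T -> T -> C) (X : T -> nat -> C) :
  (forall j, dotn a.+2 (X j) (X j) = 1) -> psd K ->
  psd (fun j l => K j l * disc_poly a m p (dotn a.+2 (X l) (X j)) (dotn a.+2 (X l) (X j))^*).
Proof.
move=> X1 hK; have z0 := zonal_const_gt0 a m p.
apply: (@psd_ext _ _ (fun j l => ((zonal_const a m p)^-1)%:C * (K j l * ((zonal_const a m p)%:C *
   disc_poly a m p (dotn a.+2 (X l) (X j)) (dotn a.+2 (X l) (X j))^*)))).
  move=> j l; rewrite mulrCA; congr (_ * _).
  by rewrite mulrA -rmorphM /= mulVf ?mul1r // gt_eqF.
apply: psdZ; first by rewrite ler0c invr_ge0 ltW.
apply: (@psd_cvg _ _ (fun M j l => K j l * avg a.+1 M (zonal_kernel a.+1 m p (X l) (X j)))).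
  move=> M; apply: (@psd_ext _ _ (fun j l => \sum_(x : dI a.+1 M)
    (dw R x)%:C * (K j l * zonal_kernel a.+1 m p (X l) (X j) (dp R x)))).
    by move=> j l; rewrite /avg mulr_sumr; apply: eq_bigr => x _; rewrite mulrCA.
  apply: psd_sum => x; apply: psdZ; first by rewrite ler0c dw_ge0.
  by apply: psd_zonal => //; exact: dp_unit.
move=> j l; apply: cvgCM; first exact: cvg_cst.
exact: cvg_zonal.
Qed.

End Zonal.

(** * Binomial expectations for Bernstein approximation *)

Section Bernstein.
Variable K : comNzRingType.

(* The expectation of g under the binomial distribution of N trials with success probability x. *)
Fixpoint bern (N : nat) (x : K) (g : nat -> K) : K :=
  if N is N'.+1 then x * bern N' x (fun k => g k.+1) + (1 - x) * bern N' x g else g 0%N.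

Lemma bernD N x g h : bern N x (fun k => g k + h k) = bern N x g + bern N x h.
Proof.
elim: N g h => [//|N IH] g h /=.
by rewrite !IH; ring.
Qed.

Lemma bernZ N x c g : bern N x (fun k => c * g k) = c * bern N x g.
Proof.
elim: N g => [//|N IH] g /=.
by rewrite !IH; ring.
Qed.

Lemma bern_cst N x c : bern N x (fun=> c) = c.
Proof. by elim: N => [//|N IH] /=; rewrite !IH; ring. Qed.

Lemma eq_bern N x g h : g =1 h -> bern N x g = bern N x h.
Proof. by move=> gh; congr bern; exact/funext. Qed.

Lemma bern_variance N x :
  bern N x (fun k => (k%:R - N%:R * x) ^+ 2) = N%:R * (x * (1 - x)).
Proof.
elim: N => [|N IH] /=; first by rewrite !mul0r subr0 expr0n.
rewrite -!bernZ -bernD.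
rewrite (@eq_bern _ _ _ (fun k => (k%:R - N%:R * x) ^+ 2 + x * (1 - x))).
  by rewrite bernD bern_cst IH -natr1; ring.
by move=> k; rewrite -!natr1; ring.
Qed.

End Bernstein.

(** * Density of polynomials in z and its conjugate *)

Section Density.
Variable R : realType.
Local Notation C := R[i].

Lemma nrm_bern N (x : R) (g : nat -> C) (h : nat -> R) : 0 <= x <= 1 ->
  (forall k, nrm (g k) <= h k) -> nrm (bern N x%:C g) <= bern N x h.
Proof.
move=> x01; move: (x01) => /andP[x0 x1]; elim: N g h => [|N IH] g h gh /=; first exact: gh.
apply: le_trans (nrmD _ _) _; rewrite !nrmM -(rmorph1 (real_complex R)) -rmorphB /= !nrm_real.
rewrite !ger0_norm ?subr_ge0 // lerD // ler_wpM2l ?subr_ge0 // IH //.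
Qed.

Definition mspan (p : C -> C) : Prop := exists s : seq (C * (nat * nat)),
  forall z, p z = \sum_(x <- s) x.1 * (z ^+ x.2.1 * z^* ^+ x.2.2).

Lemma mspan_monomial c m n : mspan (fun z => c * (z ^+ m * z^* ^+ n)).
Proof. by exists [:: (c, (m, n))] => z; rewrite big_seq1. Qed.

Lemma mspanD p r : mspan p -> mspan r -> mspan (fun z => p z + r z).
Proof. by move=> [s hs] [t ht]; exists (s ++ t) => z; rewrite big_cat hs ht. Qed.

Lemma mspanM p r : mspan p -> mspan r -> mspan (fun z => p z * r z).
Proof.
move=> [s hs] [t ht].
exists [seq (x.1 * y.1, (x.2.1 + y.2.1, x.2.2 + y.2.2)%N) | x <- s, y <- t] => z.
rewrite hs ht big_allpairs_dep mulr_suml; apply: eq_bigr => x _.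
rewrite mulr_sumr; apply: eq_bigr => y _ /=.
by rewrite !exprD; ring.
Qed.

Lemma mspan_cst c : mspan (fun=> c).
Proof.
have := mspan_monomial c 0 0; congr mspan.
by apply/funext => z; rewrite !expr0 !mulr1.
Qed.

Lemma mspan_ext p r : p =1 r -> mspan p -> mspan r.
Proof. by move=> /funext ->. Qed.

Lemma mspan_bern N (X : C -> C) (g : nat -> C -> C) : mspan X -> (forall k, mspan (g k)) ->
  mspan (fun z => bern N (X z) (fun k => g k z)).
Proof.
move=> hX; elim: N g => [|N IH] g hg /=; first exact: hg.
apply: mspanD; apply: mspanM => //.
- exact: (IH (fun k => g k.+1)).
- apply: mspan_ext (mspanD (mspan_cst 1) (mspanM (mspan_cst (-1)) hX)) => z.
  by rewrite mulN1r.
- exact: IH.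
Qed.

Lemma contD_mspan p : mspan p -> contD p.
Proof.
move=> [s hs]; have -> : p = (fun z => \sum_(x <- s) x.1 * (z ^+ x.2.1 * z^* ^+ x.2.2)).
  exact/funext.
by apply: contD_sum => x; exact/contDZ/contD_monomial.
Qed.

(** The Bernstein grid fills a square, so nodes off the disc are pulled back radially before the
    function is evaluated. *)
Definition retract (u : C) : C := if nrm u <= 1 then u else (nrm u)^-1%:C * u.

Lemma cdisc_retract u : cdisc (retract u).
Proof.
rewrite /retract cdiscE; case: ifP => [//|/negbT]; rewrite -ltNge => h.
rewrite nrmM nrm_real gtr0_norm ?invr_gt0 ?(lt_trans ltr01) // mulVf // gt_eqF //.
exact: lt_trans h.
Qed.

Lemma nrm_retract u z : cdisc z -> nrm (retract u - z) <= 2 * nrm (u - z).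
Proof.
rewrite cdiscE /retract => Dz; have u0 := nrm_ge0 (u - z).
case: ifP => [_|/negbT]; first by rewrite mulr_natl mulr2n lerDl.
rewrite -ltNge => h; have up : 0 < nrm u by exact: lt_trans h.
have e : nrm ((nrm u)^-1%:C * u - u) = nrm u - 1.
  have -> : (nrm u)^-1%:C * u - u = ((nrm u)^-1 - 1)%:C * u.
    by rewrite rmorphB /= mulrBl mul1r.
  rewrite nrmM nrm_real ler0_norm; last by rewrite subr_le0 invf_le1 // ltW.
  by rewrite opprB mulrBl mul1r mulVf // gt_eqF.
have := nrm_tri u ((nrm u)^-1%:C * u) z; rewrite e.
have := nrm_tri z u 0; rewrite !subr0; lra.
Qed.

(** Bernstein approximation in both coordinates, which are themselves polynomials in z and conj(z).
    The quadratic error in [contD_modulus] is what the binomial variance controls, so near and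
    distant nodes need no separate treatment. *)
Lemma mspan_dense F : contD F -> forall e : R, 0 < e ->
  exists2 p, mspan p & forall z, cdisc z -> nrm (F z - p z) <= e.
Proof.
move=> cF e e0; have e2 : 0 < e / 2 by rewrite divr_gt0.
have [K K0 hK] := contD_modulus cF e2.
have [N hN] : exists N : nat, 8 * K / (e / 2) < N.+1%:R.
  exists (Num.trunc (8 * K / (e / 2))); apply: truncnS_gt.
pose half (x : C) := (x + 1) / 2.
pose X z : C := ((z + z^*) / 2 + 1) / 2.
pose Y z : C := ((z^* - z) / 2 * 'i%C + 1) / 2.
have XE z : X z = ((complex.Re z + 1) / 2)%:C.
  by rewrite /X -ReJ_add !rmorphM rmorphD /= fmorphV rmorph1 rmorph_nat.
have YE z : Y z = ((complex.Im z + 1) / 2)%:C.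
  by rewrite /Y -ImJ_sub !rmorphM rmorphD /= fmorphV rmorph1 rmorph_nat.
pose node (j k : nat) : C := Complex (2 * (j%:R / N.+1%:R) - 1) (2 * (k%:R / N.+1%:R) - 1).
pose p z := bern N.+1 (X z) (fun j => bern N.+1 (Y z) (fun k => F (retract (node j k)))).
have mz : mspan id by apply: mspan_ext (mspan_monomial 1 1 0) => z; rewrite mul1r expr1 mulr1.
have mzb : mspan (fun z => z^*) by apply: mspan_ext (mspan_monomial 1 0 1) => z; rewrite !mul1r.
have mX : mspan X.
  by apply: mspanM (mspan_cst _); apply: mspanD (mspan_cst _); apply: mspanM (mspan_cst _); apply: mspanD.
have mY : mspan Y.
  apply: mspanM (mspan_cst _); apply: mspanD (mspan_cst _); apply: mspanM (mspan_cst _).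
  apply: mspanM (mspan_cst _); apply: mspanD => //.
  by apply: mspan_ext (mspanM (mspan_cst (-1)) mz) => z; rewrite mulN1r.
exists p.
  apply: mspan_bern => // j; apply: mspan_bern => // k; exact: mspan_cst.
move=> z Dz.
set x := (complex.Re z + 1) / 2; set y := (complex.Im z + 1) / 2.
have hRe := le_trans (nrm_Re z) (_ : nrm z <= 1); have hIm := le_trans (nrm_Im z) (_ : nrm z <= 1).
have {hRe} := hRe; rewrite -cdiscE => /(_ Dz); rewrite ler_norml => /andP[r1 r2].
have {hIm} := hIm; rewrite -cdiscE => /(_ Dz); rewrite ler_norml => /andP[i1 i2].
have x01 : 0 <= x <= 1 by rewrite /x; apply/andP; split; lra.
have y01 : 0 <= y <= 1 by rewrite /y; apply/andP; split; lra.
have -> : F z - p z = bern N.+1 x%:C (fun j => bern N.+1 y%:C (fun k => F z - F (retract (node j k)))).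
  rewrite /p XE YE -/x -/y.
  rewrite -{1}(bern_cst N.+1 x%:C (F z)) -mulN1r -bernZ -bernD; apply: eq_bern => j.
  rewrite -{1}(bern_cst N.+1 y%:C (F z)) -bernZ -bernD; apply: eq_bern => k.
  by rewrite mulN1r.
(* One factor 4 is the square of the constant in [nrm_retract], the other comes from the rescaling
   of [0, 1] to [-1, 1]. The two variances add up to at most (N + 1)/2, leaving 8K/(N + 1), which
   the choice of N keeps below e/2. *)
pose L := 16 * K / N.+1%:R ^+ 2.
have n0 : (N.+1%:R : R) != 0 by rewrite pnatr_eq0.
have np : (0 : R) < N.+1%:R by rewrite ltr0n.
have bd j k : nrm (F z - F (retract (node j k))) <=
    (e / 2 + L * (j%:R - N.+1%:R * x) ^+ 2) + L * (k%:R - N.+1%:R * y) ^+ 2.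
  rewrite nrmBC; apply: le_trans (hK _ _ (cdisc_retract _) Dz) _.
  rewrite -addrA lerD2l.
  have h1 : cabs2 (retract (node j k) - z) <= 4 * cabs2 (node j k - z).
    rewrite -!sqr_nrm (_ : 4 * _ = (2 * nrm (node j k - z)) ^+ 2); last by ring.
    by rewrite lerXn2r ?nnegrE ?mulr_ge0 ?nrm_ge0 // nrm_retract.
  apply: le_trans (ler_wpM2l K0 h1) _.
  have -> : cabs2 (node j k - z) = 4 / N.+1%:R ^+ 2 * ((j%:R - N.+1%:R * x) ^+ 2 + (k%:R - N.+1%:R * y) ^+ 2).
    rewrite /cabs2 /node /x /y; move: (N.+1%:R) n0 => M M0; case: (z) => u v /=; field.
    exact: M0.
  rewrite le_eqVlt; apply/orP; left; apply/eqP; rewrite /L; move: (N.+1%:R) n0 => M M0; field.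
  exact: M0.
apply: le_trans (nrm_bern _ x01 (h := fun j => (e / 2 + L * (j%:R - N.+1%:R * x) ^+ 2) + L * (N.+1%:R * (y * (1 - y)))) _) _.
  move=> j; apply: le_trans (nrm_bern _ y01 (bd j)) _.
  by rewrite bernD bern_cst bernZ bern_variance.
rewrite bernD bern_cst bernD bern_cst bernZ bern_variance -addrA -mulrDr -mulrDr.
rewrite [leRHS](splitr e) lerD2l.
have q1 : x * (1 - x) + y * (1 - y) <= 1 / 2.
  have := sqr_ge0 (x - 1 / 2); have := sqr_ge0 (y - 1 / 2); nra.
apply: (@le_trans _ _ (L * (N.+1%:R * (1 / 2)))).
  rewrite !ler_wpM2l // /L.
  by rewrite divr_ge0 ?mulr_ge0 ?exprn_ge0.
have -> : L * (N.+1%:R * (1 / 2)) = 8 * K / N.+1%:R by rewrite /L; move: (N.+1%:R) n0 => M M0; field.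
rewrite ler_pdivrMr // [e / 2 * _]mulrC -ler_pdivrMr //.
exact: ltW.
Qed.

End Density.

Lemma sum_bin_diag (a s : nat) : (\sum_(j < s.+1) 'C(j + a, a) = 'C(s + a.+1, a.+1))%N.
Proof.
elim: s => [|s IH]; first by rewrite big_ord1 !add0n !binn.
by rewrite big_ord_recr /= IH (addnS s.+1) binS addSnnS.
Qed.

Lemma ler_sum2_widen (V : numDomainType) (f : nat -> nat -> V) (k l : nat) : (k <= l)%N ->
  (forall m n, 0 <= f m n) ->
  \sum_(m < k) \sum_(n < k) f m n <= \sum_(m < l) \sum_(n < l) f m n.
Proof.
move=> kl f0.
have w (g : nat -> V) : (forall n, 0 <= g n) -> \sum_(n < k) g n <= \sum_(n < l) g n.
  move=> g0; rewrite (big_ord_widen l g kl) big_mkcond /=.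
  by apply: ler_sum => i _; case: ifP.
apply: le_trans (w (fun m => \sum_(n < l) f m n) _); last by move=> m; apply: sumr_ge0.
by apply: ler_sum => m _; exact: w.
Qed.

(** * Positive definite functions on the disc *)

Section SphereKernels.
Variables (R : realType) (a : nat).
Local Notation C := R[i].
Local Notation Rp m n := (fun z : C => disc_poly a m n z z^*).

Lemma dotn_ge0 q (x : nat -> C) : 0 <= dotn q x x.
Proof. by apply: sumr_ge0 => i _; exact: mulcJ_ge0. Qed.

(** Cauchy-Schwarz, from the squared length of x - (x . y) y. *)
Lemma cdisc_dotn q (x y : nat -> C) : dotn q x x = 1 -> dotn q y y = 1 -> cdisc (dotn q x y).
Proof.
move=> xx yy; have := dotn_ge0 q (fun i => x i + (- dotn q x y) * y i).
rewrite dotnDl !dotnDr xx yy rmorphN /= -[dotn q y x]dotnJ.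
move: (dotn q x y) => z.
have -> : 1 + - z^* * z + - z * (z^* + - z^* * 1) = (1 - cabs2 z)%:C.
  by rewrite rmorphB /= cabs2E rmorph1; ring.
rewrite ler0c subr_ge0 cdiscE -sqr_nrm => h.
by rewrite -(@ler_pXn2r _ 2) ?nnegrE ?nrm_ge0 // expr1n.
Qed.

(** The order [X l], [X j] follows [a11_adj]: if A_j has first column X_j, the upper left entry of
    A_j^-1 A_l is X_l . X_j. *)
Definition psd_sphere (G : C -> C) : Prop :=
  forall (T : finType) (X : T -> nat -> C), (forall j, dotn a.+2 (X j) (X j) = 1) ->
  psd (fun j l => G (dotn a.+2 (X l) (X j))).

Definition pairavg (M : nat) (G : C -> C) : C :=
  \sum_(x : dI a.+1 M) \sum_(y : dI a.+1 M)
    G (dotn a.+2 (dp R y) (dp R x)) * (dw R x)%:C * (dw R y)%:C.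

Lemma pairavg_monomial M m n :
  pairavg M (fun z => z ^+ m * z^* ^+ n) = pairmo R a.+1 M m n.
Proof.
rewrite /pairavg /pairmo /mo /avg exchange_big; apply: eq_bigr => x _ /=.
rewrite mulr_sumr; apply: eq_bigr => y _.
by rewrite dotnJ; ring.
Qed.

Lemma cvg_pairavg_monomial m n :
  pairavg M (fun z => z ^+ m * z^* ^+ n) @[M --> \oo] --> dmean a (fun z : C => z ^+ m * z^* ^+ n).
Proof.
under eq_fun do rewrite pairavg_monomial.
rewrite dmean_monomial; case: eqVneq => [<-|mn].
  rewrite (_ : moment R a m = cmass R a.+1 m); first exact: cvg_pairmo.
  by rewrite /moment /cmass addnS.
apply: cvg_near_cst; near=> M; apply: pairmo_offdiag => //.
  by near: M; exact: nbhs_infty_gt.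
by near: M; exact: nbhs_infty_gt.
Unshelve. all: by end_near. Qed.

Lemma cvg_pairavg_mspan p : mspan p -> pairavg M p @[M --> \oo] --> dmean a p.
Proof.
move=> [s hs]; have -> : p = (fun z => \sum_(x <- s) x.1 * (z ^+ x.2.1 * z^* ^+ x.2.2)).
  exact/funext.
have cm (x : C * (nat * nat)) : contD (fun z : C => z ^+ x.2.1 * z^* ^+ x.2.2).
  exact: contD_monomial.
rewrite dmean_sum => [|x]; last exact/contDZ/cm.
have -> : (fun M => pairavg M (fun z => \sum_(x <- s) x.1 * (z ^+ x.2.1 * z^* ^+ x.2.2))) =
    (fun M => \sum_(x <- s) x.1 * pairavg M (fun z => z ^+ x.2.1 * z^* ^+ x.2.2)).
  apply/funext => M; rewrite /pairavg.
  under [RHS]eq_bigr => x _ do rewrite mulr_sumr.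
  rewrite [RHS]exchange_big; apply: eq_bigr => x _.
  under [RHS]eq_bigr => y _ do rewrite mulr_sumr.
  rewrite [RHS]exchange_big; apply: eq_bigr => y _.
  rewrite !mulr_suml; apply: eq_bigr => u _.
  by rewrite !mulrA.
apply: cvgC_sum => x; rewrite dmeanZ; last exact: cm.
by apply: cvgCM; [exact: cvg_cst|exact: cvg_pairavg_monomial].
Qed.

Lemma cvg_pairavg G : contD G -> pairavg M G @[M --> \oo] --> dmean a G.
Proof.
move=> cG.
(* The total mass is not exactly 1, since the Riemann sums in t are inexact; its convergence bounds
   it by 2, enough for the approximation by polynomials. *)
pose W M : R := \sum_(x : dI a.+1 M) \sum_(y : dI a.+1 M) dw R x * dw R y.
have WE M : pairavg M (fun z => z ^+ 0 * z^* ^+ 0) = (W M)%:C.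
  rewrite /pairavg rmorph_sum; apply: eq_bigr => x _.
  rewrite rmorph_sum; apply: eq_bigr => y _.
  by rewrite !expr0 !mul1r (rmorphM (real_complex R) (dw R x)).
have W0 M : 0 <= W M by apply: sumr_ge0 => x _; apply: sumr_ge0 => y _; rewrite mulr_ge0 ?dw_ge0.
have d00 : dmean a (fun z : C => z ^+ 0 * z^* ^+ 0) = 1.
  by rewrite dmean_monomial moment0.
have W1 : (W M)%:C @[M --> \oo] --> (1 : C).
  by rewrite -d00; under eq_fun do rewrite -WE; exact: (@cvg_pairavg_monomial 0 0).
move/cvgCP: W1 => /(_ 1 ltr01) W1.
apply/cvgCP => e e0; have e8 : 0 < e / 8 by rewrite divr_gt0.
have tri (x y z u v : R) : x <= y + z -> z <= u + v -> y <= e / 4 -> u < e / 8 -> v <= e / 4 -> x < e.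
  by clear -e0 => *; lra.
have [p mp Gp] := mspan_dense cG e8.
have /cvgCP/(_ _ e8) hp := cvg_pairavg_mspan mp.
near=> M.
have W2 : W M <= 2.
  have : nrm (1 - (W M)%:C) < 1 by near: M; exact: W1.
  rewrite -(rmorph1 (real_complex R)) -rmorphB nrm_real ltr_norml => /andP[h _]; lra.
have hp2 : nrm (dmean a p - pairavg M p) < e / 8 by near: M; exact: hp.
have cp := contD_mspan mp.
have h1 : nrm (dmean a G - dmean a p) <= e / 4.
  rewrite -dmeanB //; apply: le_trans (nrm_dmean_le a (contDB cG cp) Gp) _; lra.
have h2 : nrm (pairavg M p - pairavg M G) <= e / 4.
  have -> : pairavg M p - pairavg M G = \sum_(x : dI a.+1 M) \sum_(y : dI a.+1 M)
     (p (dotn a.+2 (dp R y) (dp R x)) - G (dotn a.+2 (dp R y) (dp R x))) * (dw R x * dw R y)%:C.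
    rewrite /pairavg -sumrB; apply: eq_bigr => x _; rewrite -sumrB; apply: eq_bigr => y _.
    by rewrite rmorphM /=; ring.
  apply: (@le_trans _ _ (e / 8 * W M)); last first.
    by apply: le_trans (ler_wpM2l (ltW e8) W2) _; lra.
  rewrite /W mulr_sumr; apply: le_trans (nrm_sum _ _ _) _; apply: ler_sum => x _.
  rewrite mulr_sumr; apply: le_trans (nrm_sum _ _ _) _; apply: ler_sum => y _.
  have ww : 0 <= dw R x * dw R y by rewrite mulr_ge0 ?dw_ge0.
  rewrite nrmM nrm_real (ger0_norm ww); apply: ler_wpM2r; first exact: ww.
  by rewrite nrmBC; apply: Gp; apply: cdisc_dotn; exact: dp_unit.
exact: (tri _ _ _ _ _ (nrm_tri (dmean a p) _ _) (nrm_tri (pairavg M p) _ _) h1 hp2 h2).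
Unshelve. all: by end_near. Qed.

Lemma dmean_psd_ge0 G : contD G -> psd_sphere G -> 0 <= dmean a G.
Proof.
move=> cG hG; apply: (cvg_ge0C _ (cvg_pairavg cG)) => M.
have := hG (dI a.+1 M) (@dp R a.+1 M) (@dp_unit R a.+1 M) (fun x => (dw R x)%:C).
by congr (0 <= _); apply: eq_bigr => x _; apply: eq_bigr => y _; rewrite conj_realC.
Qed.

Lemma psd_sphere_disc G m n : psd_sphere G -> psd_sphere (fun z => G z * disc_poly a m n z z^*).
Proof. by move=> hG T X X1; exact: psd_disc_poly (hG T X X1). Qed.

Lemma psd1 (T : finType) : psd (fun _ _ : T => 1 : C).
Proof.
move=> c; have -> : \sum_j \sum_k 1 * c j * (c k)^* = (\sum_j c j) * (\sum_j c j)^*.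
  rewrite cconj_sum big_distrlr /=; apply: eq_bigr => j _; apply: eq_bigr => k _.
  by rewrite mul1r.
exact: mulcJ_ge0.
Qed.

Definition peak (s : nat) (z : C) : C := \sum_(j < s.+1) 'C(j + a.+1, a.+1)%:R * z ^+ j.

Lemma psd_sphere_peak s : psd_sphere (fun z => peak s z * (peak s z)^*).
Proof.
move=> T X X1.
(* Conjugating the vectors exchanges the arguments, so powers of X_l . X_j are also powers of a Gram
   kernel in the order j, l. *)
pose Xc j : nat -> C := fun i => (X j i)^*.
have zc j l : dotn a.+2 (X l) (X j) = dotn a.+2 (Xc j) (Xc l).
  by apply: eq_bigr => i _; rewrite /Xc cconjK mulrC.
apply: (@psd_ext _ _ (fun j l => \sum_(i < s.+1) \sum_(i' < s.+1)
   ('C(i + a.+1, a.+1)%:R * 'C(i' + a.+1, a.+1)%:R) *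
    (1 * dotn a.+2 (Xc j) (Xc l) ^+ i * dotn a.+2 (X j) (X l) ^+ i'))).
  move=> j l; rewrite /peak cconj_sum big_distrlr /=.
  apply: eq_bigr => i _; apply: eq_bigr => i' _.
  rewrite cconjM cconjX dotnJ -zc rmorph_nat mul1r; ring.
apply: psd_sum => i; apply: psd_sum => i'; apply: psdZ; first by rewrite mulr_ge0 ?ler0n.
by apply/psd_dotX/psd_dotX/psd1.
Qed.

Lemma dmean_square n (c : nat -> C) :
  dmean a (fun z => (\sum_(j < n) c j * z ^+ j) * (\sum_(j < n) c j * z ^+ j)^*) =
  \sum_(j < n) c j * (c j)^* * moment R a j.
Proof.
have -> : (fun z : C => (\sum_(j < n) c j * z ^+ j) * (\sum_(j < n) c j * z ^+ j)^*) =
    (fun z : C => \sum_(i < n) \sum_(j < n) (c i * (c j)^*) * (z ^+ i * z^* ^+ j)).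
  apply/funext => z; rewrite cconj_sum big_distrlr /=.
  apply: eq_bigr => i _; apply: eq_bigr => j _.
  by rewrite cconjM cconjX; ring.
have cc i j : contD (fun z : C => (c i * (c j)^*) * (z ^+ i * z^* ^+ j)).
  exact/contDZ/contD_monomial.
rewrite dmean_sum => [|i]; last by apply: contD_sum => j; exact: cc.
apply: eq_bigr => i _; rewrite dmean_sum => [|j]; last exact: cc.
rewrite (@sum1_delta _ _ _ i) => [|j ne].
  by rewrite dmeanZ ?dmean_monomial ?eqxx //; exact: contD_monomial.
rewrite dmeanZ; last exact: contD_monomial.
by rewrite dmean_monomial eq_sym (_ : (_ == _) = false) ?mulr0 //; exact: negbTE.
Qed.

Lemma moment_bin j : moment R a j = ('C(j + a.+1, a.+1)%:R)^-1.
Proof.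
have := bin_fact (leq_addl j a.+1); rewrite addnK => e.
have x0 := @fact_neq0 C a.+1; have y0 := @fact_neq0 C j.
have c0 : ('C(j + a.+1, a.+1)%:R : C) != 0 by rewrite pnatr_eq0 -lt0n bin_gt0 leq_addl.
by rewrite /moment -addnS -e (mulnC (a.+1)`!) natrM (natrM _ j`!) invfM mulrCA mulfV ?mulr1 // mulf_neq0.
Qed.

Lemma contD_peak s : contD (peak s).
Proof. by apply: contD_sum => j; exact/contDZ/contDX/contD_id. Qed.

Definition peak_mass (s : nat) : R := 'C(s + a.+2, a.+2)%:R.

Lemma peak_mass_gt0 s : 0 < peak_mass s.
Proof. by rewrite ltr0n bin_gt0 leq_addl. Qed.

Lemma nmean_peak s : nmean a (fun z => cabs2 (peak s z)) = peak_mass s.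
Proof.
apply: complexI; rewrite -dmean_real; last exact: (contRD_cabs2 (contD_peak s)).
under eq_fun do rewrite cabs2E.
rewrite (dmean_square s.+1 (fun j => 'C(j + a.+1, a.+1)%:R)) /peak_mass -sum_bin_diag rmorph_nat natr_sum; apply: eq_bigr => j _.
by rewrite moment_bin rmorph_nat mulfK // pnatr_eq0 -lt0n bin_gt0 leq_addl.
Qed.

(** Multiplication by 1 - z takes differences of the coefficients, which by Pascal's rule lowers
    their growth by one order, except for the boundary coefficient at s + 1. *)
Lemma peak_telescope s z : (1 - z) * peak s z =
  \sum_(j < s.+2) (if j == s.+1 :> nat then - 'C(s + a.+1, a.+1)%:R else 'C(j + a, a)%:R) * z ^+ j.
Proof.
rewrite big_ord_recr /= eqxx.
rewrite (eq_bigr (fun j : 'I_s.+1 => 'C(j + a, a)%:R * z ^+ j)) => [|j _]; last first.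
  by rewrite (_ : (_ == _) = false) //; apply/negbTE; rewrite neq_ltn ltn_ord.
rewrite /peak; elim: s => [|s IH].
  by rewrite !big_ord1 !add0n !binn expr0 expr1; ring.
rewrite big_ord_recr /= mulrDr IH [in RHS]big_ord_recr /=.
have e : ('C(s.+1 + a.+1, a.+1)%:R : C) = 'C(s + a.+1, a.+1)%:R + 'C(s.+1 + a, a)%:R.
  by rewrite addSn binS natrD addnS addSn.
by rewrite e [z ^+ s.+2]exprS; ring.
Qed.

Lemma nmean_peak_away s : nmean a (fun z => cabs2 ((1 - z) * peak s z)) <=
  2 * 'C(s + a.+1, a.+1)%:R.
Proof.
have cP : contD (fun z => (1 - z) * peak s z).
  exact: (contDM (contDB (contD_cst 1) (@contD_id R)) (contD_peak s)).
rewrite -lecR -dmean_real; last exact: (contRD_cabs2 cP).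
under eq_fun do rewrite cabs2E peak_telescope.
rewrite (dmean_square _ (fun j => if j == s.+1 then - 'C(s + a.+1, a.+1)%:R else 'C(j + a, a)%:R)).
have bp j : (0 : C) < 'C(j + a.+1, a.+1)%:R by rewrite ltr0n bin_gt0 leq_addl.
rewrite big_ord_recr /= eqxx rmorphM /= !rmorph_nat mulr_natl mulr2n lerD //.
  rewrite -sum_bin_diag natr_sum; apply: ler_sum => j _.
  rewrite (_ : (_ == _) = false); last by apply/negbTE; rewrite neq_ltn ltn_ord.
  rewrite rmorph_nat moment_bin ler_pdivrMr // ler_wpM2l ?ler0n // ler_nat.
  by rewrite addnS binS leq_addl.
rewrite rmorphN rmorph_nat mulrNN moment_bin ler_pdivrMr // ler_wpM2l ?ler0n // ler_nat.
by rewrite addSn binS leq_addr.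
Qed.

Lemma peak_ratio s : 'C(s + a.+1, a.+1)%:R = a.+2%:R / (s + a.+2)%:R * peak_mass s.
Proof.
have := mul_bin_diag (s + a.+2) a.+1; rewrite (_ : (s + a.+2).-1 = (s + a.+1)%N); last by lia.
move=> e; have n0 : ((s + a.+2)%:R : R) != 0 by rewrite pnatr_eq0 addnS.
by rewrite /peak_mass mulrAC -natrM -e natrM mulrC mulKf.
Qed.

(** Against |peak|^2 the quadratic error in [contD_modulus] around 1 becomes the mean of |(1 - z)
    peak|^2, which [peak_ratio] shows to be smaller than the mass by a factor of order 1/s. *)
Lemma cvg_peak H : contD H ->
  ((peak_mass s)^-1)%:C * dmean a (fun z => H z * (peak s z * (peak s z)^*)) @[s --> \oo] --> H 1.
Proof.
move=> cH; apply/cvgCP => e e0; have e4 : 0 < e / 4 by rewrite divr_gt0.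
have [K K0 hK] := contD_modulus cH e4.
have D1 : cdisc (1 : C) by rewrite cdiscE nrm1.
near=> s.
have k0 := peak_mass_gt0 s; have k0' : (peak_mass s)%:C != 0 :> C.
  by rewrite (inj_eq (@complexI R)) gt_eqF.
have cP := contD_peak s; have cPP := contDM cP (contDJ cP).
have cP1 : contD (fun z => (1 - z) * peak s z).
  exact: (contDM (contDB (contD_cst 1) (@contD_id R)) cP).
have eP : dmean a (fun z => peak s z * (peak s z)^*) = (peak_mass s)%:C.
  rewrite -nmean_peak -dmean_real; last exact: (contRD_cabs2 cP).
  by congr dmean; apply/funext => z; rewrite cabs2E.
have -> : H 1 - ((peak_mass s)^-1)%:C * dmean a (fun z => H z * (peak s z * (peak s z)^*)) =
   ((peak_mass s)^-1)%:C * dmean a (fun z => (H 1 - H z) * (peak s z * (peak s z)^*)).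
  have -> : (fun z => (H 1 - H z) * (peak s z * (peak s z)^*)) =
     (fun z => H 1 * (peak s z * (peak s z)^*) - H z * (peak s z * (peak s z)^*)).
    by apply/funext => z; rewrite mulrBl.
  rewrite dmeanB; [|exact: (contDZ (H 1) cPP)|exact: (contDM cH cPP)].
  rewrite dmeanZ // eP mulrBr mulrCA -rmorphM /= mulVf ?mulr1 // gt_eqF //.
rewrite nrmM nrm_real gtr0_norm ?invr_gt0 // mulrC ltr_pdivrMr //.
have cg1 : contRD (fun z => e / 4 * cabs2 (peak s z)) by apply: contRDZ; exact: (contRD_cabs2 cP).
have cg2 : contRD (fun z => K * cabs2 ((1 - z) * peak s z)) by apply: contRDZ; exact: (contRD_cabs2 cP1).
apply: le_lt_trans (@nrm_dmean _ a _ (fun z => e / 4 * cabs2 (peak s z) + K * cabs2 ((1 - z) * peak s z)) _ _ _) _.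
- exact: (contDM (contDB (contD_cst (H 1)) cH) cPP).
- exact: contRDD.
- move=> z Dz; rewrite !nrmM nrmJ -expr2 sqr_nrm -[cabs2 (_ * _)]sqr_nrm nrmM exprMn !sqr_nrm.
  by rewrite mulrA -mulrDl ler_wpM2r ?cabs2_ge0 // hK.
rewrite nmeanD // !nmeanZ; try exact: (contRD_cabs2 cP); try exact: (contRD_cabs2 cP1).
rewrite nmean_peak.
have h := ler_wpM2l K0 (nmean_peak_away s); rewrite peak_ratio in h.
have hs : 4 * K * a.+2%:R / (s + a.+2)%:R < e / 2.
  rewrite ltr_pdivrMr ?ltr0n ?addnS // [e / 2 * _]mulrC -ltr_pdivrMr; last by rewrite divr_gt0.
  have : 4 * K * a.+2%:R / (e / 2) < s%:R by near: s; exact: nbhs_infty_gtr.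
  by move=> /lt_le_trans; apply; rewrite ler_nat; lia.
have hs2 : 4 * K * a.+2%:R / (s + a.+2)%:R * peak_mass s < e / 2 * peak_mass s by rewrite ltr_pM2r.
apply: (@le_lt_trans _ _ (2 * (e / 4 * peak_mass s) + 4 * K * a.+2%:R / (s + a.+2)%:R * peak_mass s)).
  rewrite mulrDr lerD2l; apply: le_trans (ler_wpM2l _ h) _ => //.
  by rewrite le_eqVlt; apply/orP; left; apply/eqP; ring.
clear -hs2; set u := peak_mass s in hs2 *; set v := 4 * K * _ / _ * u in hs2 *; lra.
Unshelve. all: by end_near. Qed.

End SphereKernels.

(** * Fourier coefficients with respect to the disc polynomials *)

Section Coefficients.
Variables (R : realType) (a : nat).
Local Notation C := R[i].

Lemma conj_disc m n (z : C) : (disc_poly a m n z z^*)^* = disc_poly a n m z z^*.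
Proof. by rewrite conj_disc_poly cconjK disc_polyC. Qed.

Definition coef (F : C -> C) (m n : nat) : C :=
  (disc_norm R a m n)%:C * dmean a (fun z : C => F z * (disc_poly a m n z z^*)^*).

Lemma contD_coef F m n : contD F -> contD (fun z : C => F z * (disc_poly a m n z z^*)^*).
Proof. by move=> cF; apply: contDM => //; apply: contDJ; exact: contD_disc_poly. Qed.

Lemma coef_ge0 F m n : contD F -> psd_sphere a F -> 0 <= coef F m n.
Proof.
move=> cF hF; rewrite /coef mulr_ge0 ?ler0c ?(ltW (disc_norm_gt0 _ _ _ _)) //.
apply: dmean_psd_ge0; first exact: contD_coef.
by under eq_fun do rewrite conj_disc; exact: psd_sphere_disc.
Qed.

Lemma disc_poly1 m n : disc_poly a m n 1 (@cconj R 1) = 1.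
Proof.
have -> : (@cconj R 1) = 1 by rewrite rmorph1.
rewrite /disc_poly big_ord_recl big1 => [|i _].
  by rewrite mulr1 subrr expr0 !expr1n !mulr1 addr0 /disc_coef expr0 !bin0 !mulr1 !mul1r addn0
    divff ?fact_neq0.
by rewrite mulr1 subrr expr0n /= mul0r mulr0.
Qed.

Lemma disc_span_peak s : disc_span a s.+1 (fun z : C => peak a s z * (peak a s z)^*).
Proof.
have -> : (fun z : C => peak a s z * (peak a s z)^*) = fun z => \sum_(j < s.+1) \sum_(k < s.+1)
    ('C(j + a.+1, a.+1)%:R * 'C(k + a.+1, a.+1)%:R) * (z ^+ j * z^* ^+ k).
  apply/funext => z; rewrite /peak cconj_sum big_distrlr /=.
  apply: eq_bigr => j _; apply: eq_bigr => k _.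
  by rewrite cconjM cconjX rmorph_nat; ring.
apply: disc_span_sum => j _; apply: disc_span_sum => k _; apply: disc_spanZ.
exact: disc_span_monomial.
Qed.

(** Since |peak|^2 is a combination of finitely many disc polynomials, this case of Parseval's
    formula is a finite sum and presupposes no expansion of F. *)
Lemma dmean_peak_coef F s : contD F ->
  dmean a (fun z : C => F z * (peak a s z * (peak a s z)^*)) =
  \sum_(m < s.+1) \sum_(n < s.+1) coef F m n *
    dmean a (fun z : C => disc_poly a m n z z^* * (peak a s z * (peak a s z)^*)).
Proof.
move=> cF; have [d hd] := disc_span_peak s.
have hd' z : peak a s z * (peak a s z)^* =
   (\sum_(m < s.+1) \sum_(n < s.+1) d m n * disc_poly a m n z z^*)^*.
  by rewrite -hd cconjM cconjK mulrC.
under eq_fun do rewrite hd'.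
rewrite dmean_span; last exact: cF.
apply: eq_bigr => m _; apply: eq_bigr => n _.
under [in RHS]eq_fun do rewrite hd'.
rewrite dmean_span_coef // /coef; have N0 := disc_norm_gt0 R a m n.
have : (disc_norm R a m n)%:C * ((disc_norm R a m n)^-1)%:C = 1.
  by rewrite -rmorphM /= divff // gt_eqF.
move: (dmean _ _) (d m n)^* (_%:C) (_%:C) => D e N M NM.
rewrite -[e * D]mul1r -NM; ring.
Qed.

(** All terms in [dmean_peak_coef] are nonnegative, so the block of size K is at most the full sum
    once s >= K. After division by the mass, the full sum tends to F 1 and the factor of each
    coefficient to R_{m,n}(1) = 1. *)
Lemma coef_sum_le F K : contD F -> psd_sphere a F ->
  \sum_(m < K) \sum_(n < K) coef F m n <= F 1.
Proof.
move=> cF hF.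
pose w s : C := ((peak_mass R a s)^-1)%:C.
pose D m n s := w s * dmean a (fun z : C => disc_poly a m n z z^* * (peak a s z * (peak a s z)^*)).
pose u s := w s * dmean a (fun z : C => F z * (peak a s z * (peak a s z)^*)) -
  \sum_(m < K) \sum_(n < K) coef F m n * D m n s.
have w0 s : 0 <= w s by rewrite ler0c invr_ge0 ltW // peak_mass_gt0.
have D0 m n s : 0 <= D m n s.
  rewrite mulr_ge0 //; apply: dmean_psd_ge0.
    by have cP := contD_peak R a s; exact: (contDM (contD_disc_poly R a m n) (contDM cP (contDJ cP))).
  under eq_fun do rewrite mulrC.
  exact: (psd_sphere_disc m n (psd_sphere_peak s)).
rewrite -subr_ge0; apply: (@cvg_ge0C _ (fun N => u (N + K)%N)) => [N|].
  rewrite /u subr_ge0 dmean_peak_coef // mulr_sumr.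
  under [leRHS]eq_bigr do rewrite mulr_sumr.
  under [leRHS]eq_bigr do under eq_bigr do rewrite mulrCA.
  apply: (@ler_sum2_widen _ (fun m n => coef F m n * D m n (N + K)%N)); first by lia.
  by move=> m n; rewrite mulr_ge0 ?coef_ge0.
apply: (@cvg_comp _ _ _ (fun N => (N + K)%N) u); first exact: cvg_addnr.
have -> : F 1 - \sum_(m < K) \sum_(n < K) coef F m n =
    F 1 + -1 * \sum_(m < K) \sum_(n < K) coef F m n * 1.
  by rewrite mulN1r; congr (_ - _); apply: eq_bigr => m _; apply: eq_bigr => n _; rewrite mulr1.
have -> : u = fun s => w s * dmean a (fun z : C => F z * (peak a s z * (peak a s z)^*)) +
  -1 * \sum_(m < K) \sum_(n < K) coef F m n * D m n s.
  by apply/funext => s; rewrite mulN1r.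
apply: cvgCD; first exact: cvg_peak.
apply: cvgCM; first exact: cvg_cst.
apply: cvgC_sum => m; apply: cvgC_sum => n; apply: cvgCM; first exact: cvg_cst.
by rewrite -[X in _ --> X](disc_poly1 m n); exact: (cvg_peak a (contD_disc_poly R a m n)).
Qed.

(** H is orthogonal to every polynomial p in z and conj(z), so the mean of |H|^2 equals that of H
    conj(H - p), which density makes small. *)
Lemma dmean_complete H : contD H ->
  (forall m n, dmean a (fun z : C => H z * (disc_poly a m n z z^*)^*) = 0) ->
  forall z, cdisc z -> H z = 0.
Proof.
move=> cH hH; refine (@dmean_eq0 R a H cH _).
have orth p : mspan p -> dmean a (fun z : C => H z * (p z)^*) = 0.
  move=> [s hs].
  have -> : (fun z => H z * (p z)^*) = fun z =>
      \sum_(x <- s) x.1^* * (H z * (z ^+ x.2.1 * z^* ^+ x.2.2)^*).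
    apply/funext => z; rewrite hs cconj_sum mulr_sumr; apply: eq_bigr => x _.
    by rewrite cconjM mulrCA.
  have cM m n : contD (fun z => H z * (z ^+ m * z^* ^+ n)^*).
    by apply: contDM => //; apply: contDJ; exact: contD_monomial.
  rewrite dmean_sum; last by move=> x; exact/contDZ/cM.
  rewrite big1 // => -[c [m n]] _ /=; rewrite dmeanZ; last exact: cM.
  have [d hd] : disc_span a (maxn m n).+1 (fun z : C => z ^+ m * z^* ^+ n).
    by apply: disc_span_monomial; lia.
  under eq_fun do rewrite hd.
  rewrite dmean_span; last exact: cH.
  rewrite big1 ?mulr0 // => i _; rewrite big1 // => j _.
  by rewrite hH mulr0.
have [B B0 hB] := contD_bounded cH.
apply/nrm_eq0/eqP; rewrite eq_le nrm_ge0 andbT; apply/ler_addgt0Pl => e e0.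
rewrite addr0.
(* The 2 offsets the factor in [nrm_dmean_le]; B + 1 replaces the bound B of H because B may be
   0. *)
have B2 : 0 < 2 * (B + 1) by lra.
have [p sp hp] := mspan_dense cH (divr_gt0 e0 B2).
have cp := contD_mspan sp; have cHp := contDB cH cp.
have -> : dmean a (fun z : C => H z * (H z)^*) = dmean a (fun z : C => H z * (H z - p z)^*).
  have -> : (fun z => H z * (H z)^*) = fun z => H z * (H z - p z)^* + H z * (p z)^*.
    by apply/funext => z; rewrite -mulrDr -cconjD subrK.
  rewrite dmeanD; [|exact: (contDM cH (contDJ cHp))|exact: (contDM cH (contDJ cp))].
  by rewrite (orth _ sp) addr0.
apply: le_trans (@nrm_dmean_le _ a _ (B * (e / (2 * (B + 1)))) _ _) _.
- exact: (contDM cH (contDJ cHp)).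
- by move=> z Dz; rewrite nrmM nrmJ ler_pM ?nrm_ge0 ?hB ?hp.
have -> : 2 * (B * (e / (2 * (B + 1)))) = e * (B / (B + 1)).
  by field; rewrite gt_eqF //; lra.
by rewrite ler_piMr ?ltW // ltr_pdivrMr; lra.
Qed.

End Coefficients.

(** * Uniformly convergent series of disc polynomials *)

Lemma sum2_widen (V : nmodType) (f : nat -> nat -> V) (k l : nat) : (k <= l)%N ->
  \sum_(m < k) \sum_(n < k) f m n =
  \sum_(m < l) \sum_(n < l) if (m < k)%N && (n < k)%N then f m n else 0.
Proof.
move=> kl; rewrite (big_ord_widen _ (fun m => \sum_(n < k) f m n) kl) big_mkcond.
apply: eq_bigr => m _; case: (m < k)%N => /=; last by rewrite big1.
by rewrite (big_ord_widen _ (fun n => f m n) kl) big_mkcond.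
Qed.

Section DiscSeries.
Variables (R : realType) (a : nat).
Local Notation C := R[i].

Lemma cconj0 : (@cconj R 0) = 0.
Proof. exact: rmorph0. Qed.

Lemma cconj1 : (@cconj R 1) = 1.
Proof. exact: rmorph1. Qed.

Lemma nrm_tri3 (p p' w z : C) : nrm (w - z) <= nrm (w - p) + nrm (p - p') + nrm (z - p').
Proof.
apply: le_trans (nrm_tri p _ _) _; rewrite -addrA lerD2l (nrmBC z).
exact: nrm_tri.
Qed.

Lemma lt_third (x y z t e : R) : x <= t -> y < e / 3 -> z <= t -> t < e / 3 -> x + y + z < e.
Proof. lra. Qed.

Lemma nrm_sum2_diff (f : nat -> nat -> C) (g : nat -> nat -> R) (k l : nat) : (k <= l)%N ->
  (forall m n, nrm (f m n) <= g m n) ->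
  nrm (\sum_(m < l) \sum_(n < l) f m n - \sum_(m < k) \sum_(n < k) f m n) <=
  \sum_(m < l) \sum_(n < l) g m n - \sum_(m < k) \sum_(n < k) g m n.
Proof.
move=> kl fg; rewrite !(sum2_widen _ kl) -!sumrB.
apply: le_trans (nrm_sum _ _ _) _; apply: ler_sum => m _; rewrite -!sumrB.
apply: le_trans (nrm_sum _ _ _) _; apply: ler_sum => n _.
by case: ifP => _; rewrite ?subrr ?nrm0 ?subr0.
Qed.

Lemma psd2 (K : bool -> bool -> C) (r : R) : psd K ->
  K false false = r%:C -> K true true = r%:C -> nrm (K false true) <= r.
Proof.
move=> hK K0 K1.
have h t : 0 <= r%:C * (1 + t * t^*) + K false true * t^* + K true false * t.
  pose c (b : bool) : C := if b then t else 1.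
  have e0 : (c false)^* = c false by rewrite [LHS]cconj1.
  have := hK c; rewrite !big_bool K0 K1 e0 -[c true]/t -[c false]/1.
  congr (0 <= _); clear; move: t^* (K _ _) (K _ _) (r%:C) => u x y z /=; ring.
case E01 : (K false true) h => [a1 a2]; case: (K true false) => [b1 b2] h.
have hh t1 t2 : 0 <= r * (1 + t1 ^+ 2 + t2 ^+ 2) + (a1 * t1 + a2 * t2) + (b1 * t1 - b2 * t2) /\
   a2 * t1 - a1 * t2 + (b1 * t2 + b2 * t1) = 0.
  have := h (Complex t1 t2); rewrite lecE /= => /andP[/eqP h1 h2]; split; last by rewrite -h1; ring.
  by apply: le_trans h2 _; rewrite le_eqVlt; apply/orP; left; apply/eqP; ring.
(* Nonnegativity in [C] includes a vanishing imaginary part; at t = 1 and t = i this makes the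
   kernel Hermitian. *)
have [_ e1] := hh 1 0; have [_ e2] := hh 0 1.
have eb1 : b1 = a1 by lra.
have eb2 : b2 = - a2 by lra.
have [r0 _] := hh 0 0.
set N := nrm _; have N0 : 0 <= N := nrm_ge0 _.
have N2 : N ^+ 2 = a1 ^+ 2 + a2 ^+ 2 by rewrite sqr_nrm.
have [N_eq0|Nn0] := eqVneq N 0; first by rewrite N_eq0; lra.
(* With t minus the phase of [K false true], the form takes the value 2r - 2N. *)
have [h3 _] := hh (- (a1 / N)) (- (a2 / N)); move: h3; rewrite eb1 eb2.
have -> : r * (1 + (- (a1 / N)) ^+ 2 + (- (a2 / N)) ^+ 2) +
   (a1 * - (a1 / N) + a2 * - (a2 / N)) + (a1 * - (a1 / N) - - a2 * - (a2 / N)) =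
   r * (1 + (a1 ^+ 2 + a2 ^+ 2) / N ^+ 2) - 2 * ((a1 ^+ 2 + a2 ^+ 2) / N) by field.
rewrite -N2 divff ?expf_neq0 // expr2 mulfK //; lra.
Qed.

(** The bound is read off from positivity: e_1 and (z, sqrt(1 - |z|^2), 0, ...) are unit vectors
    with inner product z, and the two-point kernel they define has diagonal R_{m,n}(1) = 1. *)
Lemma nrm_disc_poly m n (z : C) : cdisc z -> nrm (disc_poly a m n z z^*) <= 1.
Proof.
rewrite cdiscE => Dz.
have c0 : 0 <= 1 - cabs2 z.
  by rewrite subr_ge0 -sqr_nrm expr_le1 ?nrm_ge0.
pose X (b : bool) (i : nat) : C := if b then (if i == 0%N then z else
  if i == 1%N then (Num.sqrt (1 - cabs2 z))%:C else 0) else (i == 0%N)%:R.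
have X0 x : dotn a.+2 x (X false) = x 0%N.
  rewrite /dotn big_ord_recl big1 => [|i _].
    by rewrite -[X false _]/(1 : C) cconj1 mulr1 addr0.
  by rewrite -[X false _]/(0 : C) cconj0 mulr0.
have X1 : dotn a.+2 (X true) (X true) = 1.
  rewrite /dotn 2!big_ord_recl big1 => [|i _]; last by rewrite -[X true _]/(0 : C) mul0r.
  rewrite -[X true (ord0 : 'I_a.+2)]/z -[X true _]/((Num.sqrt (1 - cabs2 z))%:C).
  rewrite addr0 conj_realC -rmorphM /= -expr2 sqr_sqrtr //.
  by rewrite -cabs2E -rmorphD /= addrC subrK.
have Xu j : dotn a.+2 (X j) (X j) = 1 by case: j => //; rewrite X0.
have hK := psd_disc_poly m n Xu (@psd1 R bool).
have := @psd2 _ 1 hK; rewrite /= !mul1r => {hK} h.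
have e00 : disc_poly a m n (dotn a.+2 (X false) (X false)) (dotn a.+2 (X false) (X false))^* = 1.
  by rewrite Xu disc_poly1.
have e11 : disc_poly a m n (dotn a.+2 (X true) (X true)) (dotn a.+2 (X true) (X true))^* = 1.
  by rewrite Xu disc_poly1.
by have := h e00 e11; rewrite X0.
Qed.

Definition dpsum (b : nat -> nat -> C) (N : nat) (z : C) : C :=
  \sum_(m < N) \sum_(n < N) b m n * disc_poly a m n z z^*.

Lemma contD_dpsum b N : contD (dpsum b N).
Proof. by apply: contD_sum => m; apply: contD_sum => n; exact/contDZ/contD_disc_poly. Qed.

Lemma nrm_coef_diff F G m n e : contD F -> contD G ->
  (forall z, cdisc z -> nrm (F z - G z) <= e) ->
  nrm (coef a F m n - coef a G m n) <= disc_norm R a m n * (2 * e).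
Proof.
move=> cF cG FG; have N0 := disc_norm_gt0 R a m n.
rewrite /coef -mulrBr nrmM nrm_real gtr0_norm // ler_wpM2l ?(ltW N0) //.
rewrite -dmeanB; try exact: contD_coef.
apply: nrm_dmean_le.
  by apply: contDB; exact: contD_coef.
move=> z Dz; rewrite -mulrBl nrmM nrmJ -[leRHS]mulr1.
by rewrite ler_pM ?nrm_ge0 ?nrm_disc_poly ?FG.
Qed.

Section Majorized.
Variables (b : nat -> nat -> C) (s : nat -> nat -> R).
Hypothesis bs : forall m n, nrm (b m n) <= s m n.
Let S N := \sum_(m < N) \sum_(n < N) s m n.

Lemma dpsum_diff z k l : cdisc z -> (k <= l)%N ->
  nrm (dpsum b l z - dpsum b k z) <= S l - S k.
Proof.
move=> Dz kl.
apply: (nrm_sum2_diff (f := fun m n => b m n * disc_poly a m n z z^*) kl) => m n.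
by rewrite nrmM; apply: le_trans (bs m n); rewrite ler_piMr ?nrm_ge0 ?nrm_disc_poly.
Qed.

Lemma dpsum_tail (z l : C) (t : R) N : cdisc z -> dpsum b n z @[n --> \oo] --> l -> S n @[n --> \oo] --> t ->
  nrm (l - dpsum b N z) <= t - S N.
Proof.
move=> Dz cl ct.
have c1 : (fun n => nrm (dpsum b n z - dpsum b N z)) @ \oo --> nrm (l - dpsum b N z).
  by apply: cvg_nrm; exact: (cvgCD _ cl (cvg_cst (- dpsum b N z))).
have c2 : (fun n => S n - S N) @ \oo --> t - S N by apply: cvgB => //; exact: cvg_cst.
apply: (ler_cvg_to c1 c2); near=> n; apply: dpsum_diff => //.
by near: n; exact: nbhs_infty_ge.
Unshelve. all: by end_near. Qed.

(** Both x + S and S are bounded and nondecreasing, so monotone convergence applies to each and x is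
    their difference. *)
Lemma cvg_majorized (x : nat -> R) (t : R) : S n @[n --> \oo] --> t ->
  (forall k l, (k <= l)%N -> `|x l - x k| <= S l - S k) -> cvgn x.
Proof.
move=> ct hx.
have nS : nondecreasing_seq S.
  by move=> k l kl; rewrite -subr_ge0; exact: le_trans (hx _ _ kl).
have St n : S n <= t.
  by rewrite -(cvg_lim _ ct) //; apply: nondecreasing_cvgn_le => //; apply/cvg_ex; exists t.
have -> : x = (fun n => (x n + S n) - S n) by apply/funext => n; rewrite addrK.
apply: is_cvgB; last by apply/cvg_ex; exists t.
apply: nondecreasing_is_cvgn.
  by move=> k l kl; have := hx _ _ kl; rewrite ler_norml => /andP[h _]; lra.
exists (x 0%N + t + t - S 0%N) => _ [n _ <-].
by have := hx _ _ (leq0n n); have := St n; rewrite ler_norml => h /andP[_ h']; lra.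
Qed.

Lemma dpsum_cvg (z : C) (t : R) : cdisc z -> S n @[n --> \oo] --> t ->
  exists l : C, dpsum b n z @[n --> \oo] --> l.
Proof.
move=> Dz ct.
have H (p : C -> R) : (forall u v, p (u - v) = p u - p v) -> (forall u, `|p u| <= nrm u) ->
    exists l : R, p (dpsum b n z) @[n --> \oo] --> l.
  move=> pB pn; apply/cvg_ex; apply: cvg_majorized ct _ => k l kl.
  by rewrite -pB; apply: le_trans (pn _) _; exact: dpsum_diff.
have [u cu] := H (@complex.Re R) (fun u v => raddfB _ u v) (@nrm_Re R).
have [v cv] := H (@complex.Im R) (fun u v => raddfB _ u v) (@nrm_Im R).
exists (Complex u v).
have -> : (fun n => dpsum b n z) = fun n => Complex (complex.Re (dpsum b n z)) (complex.Im (dpsum b n z)).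
  by apply/funext => n; case: (dpsum b n z).
exact: cvg_Complex.
Qed.

(** As soon as k > m, n, orthogonality gives the k-th partial sum the coefficient [b m n]; the
    uniform tail bound t - S k then passes to coefficients. *)
Lemma coef_uniform (G : C -> C) (t : R) m n : contD G -> S n @[n --> \oo] --> t ->
  (forall z, cdisc z -> dpsum b n z @[n --> \oo] --> G z) -> coef a G m n = b m n.
Proof.
move=> cG ct hG; have N0 := disc_norm_gt0 R a m n.
set D := disc_norm R a m n in N0 *.
apply/eqP; rewrite -subr_eq0; apply/eqP/nrm_eq0/eqP; rewrite eq_le nrm_ge0 andbT.
have c1 : (fun k => D * (2 * (t - S k))) @ \oo --> D * (2 * (t - t)).
  by apply: cvgM; [exact: cvg_cst|apply: cvgM; [exact: cvg_cst|apply: cvgB => //; exact: cvg_cst]].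
rewrite subrr !mulr0 in c1.
rewrite -(cvg_lim _ c1) //; apply: limr_ge; first by apply/cvg_ex; exists 0.
near=> k.
have mk : (m < k)%N by near: k; exact: nbhs_infty_gt.
have nk : (n < k)%N by near: k; exact: nbhs_infty_gt.
have cP := contD_dpsum b k.
have -> : b m n = coef a (dpsum b k) m n.
  rewrite /coef -/D.
  have -> : dmean a (fun z : C => dpsum b k z * (disc_poly a m n z z^*)^*) = b m n * (D^-1)%:C.
    have cR := contD_disc_poly R a m n.
    have -> : (fun z : C => dpsum b k z * (disc_poly a m n z z^*)^*) =
        (fun z => (disc_poly a m n z z^* * (dpsum b k z)^*)^*).
      by apply/funext => z; rewrite cconjM cconjK mulrC.
    rewrite dmeanJ; last exact: (contDM cR (contDJ cP)).
    by rewrite dmean_span_coef // cconjM cconjK conj_realC.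
  by rewrite mulrCA -rmorphM /= mulfV ?mulr1 // gt_eqF.
by apply: nrm_coef_diff => // z Dz; apply: dpsum_tail => //; exact: hG.
Unshelve. all: by end_near. Qed.

Lemma disc_expand (F : C -> C) (t : R) : contD F -> (forall m n, coef a F m n = b m n) -> S n @[n --> \oo] --> t ->
  forall z, cdisc z -> dpsum b n z @[n --> \oo] --> F z.
Proof.
move=> cF hF ct.
have /choice[G hG] z : exists l : C, cdisc z -> dpsum b n z @[n --> \oo] --> l.
  have [Dz|nD] := pselect (cdisc z); last by exists 0.
  by have [l hl] := dpsum_cvg Dz ct; exists l.
have cG : contD G.
  apply/contDP => w Dw e e0.
  have e3 : 0 < e / 3 by rewrite divr_gt0.
  have [N hN] : exists N, t - S N < e / 3.
    have c1 : (fun k => t - S k) @ \oo --> t - t by apply: cvgB => //; exact: cvg_cst.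
    rewrite subrr in c1; have /cvgr_lt/(_ _ e3) [N _ h] := c1.
    by exists N; apply: h => /=.
  have /contDP/(_ w Dw _ e3) [d d0 hd] := contD_dpsum b N.
  exists d => // z Dz zw; apply: le_lt_trans (nrm_tri3 (dpsum b N w) (dpsum b N z) _ _) _.
  exact: (lt_third (dpsum_tail N Dw (hG w Dw) ct) (hd z Dz zw) (dpsum_tail N Dz (hG z Dz) ct) hN).
have FG : forall z, cdisc z -> F z - G z = 0.
  apply: (@dmean_complete R a _ (contDB cF cG)) => m n.
  have N0 := disc_norm_gt0 R a m n.
  apply: (@mulfI _ (disc_norm R a m n)%:C).
    by rewrite (inj_eq (@complexI R)) gt_eqF.
  have -> : (fun z : C => (F z - G z) * (disc_poly a m n z z^*)^*) =
     fun z => F z * (disc_poly a m n z z^*)^* - G z * (disc_poly a m n z z^*)^*.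
    by apply/funext => z; rewrite mulrBl.
  rewrite dmeanB; try exact: contD_coef.
  rewrite mulrBr mulr0; apply/eqP; rewrite subr_eq0; apply/eqP.
  exact: (etrans (hF m n) (esym (coef_uniform m n cG ct hG))).
by move=> z Dz; have /subr0_eq -> := FG z Dz; exact: hG.
Qed.

End Majorized.
End DiscSeries.

(** * Unitary matrices with a prescribed first column *)

Section UnitaryMatrices.
Variables (R : realType) (q : nat).
Local Notation C := R[i].
Implicit Types A B : 'M[C]_q.+1.

Lemma a11E A : a11 A = A ord0 ord0.
Proof.
have e1E i : e1 R q.+1 i ord0 = (i == ord0)%:R by rewrite mxE.
rewrite /a11 /cdot (@sum1_delta _ _ (fun k => (A *m e1 R q.+1) k ord0 * (e1 R q.+1 k ord0)^*) ord0).
  rewrite e1E eqxx cconj1 mulr1 mxE.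
  rewrite (@sum1_delta _ _ (fun k => A ord0 k * e1 R q.+1 k ord0) ord0).
    by rewrite e1E eqxx mulr1.
  by move=> i /negbTE ni; rewrite e1E ni mulr0.
by move=> i /negbTE ni; rewrite e1E ni cconj0 mulr0.
Qed.

Lemma cconjN (z : C) : (- z)^* = - z^*.
Proof. exact: rmorphN. Qed.

Lemma cconjB (z w : C) : (z - w)^* = z^* - w^*.
Proof. exact: rmorphB. Qed.

Lemma conj_nat n : (n%:R : C)^* = n%:R.
Proof. exact: rmorph_nat. Qed.

Definition column A (i : nat) : C := A (inord i) ord0.

Lemma a11_adj A B : a11 (adjmx A *m B) = dotn q.+1 (column B) (column A).
Proof.
rewrite a11E mxE; apply: eq_bigr => i _; rewrite /column !inord_val /adjmx !mxE.
exact: mulrC.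
Qed.

Lemma column_unit A : unitary_mx A -> dotn q.+1 (column A) (column A) = 1.
Proof. by move=> /mulmx1C hA; rewrite -a11_adj hA a11E mxE. Qed.

Lemma cdisc_a11 A : unitary_mx A -> cdisc (a11 A).
Proof.
have adj1 : adjmx 1%:M = 1%:M :> 'M[C]_q.+1.
  by apply/matrixP => i j; rewrite !mxE conj_nat eq_sym.
move=> hA; rewrite -[A]mul1mx -adj1 a11_adj; apply: cdisc_dotn; apply: column_unit => //.
by rewrite /unitary_mx /= adj1 mulmx1.
Qed.

(* The matrix is a Householder reflection followed by a phase. *)
Lemma unitary_extension (x : nat -> C) : dotn q.+1 x x = 1 ->
  exists2 A, unitary_mx A & forall i, (i < q.+1)%N -> column A i = x i.
Proof.
move=> x1.
pose r := nrm (x 0%N).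
have [w ww wx] : exists2 w : C, w * w^* = 1 & w * r%:C = x 0%N.
  have [r0|r0] := eqVneq r 0.
    exists 1; first by rewrite cconj1 mulr1.
    by rewrite r0 rmorph0 mulr0; apply/esym/nrm_eq0.
  have r0C : r%:C != 0 :> C by rewrite (inj_eq (@complexI R)).
  exists (x 0%N * (r^-1)%:C); last by rewrite -mulrA -rmorphM /= mulVf // mulr1.
  rewrite cconjM conj_realC mulrACA -cabs2E -sqr_nrm -/r -!rmorphM /= -expr2 -exprMn divff //.
  by rewrite expr1n.
(* As w is the phase of x_0, v = x - w e_1 has squared length 2 (1 - |x_0|) = 2d, so the coefficient
   2/(v . v) of the reflection is d^-1. *)
pose v (i : 'I_q.+1) : C := x i - w * (i == ord0)%:R.
pose d : C := 1 - r%:C.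
have vv : \sum_i v i * (v i)^* = 2 * d.
  have vE i : v i * (v i)^* = x i * (x i)^* - (w^* * x 0%N + w * (x 0%N)^* - 1) * (i == ord0)%:R.
    rewrite /v cconjB cconjM conj_nat; case: eqP => [->|_] /=.
      by rewrite !mulr1 -ww; move: (x 0%N) (x 0%N)^* w^* => * ; ring.
    by rewrite !mulr0 !subr0.
  rewrite (eq_bigr _ (fun i _ => vE i)) sumrB -mulr_sumr.
  rewrite (@sum1_delta _ _ (fun i : 'I_q.+1 => (i == ord0)%:R) ord0).
    rewrite -[\sum_i _]/(dotn q.+1 x x) x1 -wx cconjM conj_realC mulr1 /d.
    by rewrite mulrA [w^* * w]mulrC mulrA ww mul1r; ring.
  by move=> i /negbTE ->.
have v0 : v ord0 = - (w * d) by rewrite /v /d mulr1 -wx; ring.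
have dJ : d^* = d by rewrite /d cconjB cconj1 conj_realC.
(* If d = 0 then v = 0, and with 0^-1 = 0 the reflection degenerates to the identity, as it
   should. *)
have dv i : d^-1 * d * v i = v i.
  have [d0|d0] := eqVneq d 0; last by rewrite mulVf // mul1r.
  suff -> : v i = 0 by rewrite mulr0.
  rewrite d0 mulr0 in vv; apply/nrm_eq0/eqP; rewrite -sqrf_eq0 sqr_nrm.
  rewrite -(inj_eq (@complexI R)) cabs2E.
  have /psumr_eq0P h : forall i, true -> 0 <= v i * (v i)^* by move=> k _; exact: mulcJ_ge0.
  by apply/eqP; exact: h.
have xv (i : 'I_q.+1) : x i = w * (i == ord0)%:R + v i by rewrite /v addrC subrK.
clearbody v d.
have tJ : (d^-1)^* = d^-1.
  exact: (etrans (@fmorphV _ _ (@cconj R) d) (congr1 GRing.inv dJ)).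
have td : d^-1 * d^-1 * d = d^-1.
  by have [->|d0] := eqVneq d 0; [rewrite invr0 mulr0|rewrite mulfVK].
pose A : 'M[C]_q.+1 := \matrix_(i, j) (w * ((i == j)%:R - d^-1 * (v i * (v j)^*))).
exists A; last first.
  move=> i iq; rewrite /column mxE v0 cconjN cconjM dJ.
  rewrite -(inordK iq) xv inord_val.
  have phase (e t y w' : C) : w * (e - t * (y * - (w' * d))) = w * e + w * w' * (t * d * y) by ring.
  by rewrite phase ww mul1r dv.
apply/matrixP => i j; rewrite !mxE.
have AE k : A i k * (adjmx A) k j =
    (i == k)%:R * (k == j)%:R - d^-1 * v i * ((v k)^* * (k == j)%:R)
    - d^-1 * (v j)^* * (v k * (i == k)%:R) + d^-1 * d^-1 * (v i * (v j)^*) * (v k * (v k)^*).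
  rewrite /adjmx !mxE cconjM cconjB cconjM tJ cconjM cconjK conj_nat [j == k]eq_sym mulrACA ww mul1r.
  by move: (_%:R) (_%:R) (v k) (v k)^* (v i) (v j)^* (d^-1) => * ; ring.
rewrite (eq_bigr _ (fun k _ => AE k)) !big_split /= !sumrN -!mulr_sumr vv.
rewrite (@sum1_delta _ _ (fun k => (i == k)%:R * (k == j)%:R) i); last first.
  by move=> k ki; rewrite eq_sym (negbTE ki) mul0r.
rewrite (@sum1_delta _ _ (fun k => (v k)^* * (k == j)%:R) j); last first.
  by move=> k /negbTE ->; rewrite mulr0.
rewrite (@sum1_delta _ _ (fun k => v k * (i == k)%:R) i); last first.
  by move=> k ki; rewrite eq_sym (negbTE ki) mulr0.
rewrite !eqxx !mulr1 mul1r.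
have -> : d^-1 * d^-1 * (v i * (v j)^*) * (2 * d) = 2 * d^-1 * v i * (v j)^*.
  by rewrite -[X in _ = 2 * X * _ * _]td; move: (d^-1) (v _) (v _)^* => * ; ring.
by move: (d^-1) (v _) (v _)^* (_%:R) => * ; ring.
Qed.

End UnitaryMatrices.

(** * The coefficients as iterated integrals *)

Section Integral.
Variable R : realType.
Local Notation C := R[i].

Lemma cintegralE (D : set R) (h : R -> C) : cintegral D h =
  Complex (Rintegral lebesgue_measure D (fun x => complex.Re (h x)))
          (Rintegral lebesgue_measure D (fun x => complex.Im (h x))).
Proof.
rewrite /cintegral; move: (Rintegral _ _ _) (Rintegral _ _ _) => x y.
by apply/eqP; rewrite eq_complex /= !(mul0r, mulr0, mul1r, subr0, add0r, addr0) !eqxx.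
Qed.

Lemma realMC (x u v : R) : Complex u v * x%:C = Complex (u * x) (v * x).
Proof. by rewrite mulrC realCM ![x * _]mulrC. Qed.

Lemma coef_integral a m n (F : C -> C) :
  (Nqmn R a.+2 m n * (a.+2 - 1)%:R / pi)%:C *
    cintegral [set r : R | 0 <= r <= 1] (fun r =>
      cintegral [set t : R | 0 <= t <= 2 * pi] (fun t =>
        F (polar r t) * cconj (discR (a.+2 - 2)%:R m n (polar r t))
        * (r * (1 - r ^+ 2) ^+ (a.+2 - 2))%:C)) = coef a F m n.
Proof.
have -> : (a.+2 - 2 = a)%N by rewrite !subSS subn0.
rewrite cintegralE.
pose G z := F z * (disc_poly a m n z z^*)^*.
have E r t : F (polar r t) * cconj (discR a%:R m n (polar r t)) * (r * (1 - r ^+ 2) ^+ a)%:C =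
    Complex (complex.Re (G (polar r t)) * weight a r) (complex.Im (G (polar r t)) * weight a r).
  by rewrite discRE -/(G _) -realMC; case: (G _).
have -> : (fun r => complex.Re (cintegral [set t : R | 0 <= t <= 2 * pi] (fun t =>
        F (polar r t) * cconj (discR a%:R m n (polar r t)) * (r * (1 - r ^+ 2) ^+ a)%:C))) =
   fun r => Rintegral lebesgue_measure [set t : R | 0 <= t <= 2 * pi]
     (fun t => complex.Re (G (polar r t)) * weight a r).
  apply/funext => r; rewrite cintegralE /=; congr Rintegral.
  by apply/funext => t; rewrite E.
have -> : (fun r => complex.Im (cintegral [set t : R | 0 <= t <= 2 * pi] (fun t =>
        F (polar r t) * cconj (discR a%:R m n (polar r t)) * (r * (1 - r ^+ 2) ^+ a)%:C))) =
   fun r => Rintegral lebesgue_measure [set t : R | 0 <= t <= 2 * pi]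
     (fun t => complex.Im (G (polar r t)) * weight a r).
  apply/funext => r; rewrite cintegralE /=; congr Rintegral.
  by apply/funext => t; rewrite E.
rewrite -/(rmean a (fun z => complex.Re (G z))) -/(rmean a (fun z => complex.Im (G z))).
rewrite /coef /dmean /nmean -!/(G _) -[Complex (_ * _) _]realCM mulrA -rmorphM /=.
congr (_%:C * _).
rewrite /Nqmn /disc_norm !addnS !subSS !subn0.
by rewrite mulrA.
Qed.

End Integral.

(** * Positive definite functions on U(q) x L *)

Section PositiveDefiniteFunctions.
Variables (R : realType) (H : topologicalType).
Variables (mul : H -> H -> H) (inv : H -> H) (D : set H) (g : H -> R[i]).
Local Notation C := R[i].

Lemma pos_def_psd (T : finType) (x : T -> H) : pos_def_on mul inv D g ->
  (forall j, D (x j)) -> psd (fun j k => g (mul (inv (x j)) (x k))).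
Proof.
move=> [_ hg] Dx c.
have bij : {on predT, bijective (@enum_val T predT)} := onW_bij _ (enum_val_bij T).
have := hg _ (fun i : 'I_#|T| => x (enum_val i)) (fun i => c (enum_val i)) (fun i => Dx _).
congr (0 <= _); rewrite [RHS](reindex _ bij); apply: eq_bigr => j _.
by rewrite [RHS](reindex _ bij).
Qed.

End PositiveDefiniteFunctions.

Section Group.
Variables (R : realType) (L : topologicalType).
Variables (mulL : L -> L -> L) (invL : L -> L) (eL : L).
Hypothesis hL : locally_compact_group mulL invL eL.
Local Notation C := R[i].

Lemma group_mulVg u : mulL (invL u) u = eL.
Proof. by case: hL => _ [_ /(_ u)[]]. Qed.

Lemma group_inv1 : invL eL = eL.
Proof. by case: hL => _ [/(_ (invL eL))[_ h] _] _ _ _; rewrite -{1}h group_mulVg. Qed.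

Lemma group_mul1g u : mulL eL u = u.
Proof. by case: hL => _ [/(_ u)[]]. Qed.

Variable phi : L -> C.
Hypothesis hphi : pos_def_on mulL invL setT phi.

Lemma pos_def_ge0 : 0 <= phi eL.
Proof.
have [_ /(_ 1%N (fun=> eL) (fun=> 1) (fun=> I))] := hphi.
by rewrite !big_ord1 group_mulVg mulr1 cconj1 mulr1.
Qed.

Lemma pos_def_bound u : nrm (phi u) <= nrm (phi eL).
Proof.
have := pos_def_psd (T := bool) (x := fun b => if b then u else eL) hphi (fun=> I).
move=> /(@psd2 _ _ (nrm (phi eL))); rewrite !group_mulVg group_inv1 group_mul1g.
by apply; exact: (ge0C pos_def_ge0).
Qed.

End Group.

Section DiscFunctions.
Variables (R : realType) (L : topologicalType) (f : R[i] * L -> R[i]).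
Local Notation C := R[i].
Hypothesis hf : {within [set p : C * L | `|p.1| <= 1], continuous f}.

Lemma near_disc z u (e : R) : cdisc z -> 0 < e ->
  \forall p \near ((z, u) : C * L), cdisc p.1 -> nrm (f (z, u) - f p) < e.
Proof.
move=> Dz e0; have /subspace_continuousP/(_ (z, u) Dz) h := hf.
by have /cvgCP/(_ e e0) := h; rewrite near_withinE.
Qed.

Lemma contD_section u : contD (fun z => f (z, u)).
Proof.
apply/contDP => z Dz e e0.
have [[A B] [/= /nbhsCP[d d0 hd] hB] AB] := near_disc u Dz e0.
by exists d => // w Dw zw; apply: (AB (w, u)) => //; split; [exact: hd|exact: nbhs_singleton].
Qed.

(** Compactness of the disc makes continuity in the group variable uniform in z; the continuity of
    the coefficients rests on this. *)
Lemma near_section u (e : R) : 0 < e ->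
  \forall v \near u, forall z, cdisc z -> nrm (f (z, u) - f (z, v)) < e.
Proof.
move=> e0; have e2 : 0 < e / 2 by rewrite divr_gt0.
have /compact_near_coveringP h := @compact_cdisc R.
have k := h L (nbhs u) (fun v z => cdisc z -> nrm (f (z, u) - f (z, v)) < e) (nbhs_filter u).
apply: filterS (k _) => [v hv z Dz|z Dz]; first exact: (hv z Dz Dz).
have [[A B] [/= hA hB] AB] := near_disc u Dz e2.
exists (A, B) => // -[w v] /= [hw hv] Dw.
apply: le_lt_trans (nrm_tri (f (z, u)) _ _) _; rewrite [e]splitr nrmBC; apply: ltrD.
  by apply: (AB (w, u)) => //; split => //; exact: nbhs_singleton.
exact: (AB (w, v)).
Qed.

End DiscFunctions.

Section Expansion.
Variables (R : realType) (a : nat) (L : topologicalType) (f : R[i] * L -> R[i]).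
Variables (mulL : L -> L -> L) (invL : L -> L) (eL : L).
Local Notation C := R[i].
Hypothesis hf : {within [set p : C * L | `|p.1| <= 1], continuous f}.
Hypothesis hL : locally_compact_group mulL invL eL.

Definition scoef (m n : nat) (u : L) : C := coef a (fun z => f (z, u)) m n.

Lemma continuous_scoef m n : continuous (scoef m n).
Proof.
move=> u; apply/cvgCP => e e0; have N0 := disc_norm_gt0 R a m n.
have d0 : 0 < e / (disc_norm R a m n * 4) by rewrite divr_gt0 // mulr_gt0.
apply: filterS (near_section hf u d0) => v hv.
apply: le_lt_trans (@nrm_coef_diff R a _ _ m n (e / (disc_norm R a m n * 4)) _ _ _) _.
- exact: (contD_section hf).
- exact: (contD_section hf).
- by move=> z Dz; exact: ltW (hv z Dz).
have -> : disc_norm R a m n * (2 * (e / (disc_norm R a m n * 4))) = e / 2.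
  by field; rewrite gt_eqF.
by rewrite ltr_pdivrMr // mulr_natr mulr2n ltrDl.
Qed.

(** By linearity the quadratic form of a coefficient function on L is a coefficient of one function
    on the disc, so that [coef_ge0] decides its sign. *)
Lemma coef_family (T : finType) (w : T -> T -> L) (d : T -> C) m n :
  coef a (fun z => \sum_s \sum_t f (z, w s t) * d s * (d t)^*) m n =
  \sum_s \sum_t scoef m n (w s t) * d s * (d t)^*.
Proof.
have cf s t := contD_section hf (w s t).
rewrite /coef.
have -> : (fun z : C => (\sum_s \sum_t f (z, w s t) * d s * (d t)^*) * (disc_poly a m n z z^*)^*) =
   fun z => \sum_s \sum_t (d s * (d t)^*) * (f (z, w s t) * (disc_poly a m n z z^*)^*).
  apply/funext => z; rewrite mulr_suml; apply: eq_bigr => s _.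
  rewrite mulr_suml; apply: eq_bigr => t _.
  by move: (f _) (d s) (d t)^* (_ ^*) => x y y' v; ring.
rewrite dmean_sum; last by move=> s; apply: contD_sum => t; exact/contDZ/contD_coef.
rewrite mulr_sumr; apply: eq_bigr => s _.
rewrite dmean_sum; last by move=> t; exact/contDZ/contD_coef.
rewrite mulr_sumr; apply: eq_bigr => t _.
rewrite dmeanZ; last exact: contD_coef.
by rewrite /scoef /coef [_ * dmean _ _]mulrC !mulrA.
Qed.

Local Notation q := a.+2.

Let mass (phi : nat -> nat -> L -> C) N : R := \sum_(m < N) \sum_(n < N) nrm (phi m n eL).

Lemma massE (phi : nat -> nat -> L -> C) N : (forall m n, 0 <= phi m n eL) ->
  \sum_(m < N) \sum_(n < N) phi m n eL = (mass phi N)%:C.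
Proof.
move=> phi0; rewrite /mass rmorph_sum; apply: eq_bigr => m _.
by rewrite rmorph_sum; apply: eq_bigr => n _; exact: ge0C.
Qed.

Lemma disc_psumE (phi : nat -> nat -> L -> C) N z u :
  disc_psum q phi N z u = dpsum a (fun m n => phi m n u) N z.
Proof.
rewrite /disc_psum /dpsum; have -> : (q - 2 = a)%N by rewrite !subSS subn0.
by apply: eq_bigr => m _; apply: eq_bigr => n _; rewrite discRE.
Qed.

Section Forward.
Hypothesis hP : pos_def_on (@UL_mul R L mulL q) (@UL_inv R L invL q) (@UL_set R L q)
  (fun p => f (a11 p.1, p.2)).

Lemma psd_sphere_family (T : finType) (u : T -> L) (d : T -> C) :
  psd_sphere a (fun z => \sum_s \sum_t f (z, mulL (invL (u s)) (u t)) * d s * (d t)^*).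
Proof.
move=> J X X1.
have /choice[A hA] j : exists A : 'M[C]_q, unitary_mx A /\
    forall i, (i < q)%N -> column A i = X j i.
  by have [A A1 A2] := unitary_extension (X1 j); exists A.
have EA j k : a11 (adjmx (A j) *m A k) = dotn q (X k) (X j).
  by rewrite a11_adj; apply: eq_bigr => i _; rewrite !(proj2 (hA _)).
move=> c.
(* Testing at all pairs (A_j, u_s) with product coefficients c_j d_s separates the sphere variable
   from the group variable. *)
have := pos_def_psd (T := (J * T)%type) (x := fun p => (A p.1, u p.2)) hP (fun p => proj1 (hA p.1)).
move=> /(_ (fun p => c p.1 * d p.2)); congr (0 <= _).
have -> : \sum_(p : J * T) \sum_(r : J * T)
   f (a11 (UL_mul mulL (UL_inv invL (A p.1, u p.2)) (A r.1, u r.2)).1,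
      (UL_mul mulL (UL_inv invL (A p.1, u p.2)) (A r.1, u r.2)).2) *
   (c p.1 * d p.2) * (c r.1 * d r.2)^* =
   \sum_j \sum_s \sum_k \sum_t f (dotn q (X k) (X j), mulL (invL (u s)) (u t)) *
     (c j * d s) * (c k * d t)^*.
  rewrite [RHS]pair_bigA; apply: eq_bigr => -[j s] _.
  rewrite [RHS]pair_bigA; apply: eq_bigr => -[k t] _.
  by rewrite -EA.
apply: eq_bigr => j _; rewrite exchange_big; apply: eq_bigr => k _.
rewrite !mulr_suml; apply: eq_bigr => s _; rewrite !mulr_suml; apply: eq_bigr => t _.
by rewrite cconjM; move: (f _) (d s) (d t)^* (c j) (c k)^* => x y y' v v'; ring.
Qed.

Lemma pos_def_scoef m n : pos_def_on mulL invL setT (scoef m n).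
Proof.
split; first by apply: continuous_subspaceT => u; exact: continuous_scoef.
move=> k u d _; rewrite -coef_family; apply: coef_ge0; last exact: psd_sphere_family.
apply: contD_sum => s; apply: contD_sum => t.
apply: contDM; last exact: contD_cst.
by apply: contDM; [exact: contD_section|exact: contD_cst].
Qed.

Lemma psd_sphere_unit : psd_sphere a (fun z => f (z, eL)).
Proof.
have := @psd_sphere_family 'I_1 (fun=> eL) (fun=> 1).
congr (psd_sphere _ _); apply/funext => z.
by rewrite !big_ord1 (group_mulVg hL) cconj1 !mulr1.
Qed.

Lemma disc_expansion_scoef : disc_expansion mulL invL eL q f scoef.
Proof.
have scoef0 m n : 0 <= scoef m n eL := pos_def_ge0 hL (pos_def_scoef m n).
have massf N : mass scoef N <= complex.Re (f (1, eL)).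
  have := coef_sum_le N (contD_section hf eL) psd_sphere_unit.
  rewrite -[leLHS]/(\sum_(m < N) \sum_(n < N) scoef m n eL) massE //.
  by rewrite lecE => /andP[_].
have cmass : cvgn (mass scoef).
  apply: nondecreasing_is_cvgn; last first.
    by exists (complex.Re (f (1, eL))) => _ [N _ <-]; exact: massf.
  move=> k l kl; apply: (@ler_sum2_widen _ (fun m n => nrm (scoef m n eL)) _ _ kl) => m n.
  exact: nrm_ge0.
have /cvg_ex[t ct] := cmass.
split; first exact: pos_def_scoef.
split.
  apply/cvg_ex; exists (t%:C); under eq_fun do rewrite massE //.
  exact: cvg_realC.
move=> z u Dz; under eq_fun do rewrite disc_psumE.
have hb m n := pos_def_bound hL (pos_def_scoef m n) u.
exact: (disc_expand hb (contD_section hf u) (fun m n => erefl) ct Dz).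
Qed.

End Forward.

Section Backward.
Variable phi : nat -> nat -> L -> C.
Hypothesis hE : disc_expansion mulL invL eL q f phi.

Let phi_bound u m n : nrm (phi m n u) <= nrm (phi m n eL).
Proof. exact: (pos_def_bound hL (proj1 hE m n) u). Qed.

Let cvg_mass : exists t : R, \sum_(m < N) \sum_(n < N) nrm (phi m n eL) @[N --> \oo] --> t.
Proof.
have [hphi [/cvg_ex[l cl] _]] := hE.
have phi0 m n : 0 <= phi m n eL := pos_def_ge0 hL (hphi m n).
exists (complex.Re l).
have -> : (fun N => \sum_(m < N) \sum_(n < N) nrm (phi m n eL)) =
    fun N => complex.Re (\sum_(m < N) \sum_(n < N) phi m n eL).
  by apply/funext => N; rewrite massE.
exact: cvg_Re cl.
Qed.

Let cvg_dpsum z u : cdisc z -> dpsum a (fun m n => phi m n u) N z @[N --> \oo] --> f (z, u).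
Proof.
have [_ [_ h]] := hE; move=> Dz; have := h z u Dz.
by under eq_fun do rewrite disc_psumE.
Qed.

Lemma expansion_uniform (eps : R) : 0 < eps ->
  \forall N \near \oo, forall (z : C) (u : L), `|z| <= 1 ->
    `|f (z, u) - disc_psum q phi N z u| < eps%:C.
Proof.
move=> e0; have [t ct] := cvg_mass.
have c1 : (fun k => t - mass phi k) @ \oo --> t - t by apply: cvgB => //; exact: cvg_cst.
rewrite subrr in c1; have /cvgr_lt/(_ _ e0) := c1; apply: filterS => N hN z u Dz.
rewrite normE ltcR disc_psumE; apply: le_lt_trans hN.
exact: (dpsum_tail (phi_bound u) N Dz (cvg_dpsum Dz) ct).
Qed.

Lemma expansion_coef m n u : phi m n u = scoef m n u.
Proof.
have [t ct] := cvg_mass.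
exact/esym/(coef_uniform (phi_bound u) m n (contD_section hf u) ct (fun z => @cvg_dpsum z u)).
Qed.

Lemma continuous_a11 : continuous (@a11 R q).
Proof.
have -> : @a11 R q = fun A => A ord0 ord0 by apply/funext => A; exact: a11E.
exact: coord_continuous.
Qed.

Lemma expansion_pos_def : pos_def_on (@UL_mul R L mulL q) (@UL_inv R L invL q) (@UL_set R L q)
  (fun p => f (a11 p.1, p.2)).
Proof.
split.
  apply/subspace_continuousP => -[A u] hA; apply/cvgCP => e e0.
  have [[V W] [/= hV hW] VW] := near_disc hf u (cdisc_a11 hA) e0.
  rewrite near_withinE; exists ((@a11 R q) @^-1` V, W) => /=.
    by split => //; exact: (continuous_a11 hV).
  by move=> [B v] [/= BV vW] hB; apply: (VW (a11 B, v)) => //; exact: cdisc_a11.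
move=> k x c Dx.
have psdK : psd (fun i j : 'I_k => f (dotn q (column (x j).1) (column (x i).1),
    mulL (invL (x i).2) (x j).2)).
  have Xu i : dotn q (column (x i).1) (column (x i).1) = 1 by exact: column_unit (Dx i).
  apply: (@psd_cvg _ _ (fun N i j => dpsum a (fun m n => phi m n (mulL (invL (x i).2) (x j).2)) N
      (dotn q (column (x j).1) (column (x i).1)))) => [N|i j]; last first.
    exact: (cvg_dpsum (cdisc_dotn (Xu j) (Xu i))).
  apply: psd_sum => m; apply: psd_sum => n; apply: psd_disc_poly => //.
  exact: (pos_def_psd (x := fun i => (x i).2) (proj1 hE m n) (fun=> I)).
have := psdK c; congr (0 <= _); apply: eq_bigr => i _; apply: eq_bigr => j _.
by rewrite -a11_adj.
Qed.

End Backward.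
End Expansion.

Local Open Scope complex_scope.

Theorem theorem6p1 (R : realType) (q : nat) (hq : (2 <= q)%N)
  (L : topologicalType) (mulL : L -> L -> L) (invL : L -> L) (eL : L)
  (hL : locally_compact_group mulL invL eL)
  (f : R[i] * L -> R[i])
  (hf : {within [set p : R[i] * L | `|p.1| <= 1], continuous f}) :
  (pos_def_on (@UL_mul R L mulL q) (@UL_inv R L invL q) (@UL_set R L q)
      (fun p => f (a11 p.1, p.2))
   <-> exists phi : nat -> nat -> L -> R[i], disc_expansion mulL invL eL q f phi)
  /\
  (forall phi : nat -> nat -> L -> R[i], disc_expansion mulL invL eL q f phi ->
     (* uniform convergence on the closed disc times L *)
     (forall eps : R, 0 < eps ->
        \forall N \near \oo, forall (z : R[i]) (u : L), `|z| <= 1 ->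
          `|f (z, u) - disc_psum q phi N z u| < eps%:C)
     /\
     (* the coefficient formula *)
     (forall (m n : nat) (u : L),
        phi m n u =
        (Nqmn R q m n * (q - 1)%:R / pi)%:C *
        cintegral [set r : R | 0 <= r <= 1] (fun r =>
          cintegral [set t : R | 0 <= t <= 2 * pi] (fun t =>
            f (polar r t, u) * cconj (discR (q - 2)%:R m n (polar r t))
            * (r * (1 - r ^+ 2) ^+ (q - 2))%:C)))).
Proof.
move: hq; case: q => [|[|a]] hq2; [by []|by []|].
split.
  split; last by case=> phi hE; exact: (expansion_pos_def hf hE).
  by move=> hP; exists (scoef a f); exact: (disc_expansion_scoef hf hL hP).
move=> phi hE; split; first by move=> eps e0; exact: (expansion_uniform hL hE e0).
move=> m n u; rewrite (expansion_coef hf hL hE) /scoef.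
exact/esym/(@coef_integral R a m n (fun z => f (z, u))).
Qed.
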